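(* Let $N>2$ and let $G$ be a finite simple graph with $V\ge N+1$ vertices. Consider the SU($N$) Hubbard model on $G$ in the limit $U\to+\infty$ with exactly one hole, i.e. the operator $H_\infty=P\big(\sum_{i,j}\sum_{\alpha=1}^N t_{ij}c^\dagger_{i\alpha}c_{j\alpha}\big)P$ on the space $\mathcal H_1^{(N)}$ defined in the context. Suppose that $G$ is non-separable, $G$ is not the $\theta_0$-graph, $G$ is not a polygon with $V\ge4$ vertices, and, if $G$ is bipartite, additionally $V\ge N+2$. Then the connectivity condition holds in every sector of fixed flavor occupation numbers, and the ground state of $H_\infty$ lies in the fully symmetric (one-row Young diagram) irreducible representation of SU($N$) and is unique up to the SU($N$) degeneracy, i.e. the ground space is a single copy of this irreducible representation.
   Context: Vertices of $G$ are $1,\dots,V$; $t_{ij}=t_{ji}>0$ if $\{i,j\}$ is an edge and $t_{ij}=0$ otherwise. The SU($N$) Hubbard Hamiltonian is $H=\sum_{i,j}\sum_{\alpha=1}^N t_{ij}c^\dagger_{i\alpha}c_{j\alpha}+\frac U2\sum_i n_i(n_i-1)$, where $c_{i\alpha}$ are fermion operators for $N$-component fermions (fundamental representation of SU($N$)) and $n_i=\sum_\alpha c^\dagger_{i\alpha}c_{i\alpha}$. $\mathcal H_1^{(N)}$ is the space spanned by states with exactly $V-1$ fermions and at most one fermion per vertex; $P$ is the orthogonal projection onto it. Basis: $|h,\alpha\rangle=(-1)^h\prod_{i\ne h}c^\dagger_{i,\alpha_i}|0\rangle$ (product in increasing order of $i$), with $h$ the hole position and $\alpha_i\in\{1,\dots,N\}$.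 A sector of fixed flavor occupation numbers is the span of basis states with prescribed numbers $m_1,\dots,m_N\ge 0$ ($\sum m_\alpha=V-1$) of fermions of each flavor. Connectivity condition in a sector: for any two basis states $b,b'$ in it there exists $n\ge 1$ with $\langle b'|H_\infty^n|b\rangle\ne0$. A graph is non-separable if it is connected and remains connected after deleting any single vertex with its incident edges. A polygon with $V$ vertices is the cycle graph $C_V$. The $\theta_0$-graph is the graph on 7 vertices consisting of a hexagon (6-cycle) $a_1a_2a_3a_4a_5a_6$ together with one extra vertex $b$ adjacent exactly to the two opposite hexagon vertices $a_1$ and $a_4$. *)

(* Defs.v *)
From HB Require Import structures.
From mathcomp Require Import all_boot all_order all_algebra.
Set Implicit Arguments. Unset Strict Implicit. Unset Printing Implicit Defensive.
Import Order.TTheory GRing.Theory Num.Theory.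
Local Open Scope ring_scope.

Definition simple_graph (V : nat) (e : rel 'I_V) := symmetric e /\ irreflexive e.

Definition graph_connected (V : nat) (e : rel 'I_V) :=
  forall x y : 'I_V, connect e x y.

Definition nonseparable (V : nat) (e : rel 'I_V) :=
  graph_connected e /\
  forall v x y : 'I_V, x != v -> y != v ->
    connect [rel a b | [&& e a b, a != v & b != v]] x y.

Definition bipartite (V : nat) (e : rel 'I_V) :=
  exists col : 'I_V -> bool, forall x y, e x y -> col x != col y.

Definition cycle_rel (V : nat) : rel 'I_V :=
  fun i j => (j == (i.+1 %% V)%N :> nat) || (i == (j.+1 %% V)%N :> nat).

Definition is_polygon (V : nat) (e : rel 'I_V) :=
  exists f : 'I_V -> 'I_V, bijective f /\ forall x y, e x y = cycle_rel (f x) (f y).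

(* theta_0 graph on 'I_7: hexagon 0-1-2-3-4-5-0 (= a1..a6), vertex 6 (= b)
   adjacent exactly to 0 (= a1) and 3 (= a4). *)
Definition theta0_rel : rel 'I_7 :=
  fun i j =>
    let hex (a b : nat) := (a < 6)%N && (b < 6)%N &&
                           ((b == (a.+1 %% 6))%N || (a == (b.+1 %% 6))%N) in
    let bb (a b : nat) := (a == 6)%N && ((b == 0)%N || (b == 3)%N) in
    [|| hex i j, bb i j | bb j i].

Definition is_theta0 (V : nat) (e : rel 'I_V) :=
  exists f : 'I_V -> 'I_7, bijective f /\ forall x y, e x y = theta0_rel (f x) (f y).

(* Modes (i, alpha) : 'I_V * 'I_N.  Fock basis states = finite sets of occupied
   modes; |S> := c^dag_{m1} ... c^dag_{mk} |0> with m1 < ... < mk in the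
   lexicographic order (site first, then flavor).  Vectors are column vectors
   indexed by enum_rank of S; operators are matrices with entry (S', S) = <S'|O|S>. *)

Notation fock V N := {set ('I_V * 'I_N)}.
Notation dimF V N := #|{: fock V N}|.

Section Fock.
Variables (C : numClosedFieldType) (V N : nat).

Definition fstate (i : 'I_(dimF V N)) : fock V N := enum_val i.

Definition mode_lt (a b : 'I_V * 'I_N) : bool :=
  (a.1 < b.1)%N || ((a.1 == b.1) && (a.2 < b.2)%N).

Definition jw_sign (S : fock V N) (m : 'I_V * 'I_N) : C :=
  (-1) ^+ #|[set m' in S | mode_lt m' m]|.

Definition cdag (m : 'I_V * 'I_N) : 'M[C]_(dimF V N) :=
  \matrix_(i, j)
    (let S' := fstate i in let S := fstate j in
     if (m \notin S) && (S' == m |: S) then jw_sign S m else 0).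

Definition cann (m : 'I_V * 'I_N) : 'M[C]_(dimF V N) :=
  \matrix_(i, j)
    (let S' := fstate i in let S := fstate j in
     if (m \in S) && (S' == S :\ m) then jw_sign S m else 0).

Definition vacuum : 'cV[C]_(dimF V N) :=
  \col_i ((fstate i == set0)%:R).

Definition hopping (t : 'I_V -> 'I_V -> C) : 'M[C]_(dimF V N) :=
  \sum_(i < V) \sum_(j < V) \sum_(a < N) t i j *: (cdag (i, a) *m cann (j, a)).

Definition inH1 (S : fock V N) : bool :=
  (#|S| == V.-1) && [forall i : 'I_V, #|[set a : 'I_N | (i, a) \in S]| <= 1]%N.

Definition Pproj : 'M[C]_(dimF V N) :=
  \matrix_(i, j) (((i == j) && inH1 (fstate i))%:R).

Definition Hinf (t : 'I_V -> 'I_V -> C) : 'M[C]_(dimF V N) :=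
  Pproj *m hopping t *m Pproj.

(* basis state |h, alpha> = (-1)^h prod_{i <> h, increasing} c^dag_{i, alpha_i} |0>;
   the value alpha h is irrelevant. *)
Definition hbasis (h : 'I_V) (alpha : 'I_V -> 'I_N) : 'cV[C]_(dimF V N) :=
  (-1) ^+ h *:
    foldr (fun i v => cdag (i, alpha i) *m v) vacuum [seq i <- enum 'I_V | i != h].

Definition flavor_count (h : 'I_V) (alpha : 'I_V -> 'I_N) (b : 'I_N) : nat :=
  #|[set i : 'I_V | (i != h) && (alpha i == b)]|.

Definition dotc (u v : 'cV[C]_(dimF V N)) : C :=
  \sum_i (u i 0)^* * v i 0.

Definition connectivity (t : 'I_V -> 'I_V -> C) (m : 'I_N -> nat) : Prop :=
  forall (h h' : 'I_V) (alpha alpha' : 'I_V -> 'I_N),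
    (forall b, flavor_count h alpha b = m b) ->
    (forall b, flavor_count h' alpha' b = m b) ->
    exists n : nat, (0 < n)%N /\
      dotc (hbasis h' alpha') (iter n (mulmx (Hinf t)) (hbasis h alpha)) != 0.

Definition in_H1 (v : 'cV[C]_(dimF V N)) : Prop := Pproj *m v = v.

Definition ground_energy (t : 'I_V -> 'I_V -> C) (E0 : C) : Prop :=
  (exists v, in_H1 v /\ v != 0 /\ Hinf t *m v = E0 *: v) /\
  (forall (lam : C) v, in_H1 v -> v != 0 -> Hinf t *m v = lam *: v -> E0 <= lam).

Definition ground_state (t : 'I_V -> 'I_V -> C) (E0 : C) (v : 'cV[C]_(dimF V N)) : Prop :=
  in_H1 v /\ Hinf t *m v = E0 *: v.

Definition Flav (a b : 'I_N) : 'M[C]_(dimF V N) :=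
  \sum_(i < V) cdag (i, a) *m cann (i, b).

(* occupation vectors m with sum = V-1: index set of the monomial basis x^m of the
   fully symmetric irrep Sym^{V-1}(C^N) (one-row Young diagram with V-1 boxes) *)
Definition Occ : {set {ffun 'I_N -> 'I_V}} :=
  [set m : {ffun 'I_N -> 'I_V} | (\sum_(b < N) (m b : nat) == V.-1)%N].

Definition shifted (m m' : {ffun 'I_N -> 'I_V}) (a b : 'I_N) : bool :=
  [&& (m' a == (m a).+1 :> nat), ((m' b).+1 == m b :> nat) &
      [forall c, (c != a) && (c != b) ==> (m' c == m c)]].

(* The ground space (eigenspace of E0 in H_1) is a single copy of the fully
   symmetric irreducible representation: it has a basis (w_m)_{m in Occ} on which
   the flavor generators act exactly as E_{ab} = x_a d/dx_b acts on monomials x^m: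
     F^{ab} w_m = m_b w_{m + delta_a - delta_b}  (a <> b),   F^{aa} w_m = m_a w_m. *)
Definition ground_space_is_symmetric_irrep (t : 'I_V -> 'I_V -> C) (E0 : C) : Prop :=
  exists w : {ffun 'I_N -> 'I_V} -> 'cV[C]_(dimF V N),
    [/\ forall m, m \in Occ -> ground_state t E0 (w m),
        forall c : {ffun 'I_N -> 'I_V} -> C,
          \sum_(m in Occ) c m *: w m = 0 -> forall m, m \in Occ -> c m = 0,
        forall v, ground_state t E0 v ->
          exists c : {ffun 'I_N -> 'I_V} -> C, v = \sum_(m in Occ) c m *: w m,
        forall m a, m \in Occ -> Flav a a *m w m = (m a)%:R *: w m
      & forall m a b, m \in Occ -> a != b ->
          Flav a b *m w m = \sum_(m' in Occ | shifted m m' a b) (m b)%:R *: w m'].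

End Fock.

(* Main.v *)
Require Import Defs.
From HB Require Import structures.
From mathcomp Require Import all_boot all_order all_algebra all_fingroup.
From mathcomp Require Import sesquilinear spectral zify ring.
Set Implicit Arguments. Unset Strict Implicit. Unset Printing Implicit Defensive.
Import Order.TTheory GRing.Theory Num.Theory.
Local Open Scope ring_scope.

(** With the signs [(-1)^h] of the basis, the Hamiltonian sends a configuration
    to the configurations obtained by one hole move, all with negative
    coefficients.  Connectivity of a sector is therefore a 15-puzzle with
    coloured tokens, and Wilson's theorem is needed: on a non-separable graph
    other than a polygon and theta0, closed hole walks realise every even
    permutation of the tokens.  For this, call a connected vertex set good if
    the hole can perform every 3-cycle of the other tokens of the set; going
    around an ear and conjugating a 3-cycle enlarges a good set by one vertex.
    A cycle with an ear or a chord is a theta graph, and the commutator of the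
    rotations along two of its cycles is a 3-cycle or a double transposition.
    In the second case, a suitable rotation conjugates the double transposition
    to one whose support meets the first in a single point, and the two produce
    a 3-cycle.  Only a few small theta graphs escape; explicit walks settle them,
    except for theta0, to which a chord or an ear has to be added first.  The odd
    permutations come from an odd closed walk, or, on a bipartite graph, from
    two tokens of the same flavor.

    For the ground states let [psi > 0] be the Perron vector of [t].  The vector
    with amplitude [(-1)^h psi h] is an eigenvector in each sector, with one and
    the same eigenvalue.  Dividing any other eigenvector by it turns the energy
    difference into a Dirichlet form with nonnegative weights, which gives both
    minimality and, by connectivity, uniqueness within the sector. *)

(** * Three-cycles *)

(** Why theta0 is an obstacle: its puzzle group is PGL(2,5), sharply 3-transitive on the six tokens,
    so only the identity fixes three tokens and no closed walk is a 3-cycle. The general argument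
    also shows where it breaks down: two supports of four points that meet in a single point need
    seven tokens. The growth of good sets needs only a seed, so all the graph theory before it aims
    at one 3-cycle on a small set of vertices.

    All sites but the hole are filled, so the fermionic sign of a hop depends only on the two sites
    involved and never on flavors. This is why signs depending on the hole alone can make all matrix
    elements negative, on any graph. For the same reason an amplitude that depends on the hole alone
    satisfies the same one-particle equation in every sector, which gives one common eigenvalue.

    The symmetric representation is recognised explicitly: there is one ground state per sector,
    that is, per monomial of degree [V - 1] in [N] variables, and after normalisation the flavor
    generators act on these states as on monomials. *)

Section ThreeCycles.
Variable T : finType.
Implicit Types (x y z o c : T) (s : {perm T}) (B : {set T}).

Definition c3 x y z : {perm T} := (tperm x y * tperm x z)%g.

Lemma c3J x y z s : (c3 x y z ^ s)%g = c3 (s x) (s y) (s z).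
Proof. by rewrite conjMg !tpermJ. Qed.

Lemma c3V x y z : (c3 x y z)^-1%g = c3 x z y.
Proof. by rewrite invMg !tpermV. Qed.

Lemma c3_rot x y z : x != z -> y != z -> c3 x y z = c3 y z x.
Proof.
move=> xz yz; rewrite /c3 (conjgCV (tperm x y)) tpermJ tpermV tpermL tpermD //.
by rewrite (tpermC y x).
Qed.

Lemma c3E x y z : x != y -> x != z -> y != z ->
  [/\ c3 x y z x = y, c3 x y z y = z & c3 x y z z = x].
Proof.
move=> xy xz yz; rewrite !permM tpermL tpermR (tpermD xz yz) tpermR tpermL.
by rewrite tpermD // eq_sym.
Qed.

Lemma c3D x y z o : x != o -> y != o -> z != o -> c3 x y z o = o.
Proof. by move=> xo yo zo; rewrite permM !tpermD. Qed.

Lemma odd_c3 x y z : x != y -> x != z -> odd_perm (c3 x y z) = false.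
Proof. by move=> xy xz; rewrite odd_permM !odd_tperm xy xz. Qed.

(** Induction on the number of moved points. A 3-cycle on [s x], [x] and a third moved point makes
    [x] fixed and moves nothing new; if there is no third moved point, [s] is a transposition, which
    parity excludes. *)
Lemma even_perm_ind (D : {set T}) (Q : {perm T} -> Prop) :
  Q 1%g ->
  (forall s s', Q s -> Q s' -> Q (s * s')%g) ->
  (forall x y z, x \in D -> y \in D -> z \in D -> x != y -> x != z -> y != z ->
     Q (c3 x y z)) ->
  forall s, perm_on D s -> odd_perm s = false -> Q s.
Proof.
move=> Q1 QM Q3 s.
have [n] := ubnP #|[set x | s x != x]|; elim: n s => // n IH s le_n sD ev.
case: (pickP [pred x | s x != x]) => [x /= sx | fixs]; last first.
  suff -> : s = 1%g by [].
  by apply/permP=> x; rewrite perm1; move/negbFE/eqP: (fixs x).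
case: (pickP [pred z | [&& s z != z, z != x & z != s x]]) => [z /and3P[sz zx zsx] | no];
    last first.
  suff es : s = tperm x (s x) by move: ev; rewrite es odd_tperm eq_sym sx.
  have ssx : s (s x) = x.
    apply/eqP; apply: contraNT (negbT (no (s (s x)))) => ssx /=.
    have inj1 : s (s x) != s x by rewrite (inj_eq perm_inj).
    by rewrite (inj_eq perm_inj) inj1 ssx.
  apply/permP=> z; case: tpermP => [-> //| -> //| /eqP zx /eqP zsx].
  by move: (no z) => /=; rewrite zx zsx !andbT => /negbFE/eqP.
have xsx : x != s x by rewrite eq_sym.
have inD y : s y != y -> y \in D.
  by move=> sy; apply: contraR sy => yD; rewrite (out_perm sD yD).
have ssx : s (s x) != s x by rewrite (inj_eq perm_inj).
pose c := c3 (s x) x z.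
have zx' : x != z by rewrite eq_sym.
have zsx' : s x != z by rewrite eq_sym.
have [c1 c2 c4] := c3E sx zsx' zx'.
have xz_D : [/\ x \in D, z \in D & s x \in D] by split; apply: inD.
have [xD zD sxD] := xz_D.
have cD : perm_on D c.
  apply/subsetP=> y; rewrite inE; apply: contraR => yD.
  by apply/eqP; apply: c3D; apply: contraNneq yD => <-.
have oc : odd_perm c = false by apply: odd_c3.
have -> : s = ((s * c) * c^-1)%g by rewrite -mulgA mulgV mulg1.
apply: (QM); last by rewrite c3V; apply: Q3.
apply: IH; last 2 first.
- exact: perm_onM.
- by rewrite odd_permM ev oc.
rewrite -ltnS; apply: leq_trans le_n; rewrite ltnS.
apply: proper_card; apply/properP; split; last first.
  by exists x; rewrite !inE ?sx // permM c1 eqxx.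
apply/subsetP=> y; rewrite !inE; apply: contraNN => /eqP sy.
rewrite permM sy; apply/eqP; apply: c3D.
- by apply: contraNneq ssx => ->; rewrite sy.
- by apply: contraNneq sx => ->; rewrite sy.
- by apply: contraNneq sz => ->; rewrite sy.
Qed.

Section Closed.
Variable P : {perm T} -> Prop.
Hypothesis PM : forall s s', P s -> P s' -> P (s * s')%g.
Hypothesis PV : forall s, P s -> P s^-1%g.

Definition tri x y z := P (c3 x y z).

Definition alt_on B := forall x y z, x \in B -> y \in B -> z \in B ->
  x != y -> x != z -> y != z -> tri x y z.

Lemma triJ s x y z : P s -> tri x y z -> tri (s x) (s y) (s z).
Proof.
by move=> Ps; rewrite /tri -c3J conjgE => Pt; apply: PM; [exact: PV|apply: PM].
Qed.

Lemma tri_rot x y z : x != z -> y != z -> tri x y z -> tri y z x.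
Proof. by move=> xz yz; rewrite /tri (c3_rot xz yz). Qed.

Lemma triC x y z : tri x y z -> tri x z y.
Proof. by move=> /PV; rewrite c3V. Qed.

Lemma triCl x y z : x != z -> y != z -> tri x y z -> tri y x z.
Proof. by move=> xz yz t; apply: triC; apply: tri_rot. Qed.

(** Conjugation of the second 3-cycle by the first. *)
Lemma tri4 x y z w : x != y -> x != z -> y != z -> x != w -> y != w -> z != w ->
  tri x y z -> tri x y w -> tri y z w.
Proof.
move=> xy xz yz xw yw zw txyz txyw.
have := triJ txyz txyw.
by have [-> -> _] := c3E xy xz yz; rewrite c3D.
Qed.

Lemma tri5 x y z o p : x != y -> x != z -> y != z -> o != z -> p != z -> o != p ->
    x != o -> x != p -> y != o -> y != p ->
  tri x y z -> tri z o p -> tri x y o.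
Proof.
move=> xy xz yz oz pz op xo xp yo yp txyz tzop.
have := triJ tzop txyz.
have zo : z != o by rewrite eq_sym.
have zp : z != p by rewrite eq_sym.
have [-> _ _] := c3E zo zp op.
by rewrite !c3D // eq_sym.
Qed.

Lemma alt_on_sub B B' : B' \subset B -> alt_on B -> alt_on B'.
Proof. by move=> /subsetP sub a x y z xB yB zB; apply: a; apply: sub. Qed.

(** Conjugating one 3-cycle of the star by another replaces first [y] and then [x] by an arbitrary
    point. The pair itself may lie outside [B]. *)
Lemma alt_on_star B x y : x != y ->
  (forall z, z \in B -> z != x -> z != y -> tri x y z) -> alt_on B.
Proof.
move=> xy star.
have star1 p q : p \in B -> q \in B -> p != x -> q != x -> p != q -> tri x p q.
  move=> pB qB px qx pq.
  have [ypE|py] := eqVneq p y.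
    by rewrite ypE; apply: star => //; rewrite -ypE eq_sym.
  have [yqE|qy] := eqVneq q y.
    by rewrite yqE; apply: triC; apply: star.
  have yx : y != x by rewrite eq_sym.
  have xp : x != p by rewrite eq_sym.
  have yp : y != p by rewrite eq_sym.
  have xq : x != q by rewrite eq_sym.
  have yq : y != q by rewrite eq_sym.
  have txyp := star p pB px py.
  have txyq := star q qB qx qy.
  have t1 := triCl xp yp txyp.
  have t2 := triCl xq yq txyq.
  exact: (tri4 _ _ _ _ _ _ t1 t2).
move=> p q r pB qB rB pq pr qr.
have [pxE|px] := eqVneq p x.
  by rewrite pxE; apply: star1; rewrite // -pxE eq_sym.
have xp : x != p by rewrite eq_sym.
have [qxE|qx] := eqVneq q x.
  by move: pq qr; rewrite qxE => _ xr; apply: triCl => //; apply: star1; rewrite // eq_sym.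
have xq : x != q by rewrite eq_sym.
have [rxE|rx] := eqVneq r x.
  by rewrite rxE; apply: tri_rot => //; apply: star1.
have xr : x != r by rewrite eq_sym.
exact: (tri4 _ _ _ _ _ _ (star1 p q pB qB px qx pq) (star1 p r pB rB px rx pr)).
Qed.

(** One 3-cycle linking a new point to some pair of [B] is enough: conjugation by the 3-cycles of
    [B] moves that pair onto the centre [x], [y] of a star. *)
Lemma alt_on_extend B (D : {set T}) x y : x \in B -> y \in B -> x != y -> alt_on B ->
  (forall o, o \in D -> o \notin B -> exists p q, [/\ p \in B, q \in B, p != q & tri p q o]) ->
  alt_on (B :|: D).
Proof.
move=> xB yB xy aB ext; apply: (@alt_on_star _ x y) => // z; rewrite inE.
have [zB _ zx zy|zB /= zD zx zy] := boolP (z \in B).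
  by apply: aB; rewrite // eq_sym.
have [p [q [pB qB pq tpqz]]] := ext z zD zB.
have zne w : w \in B -> w != z by move=> wB; apply: contraNneq zB => <-.
suff pass p' q' r : p' \in B -> q' \in B -> r \in B -> p' != q' -> r != p' ->
    tri p' q' z -> tri p' r z.
  have [pxE|px] := eqVneq x p.
    by subst p; apply: (pass x q y) => //; rewrite eq_sym.
  have txp : tri x p z by apply: triCl; rewrite ?zne //; apply: pass tpqz.
  by apply: pass txp; rewrite // eq_sym.
move=> p'B q'B rB p'q' rp' t.
have [->//|rq'] := eqVneq r q'.
have q'p' : q' != p' by rewrite eq_sym.
have q'r : q' != r by rewrite eq_sym.
have p'r : p' != r by rewrite eq_sym.
have tr : tri q' p' r by apply: aB.
have tz : tri q' p' z by apply: triCl; rewrite ?zne.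
by apply: (tri4 _ _ _ _ _ _ tr tz); rewrite // zne.
Qed.

(** A 3-cycle of [B] through [c], conjugated by one of [B'] that takes [c] to a new point, links
    this point to two points of [B]. *)
Lemma alt_on_merge B B' c : (2 < #|B|)%N -> (2 < #|B'|)%N -> c \in B -> c \in B' ->
  alt_on B -> alt_on B' -> alt_on (B :|: B').
Proof.
have two (D : {set T}) x : (2 < #|D|)%N -> x \in D ->
    exists y z, [/\ y \in D, z \in D, y != x, z != x & y != z].
  move=> D3 xD; have : (1 < #|D :\ x|)%N by move: D3; rewrite (cardsD1 x) xD.
  move/card_gt1P=> [y [z [yD zD yz]]]; exists y, z.
  by move: yD zD; rewrite !inE => /andP[-> ->] /andP[-> ->].
move=> B3 B'3 cB cB' aB aB'.
have [x [y [xB yB xc yc xy]]] := two _ _ B3 cB.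
apply: (@alt_on_extend _ _ x y) => // o oB' oB.
have oc : o != c by apply: contraNneq oB => ->.
have : (1 < #|B' :\ c|)%N by move: B'3; rewrite (cardsD1 c) cB'.
have oD : o \in B' :\ c by rewrite !inE oc.
rewrite (cardsD1 o) oD ltnS => /card_gt0P[p]; rewrite !inE => /and3P[po pc pB'].
have [pB|pB] := boolP (p \in B).
  exists c, p; split => //; first by rewrite eq_sym.
  by apply: aB'; rewrite // eq_sym.
exists x, y; split=> //.
have neB z : z \in B -> (z != o) * (z != p).
  by move=> zB; split; [apply: contraNneq oB => <- | apply: contraNneq pB => <-].
have co : c != o by rewrite eq_sym.
have cp : c != p by rewrite eq_sym.
have op : o != p by rewrite eq_sym.
have := @tri5 x y c o p; apply=> //; rewrite ?neB //.
- exact: aB.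
- exact: aB'.
Qed.

Lemma alt_on_J B s : P s -> alt_on B -> alt_on (s @: B).
Proof.
move=> Ps aB x y z /imsetP[x' xB ->] /imsetP[y' yB ->] /imsetP[z' zB ->].
by rewrite !(inj_eq perm_inj) => *; apply: triJ => //; apply: aB.
Qed.

Lemma alt_on3 x y z : x != y -> tri x y z -> alt_on [set x; y; z].
Proof.
move=> xy t; apply: (@alt_on_star _ x y) => // w; rewrite !inE.
by move=> /orP[/orP[]|] /eqP-> //; rewrite eqxx.
Qed.

End Closed.
End ThreeCycles.

(** * Hole walks *)

Section Walks.
Variable T : finType.
Implicit Types (x y z u v w : T) (p q : seq T) (A : {set T}).

(* Maps each site to the site its token came from after the hole has walked
   from [u] along [p]; hence composition is in reverse order of the walks. *)
Fixpoint wperm u p : {perm T} :=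
  if p is v :: p' then (wperm v p' * tperm u v)%g else 1%g.

Lemma wperm_cat u p q : wperm u (p ++ q) = (wperm (last u p) q * wperm u p)%g.
Proof. by elim: p u => [|v p IH] u /=; rewrite ?mulg1 // IH mulgA. Qed.

Lemma wperm_out u p x : x \notin u :: p -> wperm u p x = x.
Proof.
elim: p u => [|v p IH] u /=; first by rewrite perm1.
rewrite inE negb_or => /andP[xu xp]; rewrite permM IH // tpermD // 1?eq_sym //.
by apply: contraNneq xp => <-; rewrite mem_head.
Qed.

Lemma wperm_last u p : wperm u p (last u p) = u.
Proof. by elim: p u => [|v p IH] u /=; rewrite ?perm1 // permM IH tpermR. Qed.

Lemma wperm_rev u p : wperm (last u p) (rev (belast u p)) = (wperm u p)^-1%g.
Proof.
elim: p u => [|v p IH] u /=; first by rewrite invg1.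
rewrite rev_cons -cats1 wperm_cat IH invMg tpermV /= mul1g.
by case: p {IH} => [|w p] /=; rewrite ?rev_cons ?last_rcons tpermC.
Qed.

(** Away from [u] the two cycles differ only at the last vertex, whose successor changes from [v] to
    [u]. *)
Lemma next_tperm u v p x : uniq [:: u, v & p] -> x != u ->
  next [:: u, v & p] x = tperm u v (next (v :: p) x).
Proof.
rewrite cons_uniq inE negb_or => /andP[/andP[uv up] /[dup] Uvp /andP[vp Up]] xu.
rewrite !next_nth !(in_cons u) (negbTE xu) /= (eq_sym u x) (negbTE xu) /= (eq_sym v x).
rewrite !inE; case: (eqVneq x v) => [->|xv] /=.
  case: p {Uvp Up} up vp => [|w p]; first by rewrite tpermR.
  rewrite !inE !negb_or => /andP[uw _] /andP[vw _].
  by rewrite /= tpermD.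
case: ifP => [xp|/negbT xp]; last by rewrite tpermD // eq_sym.
have [ip|ip] := ltnP (index x p).+1 (size p).
  rewrite (set_nth_default v) // tpermD //.
    by apply: contraNneq up => ->; rewrite mem_nth.
  by apply: contraNneq vp => ->; rewrite mem_nth.
by rewrite !nth_default // tpermR.
Qed.

Lemma wperm_next u p : uniq (u :: p) -> wperm u p =1 next (u :: p).
Proof.
elim: p u => [|v p IH] u; first by move=> _ x; rewrite perm1 next_nth inE nth_nil; case: eqP.
move=> U x; have Uvp : uniq (v :: p) by case/andP: U.
rewrite [wperm _ _]/= permM; have [->|xu] := eqVneq x u.
  by rewrite wperm_out ?tpermL /= ?eqxx //; case/andP: U.
by rewrite IH // next_tperm.
Qed.

(** After a full turn the hole is back at [u], and the tokens have rotated along the cycle with [u]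
    skipped. *)
Lemma wperm_cycle u p : uniq (u :: p) -> wperm u (rcons p u) =1 next p.
Proof.
case: p => [|v p] U x; first by rewrite /= tperm1 mul1g perm1.
have Uvp : uniq (v :: rcons p u) by rewrite -rcons_cons rcons_uniq.
rewrite [wperm _ _]/= permM wperm_next //.
have -> : v :: rcons p u = rot 1 [:: u, v & p] by rewrite rot1_cons.
rewrite next_rot //.
have [->|xu] := eqVneq x u; last by rewrite next_tperm // tpermK.
rewrite !next_nth mem_head /= eqxx /= tpermR.
by case/andP: U => /negbTE ->.
Qed.

Lemma next_mid p1 x y p2 : uniq (p1 ++ [:: x, y & p2]) ->
  next (p1 ++ [:: x, y & p2]) x = y.
Proof.
move=> U; rewrite -(next_rot (size p1)) // rot_size_cat.
by rewrite next_nth mem_head /= eqxx.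
Qed.

Lemma next_lastE x p : uniq (x :: p) -> next (x :: p) (last x p) = x.
Proof.
move=> U; rewrite next_nth mem_last index_last // nth_default //.
Qed.

Lemma odd_wperm (e : rel T) u p : irreflexive e -> path e u p ->
  odd_perm (wperm u p) = odd (size p).
Proof.
move=> irr; elim: p u => [|v p IH] u /=; first by rewrite odd_perm1.
case/andP=> euv /IH; rewrite odd_permM odd_tperm => ->.
by rewrite (contraTneq _ euv) ?addbT // => ->; rewrite irr.
Qed.

End Walks.

(** * The puzzle group and the growth of good sets *)

Section Puzzle.
Variables (T : finType) (e : rel T).
Implicit Types (x y z u v w : T) (p q : seq T) (A : {set T}) (s g : {perm T}).
Hypothesis e_sym : symmetric e.

(* Wilson's puzzle group. *)
Definition Gam u s := exists p, [/\ path e u p, last u p = u & s = wperm u p].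

Lemma Gam1 u : Gam u 1%g. Proof. by exists [::]. Qed.

Lemma GamM u s g : Gam u s -> Gam u g -> Gam u (s * g)%g.
Proof.
move=> [p [pp lp ->]] [q [qq lq ->]]; exists (q ++ p).
by rewrite cat_path last_cat lq qq pp lp wperm_cat lq.
Qed.

Lemma path_rev x p : path e x p -> path e (last x p) (rev (belast x p)).
Proof. by rewrite rev_path; apply: sub_path => a b; rewrite e_sym. Qed.

Lemma last_revbelast x p : last (last x p) (rev (belast x p)) = x.
Proof. by case: p => //= y p; rewrite rev_cons last_rcons. Qed.

Lemma GamV u s : Gam u s -> Gam u s^-1%g.
Proof.
move=> [p [pp lp ->]]; exists (rev (belast u p)).
have := path_rev pp; have := wperm_rev u p; have := last_revbelast u p.
by rewrite lp => -> <- ->.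
Qed.

Lemma Gam_conj u v q g : path e u q -> last u q = v -> Gam u g ->
  Gam v (g ^ (wperm u q)^-1)%g.
Proof.
move=> qq lq [p [pp lp ->]]; exists (rev (belast u q) ++ p ++ q).
rewrite !cat_path !last_cat -lq last_revbelast lp path_rev // pp qq.
by split=> //; rewrite !wperm_cat last_revbelast lp wperm_rev conjgE invgK mulgA.
Qed.

Definition conn_in A := forall x y, x \in A -> y \in A ->
  exists p, [/\ path e x p, last x p = y & {subset p <= A}].

(** The size bound gives at least three tokens, so that [alt_on] is not vacuous. Only [conn_in]
    stays inside [A]; the closed walks of [Gam] may leave it. *)
Definition good A u :=
  [/\ u \in A, (3 < #|A|)%N, conn_in A & alt_on (Gam u) (A :\ u)].

(** A walk inside [A] permutes [A], so conjugation by it carries the 3-cycles from one hole position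
    to the other. *)
Lemma good_move A u v : good A u -> v \in A -> good A v.
Proof.
case=> uA A4 cA aA vA; split=> // x y z xA yA zA xy xz yz.
have [q [qq lq qA]] := cA _ _ uA vA.
pose s := wperm u q.
have sv : s v = u by rewrite /s -lq wperm_last.
have sA w : w \in A :\ v -> s w \in A :\ u.
  rewrite !inE => /andP[wv wA]; rewrite -sv (inj_eq perm_inj) wv /=.
  apply: contraLR wA => swA.
  suff ew : s w = w by rewrite -ew.
  apply: (@perm_inj _ s); apply: wperm_out; rewrite inE negb_or.
  apply/andP; split; first by apply: contraNneq swA => ->.
  by apply: contraNN swA => /qA.
have t := aA _ _ _ (sA _ xA) (sA _ yA) (sA _ zA).
have {}t : Gam u (c3 (s x) (s y) (s z)) by apply: t; rewrite (inj_eq perm_inj).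
have := Gam_conj qq lq t; rewrite c3J -/s !permK; exact.
Qed.

Hypothesis connG : forall x y, connect e x y.
Hypothesis nsepG : forall v x y, x != v -> y != v ->
  connect [rel a b | [&& e a b, a != v & b != v]] x y.

Lemma exit_edge A x p : path e x p -> x \in A -> last x p \notin A ->
  exists a b, [/\ a \in A, b \notin A & e a b].
Proof.
elim: p x => [|y p IH] x /=; first by move=> _ ->.
case/andP=> exy pp xA lA; have [yA|yA] := boolP (y \in A); first exact: IH pp yA lA.
by exists x, y.
Qed.

Definition ear A u p w := [/\ path e u (rcons p w), uniq p, p != [::],
  {in p, forall z, z \notin A} & [/\ u \in A, w \in A & u != w]].

(** Leave [A] along an edge from [a] to [b]. Non-separability brings [b] back to [A] while avoiding
    [a]; stopping at the first vertex of [A] gives an ear with distinct ends. *)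
Lemma ear_exists A z : (1 < #|A|)%N -> z \notin A -> exists u p w, ear A u p w.
Proof.
move=> A2 zA; have /card_gt0P[x xA] : (0 < #|A|)%N by apply: ltnW.
have /connectP[p pp lp] := connG x z.
have [|a [b [aA bA eab]]] := exit_edge pp xA; first by rewrite -lp.
have /card_gt0P[c] : (0 < #|A :\ a|)%N by move: A2; rewrite (cardsD1 a) aA.
rewrite !inE => /andP[ca cA].
have ba : b != a by apply: contraNneq bA => ->.
have /connectP[q0 qq0 lq0] := nsepG ba ca.
move: lq0; case/shortenP: qq0 => q qq Uq _ lq.
have hq : has (mem A) q.
  apply/hasP; exists c => //; rewrite lq.
  by case: (q) lq cA => [/= -> bA'|y q' -> _]; [rewrite bA' in bA | rewrite /= mem_last].
move: qq Uq {lq}; case/split_find: hq => w q1 q2 wA q1A qq Uq.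
exists a, (b :: q1), w; split => //.
- rewrite rcons_cons /= eab.
  move: qq; rewrite cat_path => /andP[qq _].
  by apply: sub_path qq => y y' /and3P[].
- by move: Uq; rewrite -cat_cons -rcons_cons cat_uniq rcons_uniq => /andP[/andP[]].
- move=> y; rewrite inE => /orP[/eqP->//|yq]; apply: contra q1A => yA.
  by apply/hasP; exists y.
- split=> //; move: qq; rewrite cat_path rcons_path => /andP[/andP[_ /and3P[_ _]]].
  by rewrite eq_sym.
Qed.

(* The hole goes around an ear [u, ps, w] and back inside [A].  The inverse of
   the resulting permutation sends [w] to the last vertex [p] of the ear and
   keeps the other points of [A] in [A], so it conjugates a 3-cycle through [w]
   to one through [p]. *)
Lemma good_extend A u z : good A u -> z \notin A ->
  exists A' u', good A' u' /\ (#|A| < #|A'|)%N.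
Proof.
move=> gA zA; have [|{}u' [ps [w [pp Ups ps0 psA [uA wA uw]]]]] := ear_exists _ zA.
  by case: gA => _ A4 _ _; apply: leq_trans A4.
have {gA} := good_move gA uA; move: u' pp uA uw => {}u pp uA uw [_ A4 cA aA].
have [q [qq lq qA]] := cA _ _ wA uA.
set p := last u ps.
have pps : p \in ps by rewrite /p; case: (ps) ps0 => //= y ps' _; apply: mem_last.
have pA := psA _ pps.
have uU : uniq (u :: ps).
  by rewrite /= Ups andbT; apply/negP => /psA; rewrite uA.
move: (pp); rewrite rcons_path => /andP[pp1 epw].
pose s := wperm u (ps ++ w :: q).
have sE x : s x = wperm u ps (wperm p (w :: q) x) by rewrite /s wperm_cat permM.
have Gs : Gam u s.
  exists (ps ++ w :: q); split=> //; last by rewrite last_cat /= lq.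
  by rewrite cat_path pp1 /= epw.
have notq x : x \notin A -> x \notin w :: q.
  by apply: contra; rewrite inE => /orP[/eqP->//|/qA].
have sp : s p = w.
  rewrite sE /= permM (wperm_out (notq _ pA)) tpermL wperm_out //.
  by rewrite inE (eq_sym w) negb_or uw; apply/negP => /psA; rewrite wA.
have su : s u = u by have := wperm_last u (ps ++ w :: q); rewrite last_cat /= lq.
have s_out x : x \notin A -> x != p -> s x \notin A.
  move=> xA xp; rewrite sE.
  have -> : wperm p (w :: q) x = x by rewrite wperm_out // inE negb_or xp notq.
  have [xps|xps] := boolP (x \in ps); last first.
    by rewrite wperm_out // inE negb_or xps andbT; apply: contraNneq xA => ->.
  have sxps : wperm u ps x \in u :: ps by rewrite wperm_next // mem_next inE xps orbT.
  move: sxps; rewrite inE => /orP[/eqP sxu|/psA //].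
  by move: xp; rewrite -(inj_eq (@perm_inj _ (wperm u ps))) /p wperm_last sxu eqxx.
have sVw : s^-1%g w = p by rewrite -sp permK.
have sV x : x \in A -> x != u -> x != w -> s^-1%g x \in A :\ u.
  move=> xA xu xw; have sxu : s^-1%g x != u.
    by apply: contraNneq xu => sxu; rewrite -(permKV s x) sxu su.
  rewrite !inE sxu /=.
  apply: contraLR xA => sxA; rewrite -(permKV s x); apply: s_out => //.
  by rewrite -sVw (inj_eq perm_inj).
have [x [y [xA yA xy]]] : exists x y, [/\ x \in A :\ u :\ w, y \in A :\ u :\ w & x != y].
  apply/card_gt1P; move: A4; rewrite (cardsD1 u) uA (cardsD1 w) !inE wA eq_sym uw /=.
  by rewrite !ltnS.
move: xA yA; rewrite !inE => /and3P[xw xu xA] /and3P[yw yu yA].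
have txyw : tri (Gam u) x y w by apply: aA; rewrite // !inE ?xu ?yu ?xA ?yA ?wA // eq_sym uw.
have := triJ (@GamM u) (@GamV u) (GamV Gs) txyw; rewrite sVw => t.
exists (p |: A), u; split; last by rewrite cardsU1 pA.
have cpw : exists r, [/\ path e p r, last p r = w & {subset r <= p |: A}].
  exists [:: w]; rewrite /= epw; split=> // k; rewrite inE => /eqP ->.
  by rewrite !inE wA orbT.
have cwp : exists r, [/\ path e w r, last w r = p & {subset r <= p |: A}].
  exists [:: p]; rewrite /= e_sym epw; split=> // k; rewrite inE => /eqP ->.
  by rewrite !inE eqxx.
have cA' a b : a \in A -> b \in A -> exists r, [/\ path e a r, last a r = b & {subset r <=
    p |: A}].
  move=> aA1 bA1; have [r [rr lr rA]] := cA _ _ aA1 bA1; exists r; split=> // k /rA.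
  by rewrite !inE orbC => ->.
have trans a b c : (exists r, [/\ path e a r, last a r = b & {subset r <= p |: A}]) ->
  (exists r, [/\ path e b r, last b r = c & {subset r <= p |: A}]) ->
  (exists r, [/\ path e a r, last a r = c & {subset r <= p |: A}]).
  move=> [r [rr lr rA]] [r' [rr' lr' rA']]; exists (r ++ r').
  by rewrite cat_path last_cat lr rr rr'; split=> // k; rewrite mem_cat => /orP[/rA|/rA'].
split.
- by rewrite !inE uA orbT.
- by rewrite cardsU1 pA (leq_trans A4) // leq_addl.
- move=> a b; rewrite !inE => /orP[/eqP->|aA1] /orP[/eqP->|bA1].
  + by exists [::].
  + exact: trans cpw (cA' _ _ wA bA1).
  + exact: trans (cA' _ _ aA1 wA) cwp.
  + exact: cA'.
- have -> : (p |: A) :\ u = (A :\ u) :|: [set p].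
    apply/setP=> k; rewrite !inE; case: (eqVneq k p) => [->|_] /=; last by rewrite orbF.
    by rewrite andbT orbT; apply: contraNneq pA => ->.
  apply: (alt_on_extend (@GamM u) (@GamV u) (x := x) (y := y)) => //.
  + by rewrite !inE xu.
  + by rewrite !inE yu.
  + move=> o; rewrite inE => /eqP -> _; exists (s^-1%g x), (s^-1%g y).
    by rewrite !sV // (inj_eq perm_inj).
Qed.

Lemma good_alternating A u : good A u ->
  forall v s, s v = v -> odd_perm s = false -> Gam v s.
Proof.
move: A u; suff H A u : good A u -> exists u', good setT u'.
  move=> A u /H[u' g] v s sv ev; have [_ _ _ a] := good_move g (in_setT v).
  apply: (@even_perm_ind _ (setT :\ v) (Gam v)) ev.
  - exact: Gam1.
  - exact: GamM.
  - exact: a.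
  - apply/subsetP=> x; rewrite !inE andbT; apply: contraNneq => ->.
    by rewrite sv.
have [n] := ubnP (#|T| - #|A|); elim: n A u => // n IH A u le_n gA.
have [AT|] := eqVneq A setT; first by exists u; rewrite -AT.
rewrite -subTset => /subsetPn[z _ zA].
have [A' [u' [gA' lt]]] := good_extend gA zA.
apply: (IH A' u') => //; rewrite -ltnS; apply: leq_trans le_n; rewrite ltnS.
by apply: ltn_sub2l => //; apply: leq_trans lt (max_card _).
Qed.

End Puzzle.

(** * Theta graphs *)

(** Reduces [uniq] of a rearranged sublist to linear inequalities between counts, which [lia]
    settles. *)
Lemma uniq_count_le (T : eqType) (r r' : seq T) : (forall k, count_mem k r <= count_mem k
    r')%N ->
  uniq r' -> uniq r.
Proof.
move=> le U; apply: count_mem_uniq => k; have := le k.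
rewrite (count_uniq_mem _ U) -[k \in r]has_pred1 has_count.
by case: (count_mem k r) => [|[|n]] //; case: (k \in r').
Qed.

Ltac uniq_by_count := let U := fresh in move=> U; apply: uniq_count_le U => ?;
  rewrite /= ?count_cat /= ?count_cat /= ?count_rev;
  repeat match goal with H : _ |- _ => clear H end; lia.

Section Theta.
Variables (T : finType) (e : rel T).
Implicit Types (x y z u w : T) (p q : seq T) (s g : {perm T}) (X Y S R : seq T).
Hypothesis e_sym : symmetric e.

(** The neighbour is chosen before [R]: inside a segment [next] does not see how the cycle is
    closed. Two cycles with a common arc therefore agree along it. *)
Lemma next_segment_pred x X z : z \in X ->
  exists2 z0, z0 \in x :: X &
    forall R, uniq (x :: X ++ R) -> next (x :: X ++ R) z0 = z.
Proof.
case/splitPr=> X1 X2; exists (last x X1).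
  by rewrite -cat_cons mem_cat mem_last.
move=> R; have -> : x :: (X1 ++ z :: X2) ++ R = belast x X1 ++ [:: last x X1, z & X2 ++ R].
  by rewrite -!cat_cons lastI -catA cat_rcons.
exact: next_mid.
Qed.

Lemma next_segment_succ x X z : z \in x :: X -> z != last x X ->
  exists2 z', z' \in X &
    forall R, uniq (x :: X ++ R) -> next (x :: X ++ R) z = z'.
Proof.
move=> zX; have [L1 [L2 E]] : exists L1 L2, x :: X = L1 ++ z :: L2.
  by case/splitPr: zX => L1 L2; exists L1, L2.
have -> : last x X = last z L2 by rewrite -[LHS]/(last x (x :: X)) E last_cat.
case: L2 E => [|z' L2] E; first by rewrite eqxx.
move=> _; exists z'; last by move=> R; rewrite -cat_cons E -catA; apply: next_mid.
have : z' \in behead (L1 ++ [:: z, z' & L2]).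
  by case: (L1) => [|a L] /=; rewrite ?mem_cat !inE eqxx ?orbT.
by rewrite -E.
Qed.

Lemma next_segment_last x X z R : uniq (x :: X ++ z :: R) ->
  next (x :: X ++ z :: R) (last x X) = z.
Proof.
have -> : x :: X ++ z :: R = belast x X ++ [:: last x X, z & R].
  by rewrite -cat_cons lastI cat_rcons.
exact: next_mid.
Qed.

Lemma next_swap X Y : uniq (X ++ Y) -> next (X ++ Y) =1 next (Y ++ X).
Proof. by move=> U x; rewrite -(next_rot (size X)) // rot_size_cat. Qed.

(* Two cycles through the common arc [w :: S]. *)
Section Commutator.
Variables (w x1 y1 : T) (S X Y : seq T) (sg ta : {perm T}).
Hypothesis U : uniq ((w :: S) ++ (x1 :: X) ++ y1 :: Y).
Hypothesis sgE : sg =1 next ((x1 :: X) ++ w :: S).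
Hypothesis taE : ta =1 next ((y1 :: Y) ++ w :: S).

Let Us : uniq ((x1 :: X) ++ w :: S).
Proof. by move: U; rewrite catA cat_uniq uniq_catC => /and3P[]. Qed.
Let Ut : uniq ((y1 :: Y) ++ w :: S).
Proof. by move: U; rewrite uniq_catCA cat_uniq uniq_catC => /and3P[]. Qed.
Let sgE' : sg =1 next (w :: S ++ x1 :: X).
Proof. by move=> z; rewrite sgE next_swap. Qed.
Let taE' : ta =1 next (w :: S ++ y1 :: Y).
Proof. by move=> z; rewrite taE next_swap. Qed.
Let Us' : uniq (w :: S ++ x1 :: X). Proof. by rewrite -cat_cons uniq_catC. Qed.
Let Ut' : uniq (w :: S ++ y1 :: Y). Proof. by rewrite -cat_cons uniq_catC. Qed.

Let sb := last w S.
Let y := last y1 Y.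
Let kappa := (ta * sg^-1 * ta^-1 * sg)%g.

Let sg_out z : z \notin x1 :: X -> z \notin w :: S -> sg z = z.
Proof. by move=> zX zS; rewrite sgE next_nth mem_cat (negbTE zX) (negbTE zS). Qed.
Let ta_out z : z \notin y1 :: Y -> z \notin w :: S -> ta z = z.
Proof. by move=> zX zS; rewrite taE next_nth mem_cat (negbTE zX) (negbTE zS). Qed.
Let sg_sb : sg sb = x1.
Proof. by rewrite sgE' /sb; apply: next_segment_last. Qed.
Let ta_sb : ta sb = y1.
Proof. by rewrite taE' /sb; apply: next_segment_last. Qed.
Let ta_y : ta y = w.
Proof. by rewrite taE; apply: next_segment_last. Qed.
Let sg_xa : sg (last x1 X) = w.
Proof. by rewrite sgE; apply: next_segment_last. Qed.
Let sgV_X z : z \in X -> (sg^-1)%g z \in x1 :: X.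
Proof.
case/(next_segment_pred x1) => z0 z0X nz.
by rewrite -(nz (w :: S)) // -cat_cons -sgE permK.
Qed.
Let ta_Y z : z \in y1 :: Y -> z != y -> ta z \in Y.
Proof. by move=> zY zy; have [z' z'Y nz] := next_segment_succ zY zy; rewrite taE nz. Qed.
Let sgV_S z : z \in S -> (sg^-1)%g z = (ta^-1)%g z.
Proof.
case/(next_segment_pred w) => z0 z0X nz.
by rewrite -{1}(nz (x1 :: X)) // -{1}(nz (y1 :: Y)) // -sgE' -taE' !permK.
Qed.
Let ta_S z : z \in w :: S -> z != sb -> ta z = sg z.
Proof.
by move=> zS zb; have [z' _ nz] := next_segment_succ zS zb; rewrite taE' sgE' !nz.
Qed.

Let disj z : [/\ z \in w :: S -> (z \notin x1 :: X) && (z \notin y1 :: Y),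
  z \in x1 :: X -> (z \notin w :: S) && (z \notin y1 :: Y) &
  z \in y1 :: Y -> (z \notin w :: S) && (z \notin x1 :: X)].
Proof.
move: U; rewrite !cat_uniq has_cat negb_or => /and3P[_ /andP[/hasPn h1 /hasPn h2]].
move=> /and3P[_ /hasPn h3 _]; split=> zin.
- by apply/andP; split; apply/negP; [move=> /h1 | move=> /h2]; rewrite /= zin.
- by rewrite (h1 _ zin); apply/negP => /h3; rewrite /= zin.
- by rewrite (h2 _ zin) (h3 _ zin).
Qed.

Let kE z : kappa z = sg ((ta^-1)%g ((sg^-1)%g (ta z))).
Proof. by rewrite /kappa !permM. Qed.

Let sgVw : (sg^-1)%g w = last x1 X. Proof. by rewrite -sg_xa permK. Qed.
Let sgVx : (sg^-1)%g x1 = sb. Proof. by rewrite -sg_sb permK. Qed.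
Let taVw : (ta^-1)%g w = y. Proof. by rewrite -ta_y permK. Qed.
Let fixV (s : {perm T}) z : s z = z -> (s^-1)%g z = z.
Proof. by move=> sz; rewrite -{1}sz permK. Qed.
Let y_in : y \in y1 :: Y. Proof. exact: mem_last. Qed.
Let sb_in : sb \in w :: S. Proof. exact: mem_last. Qed.
Let xa_in : last x1 X \in x1 :: X. Proof. exact: mem_last. Qed.

(** Off the common arc one rotation fixes what the other moves, and inside the arc the two act
    alike; in both cases the factors of the commutator cancel. *)
Let kappa_other z : z != x1 -> z != w -> z != y -> z != sb -> kappa z = z.
Proof.
move=> zx zw zy zb; rewrite kE.
have [dS dX dY] := disj z.
have [/[dup] zY /dY /andP[zS zX]|zY] := boolP (z \in y1 :: Y).
  have /[dup] tzY : ta z \in y1 :: Y by rewrite inE ta_Y ?orbT.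
  have [_ _ dY'] := disj (ta z).
  case/dY' => /andP[tzS tzX].
  by rewrite (fixV (sg_out tzX tzS)) permK sg_out.
have [/[dup] zS /dS /andP[zX _]|zS] := boolP (z \in w :: S).
  rewrite ta_S // permK -sgV_S ?permKV //.
  by move: zS; rewrite inE (negbTE zw).
rewrite ta_out //.
have [zX|zX] := boolP (z \in x1 :: X); last by rewrite !(fixV, sg_out, ta_out).
have zX' : z \in X by move: zX; rewrite inE (negbTE zx).
have [_ dX' _] := disj ((sg^-1)%g z).
have /andP[? ?] := dX' (sgV_X zX').
by rewrite (fixV (ta_out _ _)) // permKV.
Qed.

Let kappa_y : kappa y = w.
Proof.
rewrite kE ta_y sgVw.
have [_ /(_ xa_in) /andP[? ?] _] := disj (last x1 X).
by rewrite (fixV (ta_out _ _)).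
Qed.

Let kappa_sb : kappa sb = x1.
Proof.
rewrite kE ta_sb.
have [_ _ /(_ (mem_head _ _)) /andP[? ?]] := disj y1.
by rewrite (fixV (sg_out _ _)) // -ta_sb permK sg_sb.
Qed.

Let x1_neq : [/\ x1 != y, x1 != w, y != w, y != sb & x1 != sb].
Proof.
have [_ /(_ (mem_head _ _)) /andP[x1S x1Y] _] := disj x1.
have [_ _ /(_ y_in) /andP[yS yX]] := disj y.
split; first by apply: contraNneq x1Y => ->.
- by apply: contraNneq x1S => ->; rewrite mem_head.
- by apply: contraNneq yS => ->; rewrite mem_head.
- by apply: contraNneq yS => ->.
- by apply: contraNneq x1S => ->.
Qed.

(** The classical fact that two cycles with exactly one common point have a 3-cycle as
    commutator. *)
Lemma commutator_c3 : S = [::] -> kappa = c3 w x1 y.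
Proof.
move=> S0; have [xy xw yw ysb xsb] := x1_neq.
have sbw : sb = w by rewrite /sb S0.
have wx : w != x1 by rewrite eq_sym.
have wy : w != y by rewrite eq_sym.
have [e1 e2 e3] := c3E wx wy xy.
apply/permP=> z.
have [->|zx] := eqVneq z x1.
  have [_ /(_ (mem_head _ _)) /andP[? ?] _] := disj x1.
  have [_ _ /(_ y_in) /andP[? ?]] := disj y.
  by rewrite e2 kE ta_out // sgVx sbw taVw sg_out.
have [->|zw] := eqVneq z w; first by rewrite e1 -{1}sbw.
have [->|zy] := eqVneq z y; first by rewrite e3.
by rewrite kappa_other ?sbw // c3D // eq_sym.
Qed.

(** The rotations part only at the two ends [w] and [sb] of the common arc; these and the
    neighbouring tokens [y] and [x1] are all that moves. *)
Lemma commutator_tperm2 : S != [::] -> kappa = (tperm x1 sb * tperm y w)%g.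
Proof.
move=> S0; have [xy xw yw ysb xsb] := x1_neq.
have sbS : sb \in S.
  by rewrite /sb; case: (S) S0 => //= a S' _; apply: mem_last.
have wS : w \notin S by case/andP: Us'; rewrite mem_cat negb_or => /andP[].
have sbw : sb != w by apply: contraNneq wS => <-.
have wb : w != sb by rewrite eq_sym.
apply/permP=> z; rewrite permM.
have [->|zx] := eqVneq z x1.
  rewrite tpermL tpermD // 1?eq_sym //.
  have [_ /(_ (mem_head _ _)) /andP[? ?] _] := disj x1.
  by rewrite kE ta_out // sgVx -sgV_S // permKV.
have [->|zb] := eqVneq z sb.
  by rewrite kappa_sb tpermR tpermD // eq_sym.
have -> : tperm x1 sb z = z by rewrite tpermD // eq_sym.
have [->|zw] := eqVneq z w; last first.
  have [->|zy] := eqVneq z y; first by rewrite kappa_y tpermL.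
  by rewrite kappa_other // tpermD // eq_sym.
rewrite tpermR kE ta_S ?mem_head // permK taVw.
by rewrite sg_out //; have [_ _ /(_ y_in) /andP[]] := disj y.
Qed.
End Commutator.

Lemma conn_in_path x p : path e x p -> conn_in e [set z in x :: p].
Proof.
move=> pp.
have from_x a : a \in x :: p -> exists r, [/\ path e x r, last x r = a & {subset r <= x :: p}].
  move=> ap; move: pp; case/splitPl: ap => r r2 lr.
  rewrite cat_path => /andP[pr _]; exists r; split=> // z zr.
  by rewrite inE mem_cat zr orbT.
move=> a b; rewrite !inE -!in_cons => /from_x[r [pr <- rp]] /from_x[r' [pr' <- rp']].
exists (rev (belast x r) ++ r'); rewrite cat_path last_cat last_revbelast path_rev // pr'.
split=> // z; rewrite mem_cat mem_rev inE => /orP[|/rp' //].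
by move=> /mem_belast; rewrite !inE => /orP[->//|/rp]; rewrite inE.
Qed.

(** The seed of the growth process: a hole and three tokens are the smallest possible good set, and
    a path through them supplies the connectedness. *)
Lemma good_path4 a b c d h x y z : path e a [:: b; c; d] ->
    uniq [:: h; x; y; z] -> perm_eq [:: a; b; c; d] [:: h; x; y; z] ->
  tri (Gam e h) x y z -> good e [set k in [:: a; b; c; d]] h.
Proof.
move=> pp U pe t.
have mE k : (k \in [set k in [:: a; b; c; d]]) = (k \in [:: h; x; y; z]).
  by rewrite inE (perm_mem pe).
split; first by rewrite mE mem_head.
- by rewrite cardsE (card_uniqP _) // (perm_uniq pe).
- exact: conn_in_path.
- move: U; rewrite /= !inE !negb_or => /and4P[/and3P[hx hy hz] /andP[xy xz] yz _].
  have -> : [set k in [:: a; b; c; d]] :\ h = [set x; y; z].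
    apply/setP=> k; rewrite in_setD1 mE !inE.
    case: (eqVneq k h) => [->|_] /=; last by rewrite orbA.
    by rewrite (negbTE hx) (negbTE hy) (negbTE hz).
  by apply: (alt_on3 (@GamM _ e h) (@GamV _ e e_sym h)).
Qed.

(** The lists hold only the interior vertices of the three arcs from [u] to [w]; an empty list is an
    edge. *)
Definition theta u w X S Y :=
  [/\ path e u (rcons X w), path e u (rcons S w), path e u (rcons Y w)
    & uniq ([:: u; w] ++ X ++ S ++ Y)].

Lemma theta_swap12 u w X S Y : theta u w X S Y -> theta u w S X Y.
Proof. by case=> pX pS pY U; split=> //; rewrite -(perm_uniq (s1 := [:: u;
    w] ++ X ++ S ++ Y)) // perm_cat2l perm_catCA. Qed.

Lemma theta_swap23 u w X S Y : theta u w X S Y -> theta u w X Y S.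
Proof. by case=> pX pS pY U; split=> //; rewrite -(perm_uniq (s1 := [:: u;
    w] ++ X ++ S ++ Y)) // !perm_cat2l perm_catC. Qed.

Lemma theta_cycle u w X S : path e u (rcons X w) -> path e u (rcons S w) ->
  path e u (rcons (X ++ w :: rev S) u).
Proof.
move=> pX pS; rewrite rcons_cat rcons_cons -cat_rcons cat_path pX last_rcons.
have := path_rev e_sym pS; rewrite last_rcons belast_rcons rev_cons; exact.
Qed.

Lemma path_rcons_head u x X w : path e u (rcons (x :: X) w) -> e u x.
Proof. by case/andP. Qed.

Lemma path_rcons_last u X w : path e u (rcons X w) -> e (last u X) w.
Proof. by rewrite rcons_path => /andP[]. Qed.

Lemma next_nth_mod u p i : uniq p -> (i < size p)%N ->
  next p (nth u p i) = nth u p (i.+1 %% size p)%N.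
Proof.
move=> U im; rewrite next_nth mem_nth // index_uniq //.
case: p U im => // x p _ im.
have [im1|im1] := ltnP i.+1 (size (x :: p)).
  by rewrite modn_small // (set_nth_default u).
have -> : i.+1 = size (x :: p) by apply/eqP; rewrite eqn_leq im im1.
by rewrite modnn nth_default.
Qed.

Lemma shift_lt a b m i : m = (a.+1 + b.+1)%N -> i \in [:: 0; a.+1; m.-1]%N -> (i < m)%N.
Proof. by rewrite !inE; lia. Qed.

(* The excluded shifts are the differences modulo [m] of the positions
   [0], [a.+1] and [m.-1]. *)
Lemma shift_arith a b m j i i' : m = (a.+1 + b.+1)%N -> (j < m)%N ->
  j \notin [:: 0; 1; m.-1; a.+1; m - a.+1; a.+2; m - a.+2]%N ->
  i \in [:: 0; a.+1; m.-1]%N -> i' \in [:: 0; a.+1; m.-1]%N -> ((i + j) %% m != i')%N.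
Proof.
move=> mE jm jn ip ip'.
have im := shift_lt mE ip.
have -> : ((i + j) %% m = if i + j < m then i + j else i + j - m)%N.
  case: ltnP => h; first by rewrite modn_small.
  by rewrite -{1}(subnK h) modnDr modn_small //; lia.
by move: ip ip' jn; rewrite !inE; case: ifP; lia.
Qed.

Lemma theta_uniq u w x1 X S y1 Y : theta u w (x1 :: X) S (y1 :: Y) ->
  let y := last y1 Y in
  [/\ uniq (u :: (x1 :: X) ++ w :: rev S), uniq (u :: (y1 :: Y) ++ w :: rev S),
      uniq ((w :: rev S) ++ (x1 :: X) ++ y1 :: Y),
      uniq (y :: (w :: rev S) ++ u :: x1 :: X) & uniq [:: u; w; x1; y]].
Proof.
case=> _ _ _ U y; split; move: U; rewrite 1?[y1 :: Y]lastI -?/y -?cats1; uniq_by_count.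
Qed.

Section TwoCycles.
Variables (u w x1 y1 : T) (S X Y : seq T).
Hypothesis th : theta u w (x1 :: X) S (y1 :: Y).
Let y := last y1 Y.
Let p := (x1 :: X) ++ w :: rev S.
Let q := (y1 :: Y) ++ w :: rev S.
Let sg := wperm u (rcons p u).
Let ta := wperm u (rcons q u).

Let Uthy := theta_uniq th.
Let Up : uniq (u :: p). Proof. by case: Uthy. Qed.
Let Uq : uniq (u :: q). Proof. by case: Uthy. Qed.
Let Uall : uniq ((w :: rev S) ++ (x1 :: X) ++ y1 :: Y). Proof. by case: Uthy. Qed.

Let sgE : sg =1 next p. Proof. exact: wperm_cycle. Qed.
Let taE : ta =1 next q. Proof. exact: wperm_cycle. Qed.

Let Gsg : Gam e u sg.
Proof.
by case: th => pX pS _ _; exists (rcons p u); rewrite last_rcons theta_cycle.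
Qed.
Let Gta : Gam e u ta.
Proof.
by case: th => _ pS pY _; exists (rcons q u); rewrite last_rcons theta_cycle.
Qed.

Let Gkappa : Gam e u (ta * sg^-1 * ta^-1 * sg)%g.
Proof. by apply: GamM Gsg; apply: GamM (GamV e_sym Gta); apply: GamM Gta (GamV e_sym Gsg). Qed.

(** With the hole at [u], adjacent to [w], the tokens of the two cycles overlap only at [w], and the
    commutator is a 3-cycle at once. *)
Lemma theta_good0 : S = [::] -> exists A h, good e A h.
Proof.
move=> S0; have [pX pS pY U] := th.
exists [set k in [:: x1; u; w; y]], u.
apply: (@good_path4 _ _ _ _ _ w x1 y).
- have eyw : e y w := path_rcons_last pY.
  rewrite /= e_sym (path_rcons_head pX) [e w y]e_sym eyw !andbT /=.
  by move: pS; rewrite S0 /= andbT.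
- by case: Uthy.
- by rewrite (perm_catCA [:: x1] [:: u; w] [:: y]).
- by rewrite /tri -(commutator_c3 Uall sgE taE) ?S0.
Qed.

Let m := size p.
Let pos := [:: 0; (size X).+1; m.-1]%N.

Let sg_nth i : (i < m)%N -> sg (nth u p i) = nth u p (i.+1 %% m)%N.
Proof.
move=> im; by rewrite sgE next_nth_mod //; case/andP: Up.
Qed.

Let sgX_nth j i : (i < m)%N -> (sg ^+ j)%g (nth u p i) = nth u p ((i + j) %% m)%N.
Proof.
move=> im; elim: j => [|j IH]; first by rewrite perm1 addn0 modn_small.
rewrite expgSr permM IH sg_nth ?ltn_pmod ?(leq_ltn_trans _ im) //.
by rewrite -[(_ %% _).+1]addn1 modnDml addn1 addnS.
Qed.

Hypothesis S0 : S != [::].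
Variable j : nat.
Hypothesis jm : (j < m)%N.
Let a := (size X).+1.
Hypothesis jgood : j \notin [:: 0; 1; m.-1; a; m - a; a.+1; m - a.+1]%N.

Let sb := last w (rev S).
Let y_out : y \notin p.
Proof.
case: Uthy => _ _ _ + _; rewrite -/y => /andP[+ _]; apply: contra.
by rewrite /p -cat_rcons; rewrite !mem_cat mem_rcons !inE => /orP[/orP[->|->]|->];
    rewrite ?orbT.
Qed.
Let mE : m = (a + (size S).+1)%N.
Proof. by rewrite /m /p size_cat /= size_rev. Qed.
Let nth0 : nth u p 0 = x1. Proof. by []. Qed.
Let ntha : nth u p a = w. Proof. by rewrite /p nth_cat /= ltnn subnn. Qed.
Let nthb : nth u p m.-1 = sb.
Proof. by rewrite /m nth_last /p last_cat. Qed.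

Let shift_neq i i' : i \in pos -> i' \in pos ->
  (sg ^+ j)%g (nth u p i) != nth u p i'.
Proof.
have Up' : uniq p by case/andP: Up.
move=> ip ip'; have pm k : k \in pos -> (k < m)%N.
  exact: shift_lt mE.
have [im im'] := (pm _ ip, pm _ ip').
have m0 : (0 < m)%N by apply: leq_ltn_trans im.
rewrite sgX_nth // nth_uniq ?ltn_pmod //.
exact: (shift_arith mE).
Qed.

(* The double transpositions [c1], from the commutator, and [c2], its conjugate
   by [sg ^+ j], have only [y] in common; then [c2 * c2 ^ c1] is a 3-cycle. *)
Let tri_y : tri (Gam e u) y w ((sg ^+ j)%g w).
Proof.
have GX k : Gam e u (sg ^+ k)%g.
  by elim: k => [|k IH]; [exact: Gam1 | rewrite expgS; apply: GamM].
have S0' : rev S != [::] by rewrite -size_eq0 size_rev size_eq0.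
have [ps0 psa psb] : [/\ 0 \in pos, a \in pos & m.-1 \in pos]%N.
  by rewrite /pos -/a !inE !eqxx !orbT.
set r := (sg ^+ j)%g.
have ry : r y = y by rewrite /r permX_fix // sgE next_nth (negbTE y_out).
have := Gkappa; rewrite (commutator_tperm2 Uall sgE taE) // -/y -/sb => G1.
have : Gam e u ((tperm x1 sb * tperm y w) ^ r)%g.
  by rewrite conjgE; apply: GamM (GamV e_sym (GX j)) (GamM G1 (GX j)).
rewrite conjMg !tpermJ ry => G2.
have neq i i' : i \in pos -> i' \in pos -> nth u p i != r (nth u p i').
  by move=> ip ip'; rewrite eq_sym; apply: shift_neq.
have y_neq k : k \in p -> (y != k) * (k != y) * (y != r k) * (r k != y).
  move=> kp; have yk : y != k by apply: contraNneq y_out => ->.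
  have yrk : y != r k by rewrite -{1}ry (inj_eq perm_inj).
  by rewrite yk yrk eq_sym yk eq_sym yrk.
have [x1p wp sbp] : [/\ x1 \in p, w \in p & sb \in p].
  have mlt : (m.-1 < m)%N by rewrite mE addnS.
  rewrite -nth0 -ntha -nthb; split; apply: mem_nth; rewrite -/m //.
  by rewrite mE addnS ltnS leq_addr.
move: (neq _ _ ps0 ps0) (neq _ _ ps0 psa) (neq _ _ ps0 psb)
  (neq _ _ psa ps0) (neq _ _ psa psa) (neq _ _ psa psb)
  (neq _ _ psb ps0) (neq _ _ psb psa) (neq _ _ psb psb).
rewrite nth0 ntha nthb => n00 n0a n0b na0 naa nab nb0 nba nbb.
have Up' : uniq p by case/andP: Up.
have xw : x1 != w.
  by rewrite -nth0 -ntha nth_uniq // -/m mE addnS ltnS leq_addr.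
have bw : sb != w.
  have sS : (0 < size S)%N by rewrite lt0n size_eq0.
  have [m1 am] : (m.-1 < m)%N /\ (a < m)%N by rewrite mE addnS ltnS leq_addr.
  have : m.-1 != a by rewrite mE addnS /= -[X in _ != X]addn0 eqn_add2l -lt0n.
  by rewrite -nthb -ntha nth_uniq.
pose c1 := (tperm x1 sb * tperm y w)%g.
pose c2 := (tperm (r x1) (r sb) * tperm y (r w))%g.
have c1y : c1 y = w.
  by rewrite /c1 permM (tpermD (z := y)) ?y_neq // tpermL.
have c1f k : k != x1 -> k != sb -> k != y -> k != w -> c1 k = k.
  by move=> *; rewrite /c1 permM (tpermD (z := k)) ?tpermD // eq_sym.
have rE k : k \in p -> r k != y by case/y_neq.
have rE' k : k \in p -> y != r k by rewrite eq_sym; apply: rE.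
have G3 : Gam e u (c2 ^ c1)%g.
  by rewrite conjgE; apply: GamM (GamV e_sym G1) (GamM G2 G1).
have E3 : (c2 ^ c1)%g = (tperm (r x1) (r sb) * tperm w (r w))%g.
  by rewrite conjMg !tpermJ c1y !c1f ?rE // eq_sym.
have comm : c2 = (tperm y (r w) * tperm (r x1) (r sb))%g.
  rewrite /c2 [in RHS](conjgCV (tperm y (r w))) tpermJ tpermV.
  by rewrite !(tpermD (x := y)) ?rE' ?(inj_eq perm_inj) // eq_sym.
have := GamM G2 G3; rewrite -/c2 E3 comm -mulgA (mulgA (tperm _ (r sb))) tperm2 mul1g.
rewrite (tpermC y) (tpermC w) -/(c3 (r w) y w) => t.
have wrw : w != r w by [].
have : tri (Gam e u) (r w) y w by exact: t.
by have [[[yw _] _] _] := y_neq w wp; apply: tri_rot; rewrite // eq_sym.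
Qed.

(** The rotation [sg] fixes [y] and is transitive on the tokens of its cycle. The images of the
    triple [y], [w], [w'] under its powers all contain [y], so they merge until the whole cycle is
    covered. *)
Lemma theta_good_shift : exists A h, good e A h.
Proof.
have GX k : Gam e u (sg ^+ k)%g.
  by elim: k => [|k IH]; [exact: Gam1 | rewrite expgS; apply: GamM].
have := tri_y; set w' := (sg ^+ j)%g w => ty.
have wp : w \in p by rewrite mem_cat mem_head orbT.
have sgp k : k \in p -> sg k \in p by rewrite sgE mem_next.
have sgXp i k : k \in p -> (sg ^+ i)%g k \in p.
  by move=> kp; elim: i => [|i IH]; rewrite ?perm1 // expgSr permM sgp.
have yn k : k \in p -> y != k by move=> kp; apply: contraNneq y_out => ->.
have ww' : w != w'.
  by rewrite eq_sym /w' -ntha shift_neq // /pos -/a !inE eqxx orbT.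
have sgy : sg y = y by rewrite sgE next_nth (negbTE y_out).
pose B0 := [set y; w; w'].
have B0_3 : (2 < #|B0|)%N.
  by rewrite /B0 -setUA cardsU1 cards2 !inE ww' negb_or !yn //; apply: sgXp.
have aB0 : alt_on (Gam e u) B0.
  by apply: (alt_on3 (@GamM _ e u) (@GamV _ e e_sym u)) => //; apply: yn.
pose B n := iter n (fun B : {set T} => B0 :|: sg @: B) B0.
have BP n : [/\ y \in B n, alt_on (Gam e u) (B n), (2 < #|B n|)%N & (sg ^+ n)%g w \in B n].
  elim: n => [|n [yB aB B3 wB]].
    by split; rewrite // /B0 ?perm1 !inE eqxx ?orbT.
  have ysB : y \in sg @: B n by apply/imsetP; exists y.
  split.
  - by rewrite /= !inE eqxx.
  - apply: (alt_on_merge (@GamM _ e u) (@GamV _ e e_sym u) (c := y)) => //.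
    + by rewrite card_imset //; apply: perm_inj.
    + by rewrite !inE eqxx.
    + exact: (alt_on_J (@GamM _ e u) (@GamV _ e e_sym u) Gsg).
  - by apply: leq_trans B0_3 _; apply: subset_leq_card; apply: subsetUl.
  - by rewrite /= inE expgSr permM imset_f ?orbT.
have Bstep i : B i \subset B i.+1.
  elim: i => [|i IH]; first exact: subsetUl.
  by apply: setUS; apply: imsetS.
have Bmono n k : (n <= k)%N -> B n \subset B k.
  move/subnK <-; elim: (k - n)%N => [|d IH]; first by [].
  exact: subset_trans IH (Bstep _).
(* Listed in this order, the cycle together with [y] is a path, as [y] is adjacent to [w]. *)
exists [set k in y :: (w :: rev S) ++ u :: x1 :: X], u.
split.
- by rewrite !inE mem_cat mem_head !orbT.
- case: Uthy => _ _ _ Uham _; rewrite cardsE (card_uniqP _) //= size_cat /= size_rev.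
  by case: (S) S0 => //= s0 S' _; rewrite addnS.
- apply: conn_in_path; case: th => pX pS pY _.
  have eyw : e y w := path_rcons_last pY.
  rewrite cat_path /= eyw /=.
  have := path_rev e_sym pS; rewrite last_rcons belast_rcons rev_cons rcons_path.
  case/andP=> -> -> /=.
  by move: pX; rewrite rcons_path => /andP[].
- have [yB aB _ _] := BP m.
  apply: alt_on_sub aB; apply/subsetP=> k; rewrite in_setD1 inE => /andP[ku].
  rewrite inE => /orP[/eqP-> //|kin].
  have kp : k \in p.
    have : k \in (w :: rev S) ++ u :: x1 :: X by [].
    by rewrite mem_cat (in_cons u) (negbTE ku) orbC -mem_cat.
  have [i im ->] : exists2 i, (i < m)%N & k = (sg ^+ i)%g w.
    have am : (a < m)%N by rewrite mE addnS ltnS leq_addr.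
    have m0 : (0 < m)%N by rewrite mE addnS.
    (* Position [a] of [p] is [w]; the witness is the number of rotations from there to [k], modulo
       [m]. *)
    exists ((index k p + (m - a)) %% m)%N; first by rewrite ltn_pmod.
    rewrite -ntha sgX_nth // modnDmr addnCA (subnKC (ltnW am)).
    by rewrite modnDr modn_small ?index_mem // nth_index.
  by apply: (subsetP (Bmono _ _ (ltnW im))); have [] := BP i.
Qed.

End TwoCycles.
End Theta.

(** * Certificates for small graphs *)

Section ExplicitWalks.
Local Open Scope nat_scope.

(** This and the next definitions are copies of [tperm], [wperm] and [c3] on vertex numbers that can
    be evaluated. *)
Definition swapn (a b x : nat) := if x == a then b else if x == b then a else x.

Fixpoint nwalk a p x := if p is b :: p' then swapn a b (nwalk b p' x) else x.

Definition c3n x y z i := swapn x z (swapn x y i).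

Definition edge_in (E : seq (nat * nat)) : rel nat :=
  fun i j => ((i, j) \in E) || ((j, i) \in E).

(* A path [l] on four vertices, one of them the hole [h], and a closed walk from
   [h] whose effect is the 3-cycle [x -> y -> z -> x] of the other three. *)
Definition walk_cert := (seq nat * (nat * nat * nat * nat) * seq nat)%type.

Definition walk_ok n (E : seq (nat * nat)) (c : walk_cert) :=
  let: (l, (h, x, y, z), p) := c in
  [&& size l == 4, perm_eq l [:: h; x; y; z], uniq [:: h; x; y; z],
      path (edge_in E) (head 0 l) (behead l), path (edge_in E) h p, last h p == h,
      all (gtn n) [:: h, x, y, z & p ++ l]
    & all (fun i => nwalk h p i == c3n x y z i) (iota 0 n)].

Variables (T : finType) (e : rel T) (x0 : T) (vs : seq T) (E : seq (nat * nat)).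
Hypothesis e_sym : symmetric e.
Hypothesis Uvs : uniq vs.
Let f := nth x0 vs.
Hypothesis Ee : all (fun ij => e (f ij.1) (f ij.2)) E.
Let n := size vs.

Let edgeE i j : edge_in E i j -> e (f i) (f j).
Proof. by case/orP=> /(allP Ee) //=; rewrite e_sym. Qed.

Let f_inj i j : i < n -> j < n -> (f i == f j) = (i == j).
Proof. by move=> im jm; rewrite nth_uniq. Qed.

Let swapn_lt a b x : a < n -> b < n -> x < n -> swapn a b x < n.
Proof. by rewrite /swapn; case: ifP => // _; case: ifP. Qed.

Let tperm_f a b x : a < n -> b < n -> x < n -> tperm (f a) (f b) (f x) = f (swapn a b x).
Proof.
move=> an bn xn; rewrite /swapn -!(f_inj xn) //.
by case: tpermP => [->|->|/eqP/negbTE-> /eqP/negbTE->]; rewrite ?eqxx //; case: eqP => // ->.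
Qed.

Let nwalk_lt a p x : a < n -> all (gtn n) p -> x < n -> nwalk a p x < n.
Proof.
by elim: p a => //= b p IH a an /andP[bn pn] xn; apply: swapn_lt => //; apply: IH.
Qed.

Let wperm_f a p x : a < n -> all (gtn n) p -> x < n ->
  wperm (f a) (map f p) (f x) = f (nwalk a p x).
Proof.
elim: p a => [|b p IH] a an /=; first by rewrite perm1.
by case/andP=> bn pn xn; rewrite permM IH // tperm_f // nwalk_lt.
Qed.

(** The walk never visits a vertex outside [vs], and further edges of [e] do it no harm, so it has
    the same effect in the large graph as in the small one. *)
Lemma walk_ok_good c : walk_ok n E c -> exists A h, good e A h.
Proof.
case: c => [[l [[[h x] y] z]] p] /=.
case: l => [|a [|b [|c [|d [|? ?]]]]] //.
case/and5P=> _ pe U pl /and4P[pp lp al /allP ok].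
move: al => /and5P[hn xn yn zn]; rewrite all_cat => /andP[pn _].
exists [set k in [:: f a; f b; f c; f d]], (f h).
have fpath a' r : path (edge_in E) a' r -> path e (f a') (map f r).
  by elim: r a' => //= b' r IH a' /andP[/edgeE -> /IH].
have Uf : uniq [:: f h; f x; f y; f z].
  rewrite -[[:: f h; f x; f y; f z]]/(map f [:: h; x; y; z]) map_inj_in_uniq //.
  move=> i j; rewrite !inE => /or4P ii /or4P jj /eqP.
  rewrite f_inj; first by move/eqP.
    by case: ii => /eqP->.
  by case: jj => /eqP->.
apply: (@good_path4 _ _ _ _ _ _ _ _ (f x) (f y) (f z)) => //.
- exact: (fpath a [:: b; c; d]).
- exact: (perm_map f pe).
exists (map f p); split; first exact: fpath.
  by rewrite last_map (eqP lp).
apply/permP=> t; have [tvs|tvs] := boolP (t \in vs).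
  have tn : index t vs < n by rewrite index_mem.
  rewrite -(nth_index x0 tvs) -/f wperm_f // (eqP (ok _ _)) ?mem_iota //.
  rewrite permM !tperm_f //; last by apply: swapn_lt.
have fne i : i < n -> f i != t by move=> im; apply: contraNneq tvs => <-; rewrite mem_nth.
rewrite c3D ?fne // wperm_out //.
rewrite -map_cons; apply/mapP => -[i ip tE]; have := fne i.
rewrite tE eqxx => /(_ _)/negP; apply=> //.
by move: ip; rewrite inE => /orP[/eqP->//|/(allP pn)].
Qed.

End ExplicitWalks.

(** * Theta graphs by the lengths of their arcs *)

Section ThetaClassification.
Variables (T : finType) (e : rel T).
Implicit Types (u w : T) (X S Y : seq T).
Hypothesis e_sym : symmetric e.

(* The certificates below were found by breadth-first search over the states of
   the puzzle.  Vertices are numbered in the order of the list given first. *)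
Lemma theta_good11 u w x1 s1 Y :
  theta e u w [:: x1] [:: s1] Y -> exists A h, good e A h.
Proof.
case=> pX pS pY U.
(* Two arcs with one interior vertex each form a 4-cycle, and a single turn of the hole around it
   permutes the three tokens cyclically. *)
apply: (@walk_ok_good _ e u [:: u; w; x1; s1]
  [:: (0, 2); (2, 1); (0, 3); (3, 1)] e_sym _ _
  ([:: 0; 2; 1; 3], (0, 1, 3, 2), [:: 2; 1; 3; 0])) => //.
  by move: U; uniq_by_count.
by move: pX pS pY; rewrite /= !andbT; do ![case/andP | move=> ->].
Qed.

Lemma theta_good123 u w x1 s1 s2 y1 y2 y3 :
  theta e u w [:: x1] [:: s1; s2] [:: y1; y2; y3] -> exists A h, good e A h.
Proof.
case=> pX pS pY U.
apply: (@walk_ok_good _ e u [:: u; w; x1; s1; s2; y1; y2; y3]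
  [:: (0, 2); (2, 1); (0, 3); (3, 4); (4, 1); (0, 5); (5, 6); (6, 7); (7, 1)] e_sym _ _
  ([:: 4; 3; 0; 5], (0, 3, 4, 5), [:: 2; 1; 4; 3; 0; 2; 1; 7; 6; 5; 0; 2; 1;
  4; 3; 0; 2; 1; 7; 6; 5; 0; 2; 1; 4; 3; 0; 2; 1; 7; 6; 5; 0; 3; 4; 1; 7; 6;
  5; 0])) => //.
by move: pX pS pY; rewrite /= !andbT; do ![case/andP | move=> ->].
Qed.

Lemma theta_good222 u w x1 x2 s1 s2 y1 y2 :
  theta e u w [:: x1; x2] [:: s1; s2] [:: y1; y2] -> exists A h, good e A h.
Proof.
case=> pX pS pY U.
apply: (@walk_ok_good _ e u [:: u; w; x1; x2; s1; s2; y1; y2]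
  [:: (0, 2); (2, 3); (3, 1); (0, 4); (4, 5); (5, 1); (0, 6); (6, 7); (7, 1)] e_sym _ _
  ([:: 0; 6; 7; 1], (0, 1, 6, 7), [:: 2; 3; 1; 5; 4; 0; 2; 3; 1; 5; 4; 0; 2;
  3; 1; 7; 6; 0; 2; 3; 1; 5; 4; 0; 2; 3; 1; 5; 4; 0; 2; 3; 1; 7; 6; 0])) => //.
by move: pX pS pY; rewrite /= !andbT; do ![case/andP | move=> ->].
Qed.

Lemma theta_good223 u w x1 x2 s1 s2 y1 y2 y3 :
  theta e u w [:: x1; x2] [:: s1; s2] [:: y1; y2; y3] -> exists A h, good e A h.
Proof.
case=> pX pS pY U.
apply: (@walk_ok_good _ e u [:: u; w; x1; x2; s1; s2; y1; y2; y3]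
  [:: (0, 2); (2, 3); (3, 1); (0, 4); (4, 5); (5, 1); (0, 6); (6, 7);
      (7, 8); (8, 1)] e_sym _ _
  ([:: 0; 4; 5; 1], (0, 1, 4, 5), [:: 2; 3; 1; 5; 4; 0; 2; 3; 1; 8; 7; 6; 0;
  2; 3; 1; 8; 7; 6; 0; 4; 5; 1; 3; 2; 0; 4; 5; 1; 8; 7; 6; 0; 4; 5; 1; 3; 2;
  0; 4; 5; 1; 8; 7; 6; 0; 2; 3; 1; 8; 7; 6; 0; 4; 5; 1; 8; 7; 6; 0])) => //.
by move: pX pS pY; rewrite /= !andbT; do ![case/andP | move=> ->].
Qed.

Lemma theta_good224 u w x1 x2 s1 s2 y1 y2 y3 y4 :
  theta e u w [:: x1; x2] [:: s1; s2] [:: y1; y2; y3; y4] -> exists A h, good e A h.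
Proof.
case=> pX pS pY U.
apply: (@walk_ok_good _ e u [:: u; w; x1; x2; s1; s2; y1; y2; y3; y4]
  [:: (0, 2); (2, 3); (3, 1); (0, 4); (4, 5); (5, 1); (0, 6); (6, 7);
      (7, 8); (8, 9); (9, 1)] e_sym _ _
  ([:: 5; 4; 0; 6], (0, 4, 5, 6), [:: 2; 3; 1; 9; 8; 7; 6; 0; 2; 3; 1; 9; 8;
  7; 6; 0; 2; 3; 1; 9; 8; 7; 6; 0; 2; 3; 1; 5; 4; 0; 6; 7; 8; 9; 1; 5; 4; 0;
  6; 7; 8; 9; 1; 3; 2; 0; 6; 7; 8; 9; 1; 3; 2; 0; 6; 7; 8; 9; 1; 5; 4; 0; 6;
  7; 8; 9; 1; 5; 4; 0])) => //.
by move: pX pS pY; rewrite /= !andbT; do ![case/andP | move=> ->].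
Qed.

(** Pigeonhole: there are at least eight shifts, and seven values are excluded. *)
Lemma shift_exists a b : (7 <= a + b)%N ->
  exists2 j, (j < a + b.+1)%N &
    j \notin [:: 0; 1; (a + b.+1).-1; a; a + b.+1 - a; a.+1; a + b.+1 - a.+1]%N.
Proof.
move=> ab; set bad := [:: _; _ ; _; _; _; _; _].
have [/allP sub|/allPn[j]] := boolP (all (mem bad) (iota 0 (a + b.+1))).
  have := uniq_leq_size (iota_uniq 0 (a + b.+1)) sub.
  by rewrite size_iota /= addnS ltnNge ab.
by rewrite mem_iota => /andP[_ jm] jbad; exists j.
Qed.

Lemma theta_good_arcs u w X Z Y j : theta e u w X Z Y ->
    X != [::] -> Z != [::] -> Y != [::] ->
    (j < size X + (size Z).+1)%N ->
    j \notin [:: 0; 1; (size X + (size Z).+1).-1; size X; size X + (size Z).+1 - size X;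
      (size X).+1; size X + (size Z).+1 - (size X).+1]%N ->
  exists A h, good e A h.
Proof.
case: X => // x1 X; case: Y => // y1 Y th _ S0 _ jm jbad.
have mE : size ((x1 :: X) ++ w :: rev Z) = (size (x1 :: X) + (size Z).+1)%N.
  by rewrite size_cat /= size_rev.
by apply: (theta_good_shift e_sym th S0 (j := j)); rewrite mE.
Qed.

(** An empty arc gives a 3-cycle directly. If the two longer arcs have seven or more interior
    vertices together, their cycle has an admissible shift. This leaves finitely many sizes besides
    an arbitrary third arc over 1, 1; in fact 1, 1 forms a 4-cycle. Among the others, 3, 3 as the
    longer arcs and 1, 2, 4 still admit a shift, and the rest need certificates. *)
Lemma theta_good_sorted u w X Z Y : theta e u w X Z Y ->
    (size X <= size Z <= size Y)%N -> (0 < size Z)%N ->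
    [:: size X; size Z; size Y] != [:: 1; 2; 2]%N ->
  exists A h, good e A h.
Proof.
move=> th /andP[XZ ZY] S0 ne.
have nS : Z != [::] by rewrite -size_eq0 -lt0n.
have nY : Y != [::] by rewrite -size_eq0 -lt0n (leq_trans S0).
have [X0|] := eqVneq (size X) 0%N.
  case: X X0 th {XZ ne} => // _ /theta_swap12.
  case: Z nS {S0 ZY} => // s1 Z _; case: Y nY => // y1 Y _ th.
  exact: (theta_good0 e_sym th).
move=> nX'; have nX : X != [::] by rewrite -size_eq0.
have [big|small] := leqP 7 (size Z + size Y).
  have [j jm jbad] := shift_exists big.
  exact: (theta_good_arcs (theta_swap23 (theta_swap12 th)) nS nY nX jm jbad).
have [/eqP X1|X1] := boolP (size X == 1%N); last first.
  have [/eqP S3|S3] := boolP (size Z == 3%N).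
    have Y3 : size Y = 3%N by lia.
    (* Seven rotating tokens, with arcs 3 and 3: the admissible shifts are 2 and 5. *)
    by apply: (theta_good_arcs (theta_swap23 (theta_swap12 th)) nS nY nX (j := 2));
        rewrite S3 Y3.
  have [X2 S2] : (size X = 2 /\ size Z = 2)%N by lia.
  have Y234 : size Y \in [:: 2; 3; 4]%N by rewrite !inE; lia.
  case: X X2 th {XZ nX nX' X1 ne} => [|x1 [|x2 [|]]] // _.
  case: Z S2 {ZY S0 nS S3 small} => [|s1 [|s2 [|]]] // _.
  case: Y Y234 {nY} => [|y1 [|y2 [|y3 [|y4 [|]]]]] // _.
  - exact: theta_good222.
  - exact: theta_good223.
  - exact: theta_good224.
have [/eqP S1|S1] := boolP (size Z == 1%N).
  case: X X1 th {XZ nX nX' ne} => [|x1 [|]] // _.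
  case: Z S1 {ZY S0 nS small} => [|s1 [|]] // _.
  exact: theta_good11.
have [/eqP S3|S3] := boolP (size Z == 3%N).
  have Y3 : size Y = 3%N by lia.
  by apply: (theta_good_arcs (theta_swap23 (theta_swap12 th)) nS nY nX (j := 2));
      rewrite S3 Y3.
have S2 : size Z = 2%N by lia.
have [/eqP Y4|Y4] := boolP (size Y == 4%N).
  (* The cycle of the shortest and the longest arc has six rotating tokens, and 3 is its only
     admissible shift. *)
  by apply: (theta_good_arcs (theta_swap23 th) nX nY nS (j := 3)); rewrite X1 Y4.
have Y2 : size Y != 2%N by apply: contra ne => /eqP ->; rewrite X1 S2.
have Y3 : size Y = 3%N by lia.
case: X X1 th {XZ nX nX' ne} => [|x1 [|]] // _.
case: Z S2 {ZY S0 nS small S1 S3} => [|s1 [|s2 [|]]] // _.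
case: Y Y3 {nY Y4 Y2} => [|y1 [|y2 [|y3 [|]]]] // _.
exact: theta_good123.
Qed.

(* The excluded sizes are those of theta0. *)
Lemma theta_good u w X Z Y : theta e u w X Z Y ->
    (0 < size X + size Z)%N -> (0 < size Z + size Y)%N -> (0 < size X + size Y)%N ->
    ~~ perm_eq [:: size X; size Z; size Y] [:: 1; 2; 2]%N ->
  exists A h, good e A h.
Proof.
move=> th XZ ZY XY ne.
have nep l : perm_eq l [:: size X; size Z; size Y] -> l != [:: 1; 2; 2]%N.
  by move=> pe; apply: contraNneq ne => <-; rewrite perm_sym.
pose s12 := theta_swap12; pose s23 := theta_swap23.
have pC a b c : perm_eql [:: a; b; c] [:: b; a; c] := perm_catCA [:: a] [:: b] [:: c].
have pC' a b c : perm_eql [:: a; b; c] [:: a; c; b].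
  by apply/permPl; rewrite perm_cons; apply/permPl/(perm_catC [:: b] [:: c]).
case: (leqP (size X) (size Z)) => h1; case: (leqP (size Z) (size Y)) => h2;
  case: (leqP (size X) (size Y)) => h3.
- by apply: (theta_good_sorted th); rewrite ?h1 ?h2 ?nep //; lia.
- by lia.
- apply: (theta_good_sorted (theta_swap23 th)); rewrite ?h3 ?(ltnW h2) //; first by lia.
  by apply: nep; rewrite pC'.
- apply: (theta_good_sorted (theta_swap12 (theta_swap23 th))); rewrite ?h1 ?(ltnW h3) //;
    first by lia.
  by apply: nep; rewrite pC pC'.
- apply: (theta_good_sorted (theta_swap12 th)); rewrite ?h3 ?(ltnW h1) //; first by lia.
  by apply: nep; rewrite pC.
- apply: (theta_good_sorted (theta_swap23 (theta_swap12 th))); rewrite ?h2 ?(ltnW h3) //;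
    first by lia.
  by apply: nep; rewrite pC' pC.
- by lia.
- apply: (theta_good_sorted (theta_swap12 (theta_swap23 (theta_swap12 th))));
    rewrite ?(ltnW h2) ?(ltnW h1) //; first by lia.
  by apply: nep; rewrite pC pC' pC.
Qed.

End ThetaClassification.

(** * Graphs containing theta0 *)

Section Theta0.
Local Open Scope nat_scope.

Definition theta0_edges : seq (nat * nat) :=
  [:: (0, 1); (1, 2); (2, 3); (3, 4); (4, 5); (0, 5); (0, 6); (3, 6)].

(* For [p < q], the interiors of two disjoint paths from [p] to [q]. *)
Definition theta0_arcs : seq ((nat * nat) * (seq nat * seq nat)) := [::
  ((0, 1), ([::], [:: 6; 3; 2]));
  ((0, 2), ([:: 1], [:: 6; 3]));
  ((0, 3), ([:: 1; 2], [:: 6]));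
  ((0, 4), ([:: 5], [:: 6; 3]));
  ((0, 5), ([::], [:: 6; 3; 4]));
  ((0, 6), ([:: 1; 2; 3], [::]));
  ((1, 2), ([::], [:: 0; 6; 3]));
  ((1, 3), ([:: 2], [:: 0; 6]));
  ((1, 4), ([:: 2; 3], [:: 0; 5]));
  ((1, 5), ([:: 2; 3; 4], [:: 0]));
  ((1, 6), ([:: 2; 3], [:: 0]));
  ((2, 3), ([::], [:: 1; 0; 6]));
  ((2, 4), ([:: 3], [:: 1; 0; 5]));
  ((2, 5), ([:: 3; 4], [:: 1; 0]));
  ((2, 6), ([:: 3], [:: 1; 0]));
  ((3, 4), ([:: 6; 0; 5], [::]));
  ((3, 5), ([:: 6; 0], [:: 4]));
  ((3, 6), ([::], [:: 2; 1; 0]));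
  ((4, 5), ([:: 3; 6; 0], [::]));
  ((4, 6), ([:: 3], [:: 5; 0]));
  ((5, 6), ([:: 4; 3], [:: 0]))].

(* Certificates for theta0 with a path from [p] to [q] added that has none, one
   or two interior vertices, numbered from 7 on.  Longer paths need none: with
   the arcs above they form a theta graph other than theta0. *)
Definition theta0_chord_certs : seq ((nat * nat) * walk_cert) := [::
  ((0, 2), ([:: 0; 2; 3; 6], (0, 2, 6, 3), [:: 6; 3; 2; 0]));
  ((0, 3), ([:: 0; 1; 2; 3], (0, 1, 2, 3), [:: 1; 2; 3; 0]));
  ((0, 4), ([:: 0; 4; 3; 6], (0, 3, 4, 6), [:: 6; 3; 4; 0]));
  ((1, 3), ([:: 0; 1; 3; 6], (0, 1, 3, 6), [:: 1; 3; 6; 0]));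
  ((1, 4), ([:: 0; 1; 4; 5], (0, 1, 4, 5), [:: 1; 4; 5; 0]));
  ((1, 5), ([:: 0; 6; 3; 2], (0, 2, 3, 6), [:: 1; 2; 3; 4; 5; 0; 1; 5; 4; 3;
    6; 0]));
  ((1, 6), ([:: 1; 2; 3; 6], (1, 2, 3, 6), [:: 2; 3; 6; 1]));
  ((2, 4), ([:: 3; 6; 0; 5], (0, 3, 6, 5), [:: 1; 2; 3; 4; 2; 1; 0; 5; 4; 3;
    6; 0]));
  ((2, 5), ([:: 0; 1; 2; 5], (0, 1, 2, 5), [:: 1; 2; 5; 0]));
  ((2, 6), ([:: 0; 1; 2; 6], (0, 1, 2, 6), [:: 1; 2; 6; 0]));
  ((3, 5), ([:: 0; 5; 3; 6], (0, 3, 6, 5), [:: 5; 3; 6; 0]));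
  ((4, 6), ([:: 0; 5; 4; 6], (0, 4, 6, 5), [:: 5; 4; 6; 0]));
  ((5, 6), ([:: 3; 4; 5; 6], (3, 4, 5, 6), [:: 4; 5; 6; 3]))].

Definition theta0_ear1_certs : seq ((nat * nat) * walk_cert) := [::
  ((0, 1), ([:: 0; 7; 1; 2], (0, 1, 2, 7), [:: 1; 2; 3; 6; 0; 1; 7; 0; 6; 3;
    2; 1; 7; 0]));
  ((0, 2), ([:: 0; 1; 2; 7], (0, 1, 2, 7), [:: 1; 2; 7; 0]));
  ((0, 3), ([:: 0; 6; 3; 7], (0, 3, 7, 6), [:: 6; 3; 7; 0]));
  ((0, 4), ([:: 0; 5; 4; 7], (0, 4, 7, 5), [:: 5; 4; 7; 0]));
  ((0, 5), ([:: 0; 7; 5; 4], (0, 4, 7, 5), [:: 5; 4; 3; 6; 0; 5; 7; 0; 6; 3;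
    4; 5; 7; 0]));
  ((0, 6), ([:: 1; 0; 6; 7], (0, 1, 7, 6), [:: 1; 2; 3; 6; 0; 7; 6; 3; 2; 1;
    0; 6; 7; 0]));
  ((1, 2), ([:: 0; 1; 2; 7], (0, 1, 2, 7), [:: 1; 2; 7; 1; 0; 6; 3; 2; 1; 7;
    2; 3; 6; 0]));
  ((1, 3), ([:: 1; 2; 3; 7], (1, 2, 3, 7), [:: 2; 3; 7; 1]));
  ((1, 4), ([:: 6; 0; 1; 7], (0, 1, 7, 6), [:: 1; 2; 3; 6; 0; 5; 4; 3; 2; 1;
    7; 4; 5; 0]));
  ((1, 5), ([:: 0; 1; 7; 5], (0, 1, 7, 5), [:: 1; 7; 5; 0]));
  ((1, 6), ([:: 0; 1; 7; 6], (0, 1, 7, 6), [:: 1; 7; 6; 0]));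
  ((2, 3), ([:: 1; 2; 3; 7], (1, 2, 7, 3), [:: 0; 6; 3; 2; 7; 3; 6; 0; 1; 2;
    3; 7; 2; 1]));
  ((2, 4), ([:: 2; 3; 4; 7], (2, 3, 4, 7), [:: 3; 4; 7; 2]));
  ((2, 5), ([:: 6; 0; 5; 7], (0, 5, 6, 7), [:: 1; 2; 7; 5; 4; 3; 2; 1; 0; 6;
    3; 4; 5; 0]));
  ((2, 6), ([:: 2; 3; 6; 7], (2, 3, 6, 7), [:: 3; 6; 7; 2]));
  ((3, 4), ([:: 3; 7; 4; 5], (3, 4, 5, 7), [:: 4; 5; 0; 6; 3; 4; 7; 3; 6; 0;
    5; 4; 7; 3]));
  ((3, 5), ([:: 3; 4; 5; 7], (3, 4, 5, 7), [:: 4; 5; 7; 3]));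
  ((3, 6), ([:: 0; 6; 3; 7], (0, 3, 6, 7), [:: 1; 2; 3; 6; 7; 3; 2; 1; 0; 6;
    3; 7; 6; 0]));
  ((4, 5), ([:: 0; 5; 4; 7], (0, 4, 7, 5), [:: 5; 4; 7; 5; 0; 6; 3; 4; 5; 7;
    4; 3; 6; 0]));
  ((4, 6), ([:: 3; 4; 7; 6], (3, 4, 7, 6), [:: 4; 7; 6; 3]));
  ((5, 6), ([:: 0; 5; 7; 6], (0, 5, 7, 6), [:: 5; 7; 6; 0]))].

Definition theta0_ear2_certs : seq ((nat * nat) * walk_cert) := [::
  ((0, 1), ([:: 0; 1; 8; 7], (0, 1, 8, 7), [:: 1; 8; 7; 0]));
  ((0, 2), ([:: 2; 1; 0; 6], (2, 0, 6, 1), [:: 3; 4; 5; 0; 6; 3; 2; 8; 7; 0;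
    1; 2; 3; 6; 0; 5; 4; 3; 2; 1; 0; 7; 8; 2]));
  ((0, 3), ([:: 0; 6; 3; 4], (0, 3, 4, 6), [:: 1; 2; 3; 4; 5; 0; 7; 8; 3; 6;
    0; 5; 4; 3; 2; 1; 0; 6; 3; 8; 7; 0]));
  ((0, 4), ([:: 3; 6; 0; 7], (3, 0, 6, 7), [:: 2; 1; 0; 6; 3; 4; 5; 0; 7; 8;
    4; 3; 6; 0; 1; 2; 3; 4; 8; 7; 0; 5; 4; 3]));
  ((0, 5), ([:: 0; 5; 8; 7], (0, 5, 8, 7), [:: 5; 8; 7; 0]));
  ((0, 6), ([:: 0; 6; 8; 7], (0, 6, 8, 7), [:: 6; 8; 7; 0]));
  ((1, 2), ([:: 1; 2; 8; 7], (1, 2, 8, 7), [:: 2; 8; 7; 1]));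
  ((1, 3), ([:: 0; 6; 3; 8], (0, 3, 8, 6), [:: 1; 2; 3; 8; 7; 1; 0; 5; 4; 3;
    6; 0; 1; 7; 8; 3; 2; 1; 0; 6; 3; 4; 5; 0]));
  ((1, 4), ([:: 2; 1; 0; 5], (0, 1, 2, 5), [:: 1; 7; 8; 4; 5; 0; 6; 3; 4; 8;
    7; 1; 2; 3; 6; 0]));
  ((1, 5), ([:: 1; 2; 3; 4], (1, 2, 3, 4), [:: 2; 3; 6; 0; 1; 7; 8; 5; 0; 6;
    3; 4; 5; 8; 7; 1]));
  ((1, 6), ([:: 1; 0; 6; 3], (0, 1, 3, 6), [:: 1; 7; 8; 6; 3; 4; 5; 0; 6; 8;
    7; 1; 0; 5; 4; 3; 6; 0]));
  ((2, 3), ([:: 2; 3; 8; 7], (2, 3, 8, 7), [:: 3; 8; 7; 2]));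
  ((2, 4), ([:: 2; 1; 0; 5], (0, 1, 2, 5), [:: 1; 2; 7; 8; 4; 5; 0; 6; 3; 4;
    8; 7; 2; 3; 6; 0]));
  ((2, 5), ([:: 1; 0; 5; 4], (0, 1, 5, 4), [:: 5; 8; 7; 2; 1; 0; 6; 3; 2; 7;
    8; 5; 4; 3; 6; 0]));
  ((2, 6), ([:: 0; 6; 3; 2], (0, 2, 3, 6), [:: 5; 4; 3; 2; 7; 8; 6; 3; 4; 5;
    0; 6; 8; 7; 2; 3; 6; 0]));
  ((3, 4), ([:: 3; 4; 8; 7], (3, 4, 8, 7), [:: 4; 8; 7; 3]));
  ((3, 5), ([:: 0; 6; 3; 7], (0, 3, 6, 7), [:: 1; 2; 3; 6; 0; 5; 4; 3; 7; 8;
    5; 0; 6; 3; 2; 1; 0; 5; 8; 7; 3; 4; 5; 0]));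
  ((3, 6), ([:: 3; 6; 8; 7], (3, 6, 8, 7), [:: 6; 8; 7; 3]));
  ((4, 5), ([:: 4; 5; 8; 7], (4, 5, 8, 7), [:: 5; 8; 7; 4]));
  ((4, 6), ([:: 0; 6; 3; 4], (0, 3, 6, 4), [:: 1; 2; 3; 4; 7; 8; 6; 3; 2; 1;
    0; 6; 8; 7; 4; 3; 6; 0]));
  ((5, 6), ([:: 1; 0; 6; 8], (0, 1, 8, 6), [:: 1; 2; 3; 6; 8; 7; 5; 0; 6; 3;
    2; 1; 0; 5; 7; 8; 6; 0]))].

Definition ear_edges k p q := zip (p :: iota 7 k) (rcons (iota 7 k) q).

Definition cert_in (tab : seq ((nat * nat) * walk_cert)) k p q :=
  has (fun c => (c.1 == (p, q)) && walk_ok (7 + k) (theta0_edges ++ ear_edges k p q) c.2) tab.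

Lemma theta0_tables_ok : all (fun q => all (fun p =>
    [&& edge_in theta0_edges p q || cert_in theta0_chord_certs 0 p q,
        cert_in theta0_ear1_certs 1 p q, cert_in theta0_ear2_certs 2 p q
      & has (fun a => let: (L1, L2) := a.2 in
          [&& a.1 == (p, q), path (edge_in theta0_edges) p (rcons L1 q),
            path (edge_in theta0_edges) p (rcons L2 q), uniq ([:: p; q] ++ L1 ++ L2),
            all (gtn 7) ([:: p; q] ++ L1 ++ L2) & 0 < size L1 + size L2]) theta0_arcs])
  (iota 0 q)) (iota 0 7).
Proof. by vm_compute. Qed.

Variables (T : finType) (e : rel T).
Hypothesis e_sym : symmetric e.
Variables (v0 v1 v2 v3 v4 v5 v6 : T).
Let vs := [:: v0; v1; v2; v3; v4; v5; v6].
Hypothesis Uvs : uniq vs.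
Let f := nth v0 vs.
Hypothesis Ee : all (fun ij => e (f ij.1) (f ij.2)) theta0_edges.

Lemma theta0_cert_good tab k p q ps : cert_in tab k p q -> size ps = k ->
    k <= 2 -> p < 7 -> q < 7 ->
    path e (f p) (rcons ps (f q)) -> uniq (vs ++ ps) ->
  exists A h, good e A h.
Proof.
move=> /hasP[[pq c] _ /andP[_ ok]] szk k2 p7 q7 pp U.
apply: (@walk_ok_good _ e v0 (vs ++ ps) (theta0_edges ++ ear_edges k p q) e_sym U _ c).
  rewrite all_cat; apply/andP; split; first exact: Ee.
  have [fp fq] : nth v0 (vs ++ ps) p = f p /\ nth v0 (vs ++ ps) q = f q.
    by rewrite !nth_cat p7 q7.
  move: pp; rewrite -fp -fq -szk.
  case: ps szk U {fp fq} => [|a [|b [|d ps]]] szk U //=; last by rewrite -szk in k2.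
by rewrite size_cat szk.
Qed.

Lemma theta0_pair_good p q ps : p < q -> q < 7 ->
    path e (f p) (rcons ps (f q)) -> uniq (vs ++ ps) ->
    edge_in theta0_edges p q = false \/ ps != [::] ->
  exists A h, good e A h.
Proof.
move=> pq q7 pp U ne.
have /allP/(_ q) := theta0_tables_ok; rewrite mem_iota q7 => /(_ isT)/allP/(_ p).
rewrite mem_iota pq => /(_ isT)/and4P[c0 c1 c2 /hasP[[pq' [L1 L2]] _]].
have p7 := ltn_trans pq q7.
case/and5P=> _ pL1 pL2 UL /andP[L7 L0].
have [k3|] := ltnP 2 (size ps); last first.
  rewrite leq_eqVlt => /orP[/eqP k2|]; first exact: (theta0_cert_good c2 k2 _ p7 q7 pp U).
  rewrite ltnS leq_eqVlt => /orP[/eqP k1|]; first exact: (theta0_cert_good c1 k1 _ p7 q7 pp U).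
  rewrite ltnS leqn0 => /eqP k0.
  case: ne => [ne|]; last by rewrite -size_eq0 k0.
  by move: c0; rewrite ne => c0; exact: (theta0_cert_good c0 k0 _ p7 q7 pp U).
have fpath a r : path (edge_in theta0_edges) a r -> path e (f a) (map f r).
  elim: r a => //= b r IH a /andP[ab /IH ->]; rewrite andbT.
  by case/orP: ab => /(allP Ee) //=; rewrite e_sym.
have th : theta e (f p) (f q) (map f L1) (map f L2) ps.
  split => //; first by rewrite -map_rcons fpath.
    by rewrite -map_rcons fpath.
  have : uniq (map f ([:: p; q] ++ L1 ++ L2) ++ ps).
    move: U; rewrite !cat_uniq => /and3P[_ psv ->]; rewrite andbT; apply/andP; split.
      rewrite map_inj_in_uniq // => i j /(allP L7) i7 /(allP L7) j7 /eqP.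
      by rewrite nth_uniq // => /eqP.
    apply: contra psv => /hasP[z zps /mapP[i /(allP L7) i7 zE]].
    by apply/hasP; exists z; rewrite // zE; apply: mem_nth.
  by rewrite !map_cat -!catA.
apply: (theta_good e_sym th); rewrite !size_map //.
- by rewrite addn_gt0 (ltn_trans _ k3) ?orbT.
- by rewrite addn_gt0 (ltn_trans _ k3) ?orbT.
- apply: contraL k3 => /perm_mem/(_ (size ps)).
  by rewrite !inE eqxx !orbT => /esym/or3P[]/eqP ->.
Qed.

End Theta0.

(** * Wilson's theorem *)

Section CycleTheta.
Variables (T : finType) (e : rel T).
Implicit Types (x y z u v w : T) (p q c : seq T).
Hypothesis e_sym : symmetric e.
Hypothesis e_irr : irreflexive e.
Hypothesis connG : forall x y, connect e x y.
Hypothesis nsepG : forall v x y, x != v -> y != v ->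
  connect [rel a b | [&& e a b, a != v & b != v]] x y.

(** Non-separability is used twice: deleting [v] leaves [u] a second neighbour [v'], and deleting
    [u] leaves a path from [v] to [v']. *)
Lemma cycle_exists : (2 < #|T|)%N -> exists c, [/\ path.cycle e c, uniq c & (2 < size c)%N].
Proof.
move=> T3; have [u] : exists u : T, u \in T by apply/card_gt0P; apply: leq_trans T3.
move=> _.
have other (a b : T) : exists2 z, z != a & z != b.
  have : (0 < #|~: [set a; b]|)%N.
    have := cardsC [set a; b]; have := cards2 a b.
    by move: T3; rewrite cardE -cardE; case: (a != b) => /=; lia.
  by case/card_gt0P=> z; rewrite !inE negb_or => /andP[]; exists z.
have step (r : rel T) x z : z != x -> connect r x z -> exists v, r x v.
  move=> zx /connectP[[|v p] /=]; first by move=> _ zE; rewrite zE eqxx in zx.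
  by move=> /andP[rxv _] _; exists v.
have [z zu _] := other u u.
have [v euv] := step _ _ _ zu (connG u z).
have vu : v != u by apply: contraTneq euv => ->; rewrite e_irr.
have uv : u != v by rewrite eq_sym.
have [z' z'u z'v] := other u v.
have [v' /= /and3P[euv' _ v'v]] := step _ _ _ z'u (nsepG uv z'v).
have v'u : v' != u by apply: contraTneq euv' => ->; rewrite e_irr.
have /connectP[p0 pp0 lp0] := nsepG vu v'u.
move: lp0; case/shortenP: pp0 => p pp Up _ lp.
exists (u :: v :: p); split.
- rewrite /= euv rcons_path -lp [e v' u]e_sym euv' andbT.
  by apply: sub_path pp => a b /and3P[].
- rewrite cons_uniq Up andbT; apply/negP => up.
  have : all (predC1 u) (v :: p).
    rewrite /= vu /=; elim: p (v) pp {lp Up up} => //= b p IH a /andP[/and3P[_ _ ->]].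
    exact: IH.
  by move/allP/(_ _ up); rewrite /= eqxx.
- by case: p lp {pp Up} => //= vE; rewrite vE eqxx in v'v.
Qed.

Lemma cycle_arcs c x y : path.cycle e c -> uniq c -> x \in c -> y \in c -> x != y ->
  exists X Z, [/\ perm_eq c (x :: X ++ y :: Z), path e x (rcons X y),
    path e x (rcons (rev Z) y), next c =1 next (x :: X ++ y :: Z) & size c = (size X + size
        Z).+2].
Proof.
move=> cc Uc xc yc xy; case: (rot_to xc) => i s rE.
have : y \in x :: s by rewrite -rE mem_rot.
rewrite inE eq_sym (negbTE xy) /= => ys.
case/splitPr: ys rE => X Z rE; exists X, Z.
have : path.cycle e (x :: X ++ y :: Z) by rewrite -rE rot_cycle.
rewrite /= rcons_cat rcons_cons -cat_rcons cat_path last_rcons => /andP[pX pZ].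
split => //.
- by rewrite -rE perm_sym perm_rot.
- by have := path_rev e_sym pZ; rewrite last_rcons belast_rcons rev_cons.
- by move=> z; rewrite -rE next_rot.
- by rewrite -(size_rot i) rE /= size_cat /= addnS.
Qed.

(** A chord is treated as an arc without interior. The three inequalities say that at most one arc
    is a single edge: a chord joins vertices that are not neighbours on the cycle. *)
Lemma theta_exists c : path.cycle e c -> uniq c -> (2 < size c)%N ->
    ~ ((forall x, x \in c) /\ forall x y, e x y -> (y == next c x) || (x == next c y)) ->
  exists u w X Z Y, theta e u w X Z Y /\
    [/\ (0 < size X + size Z)%N, (0 < size Z + size Y)%N & (0 < size X + size Y)%N].
Proof.
move=> cc Uc c3 npoly.
suff H x y Y : x \in c -> y \in c -> x != y -> path e x (rcons Y y) -> uniq Y ->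
    {in Y, forall z, z \notin c} -> Y != [::] \/ (y != next c x) && (x != next c y) ->
  exists u w X Z Y, theta e u w X Z Y /\
    [/\ (0 < size X + size Z)%N, (0 < size Z + size Y)%N & (0 < size X + size Y)%N].
  have [/forallP allc|] := boolP [forall x, x \in c]; last first.
    rewrite negb_forall => /existsP[z zc].
    have [||u [p [w [pp Up p0 pc [uc wc uw]]]]] := @ear_exists _ e connG nsepG [set x in c] z.
    - by rewrite cardsE (card_uniqP _) // ltnW.
    - by rewrite inE.
    rewrite !inE in uc wc.
    apply: (H u w p) => //; last by left.
    by move=> k /pc; rewrite inE.
  have [|] := boolP [forall x, [forall y, e x y ==> ((y == next c x) || (x == next c y))]].
    move=> /forallP h; case: npoly; split=> // x y exy.
    by have /forallP/(_ y) := h x; rewrite exy.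
  rewrite negb_forall => /existsP[x]; rewrite negb_forall => /existsP[y].
  rewrite negb_imply negb_or => /andP[exy chord].
  apply: (H x y [::]) => //; last by right.
  - by apply: contraTneq exy => ->; rewrite e_irr.
  - by rewrite /= exy.
move=> xc yc xy pY UY Yc nonadj.
have [X [Z [pe pX pZ nE szc]]] := cycle_arcs cc Uc xc yc xy.
have Ux : uniq (x :: X ++ y :: Z) by rewrite -(perm_uniq pe).
exists x, y, X, (rev Z), Y; split.
  split=> //.
  have U : uniq ((x :: X ++ y :: Z) ++ Y).
    rewrite cat_uniq Ux UY andbT; apply/hasPn => k /Yc.
    by rewrite /= (perm_mem pe).
  by move: U; uniq_by_count.
rewrite size_rev; split.
- by move: szc c3 => ->; rewrite !ltnS.
- rewrite addn_gt0; case: nonadj => [|/andP[_ nx]];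
    first by rewrite -size_eq0 -lt0n orbC => ->.
  rewrite lt0n size_eq0; case: eqP => // Z0; move: nx; rewrite nE Z0.
  move: Ux; rewrite Z0 cats1 -rcons_cons => Ux.
  by have := next_lastE Ux; rewrite last_rcons => ->; rewrite eqxx.
- rewrite addn_gt0; case: nonadj => [|/andP[nx _]];
    first by rewrite -size_eq0 -lt0n orbC => ->.
  rewrite lt0n size_eq0; case: eqP => // X0; move: nx; rewrite nE X0.
  by rewrite X0 in Ux; rewrite (@next_mid _ [::]) ?eqxx.
Qed.

(** Only the presence of the eight edges is asked for, so the seven vertices may carry chords and
    need not exhaust the graph. *)
Definition theta0_vertices (vs : seq T) := 
  [/\ size vs = 7, uniq vs & forall x0, all (fun ij => e (nth x0 vs ij.1) (nth x0 vs ij.2))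
      theta0_edges].

Lemma theta_good_or_theta0 u w X Z Y : theta e u w X Z Y ->
    [/\ (0 < size X + size Z)%N, (0 < size Z + size Y)%N & (0 < size X + size Y)%N] ->
  (exists A h, good e A h) \/ exists vs, theta0_vertices vs.
Proof.
move=> th [XZ ZY XY].
have [pe|npe] := boolP (perm_eq [:: size X; size Z; size Y] [:: 1; 2; 2]%N); last first.
  by left; apply: (theta_good e_sym th).
right.
have main b s1 s2 y1 y2 : theta e u w [:: b] [:: s1; s2] [:: y1; y2] ->
    exists vs, theta0_vertices vs.
  (* The hexagon goes out along one long arc and back along the other; the short arc provides the
     seventh vertex. *)
  case=> pX pZ pY U; exists [:: u; s1; s2; w; y2; y1; b]; split=> //.
    by move: U; uniq_by_count.
  move=> x0; move: pX pZ pY; rewrite /= !andbT.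
  by rewrite [e w y2]e_sym [e y2 y1]e_sym [e w b]e_sym; do ![case/andP | move=> ->].
have szs : [\/ [/\ size X = 1, size Z = 2 & size Y = 2]%N,
    [/\ size X = 2, size Z = 1 & size Y = 2]%N | [/\ size X = 2, size Z = 2 & size Y = 1]%N].
  have /=/and4P[hX hZ hY _] : all (mem [:: 1; 2]%N) [:: size X; size Z; size Y].
    by rewrite (perm_all _ pe).
  have := perm_sumn pe; move: hX hZ hY; rewrite /= !inE.
  case/orP=> /eqP->; case/orP=> /eqP->; case/orP=> /eqP-> //= _.
  - by constructor 1.
  - by constructor 2.
  - by constructor 3.
case: szs => [[X1 Z2 Y2]|[X2 Z1 Y2]|[X2 Z2 Y1]].
- case: X X1 th {XZ XY pe} => [|x1 [|]] // _; case: Z Z2 {ZY} => [|s1 [|s2 [|]]] // _.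
  by case: Y Y2 => [|y1 [|y2 [|]]] // _ /main.
- case: X X2 th {XZ XY pe} => [|x1 [|x2 [|]]] // _; case: Z Z1 {ZY} => [|s1 [|]] // _.
  by case: Y Y2 => [|y1 [|y2 [|]]] // _ /theta_swap12/main.
- case: X X2 th {XZ XY pe} => [|x1 [|x2 [|]]] // _; case: Z Z2 {ZY} => [|s1 [|s2 [|]]] // _.
  by case: Y Y1 => [|y1 [|]] // _ /theta_swap23/theta_swap12/main.
Qed.

Lemma theta0_good vs : theta0_vertices vs ->
    ~ ((forall x, x \in vs) /\ forall x y, e x y ->
        edge_in theta0_edges (index x vs) (index y vs)) ->
  exists A h, good e A h.
Proof.
case=> sz U E no.
have gen x y ps : x \in vs -> y \in vs -> x != y -> path e x (rcons ps y) -> uniq ps ->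
    {in ps, forall z, z \notin vs} ->
    edge_in theta0_edges (index x vs) (index y vs) = false \/ ps != [::] ->
  exists A h, good e A h.
  move=> xv yv xy pp Ups psv ne.
  (* The tables list each pair in increasing order only; otherwise the ear is walked backwards. *)
  wlog lt : x y ps xv yv xy pp Ups psv ne / (index x vs < index y vs)%N.
    move=> W; case: (ltngtP (index x vs) (index y vs)) => [lt|lt|eq].
    - exact: (W x y ps).
    - apply: (W y x (rev ps)) => //.
      + by rewrite eq_sym.
      + by have := path_rev e_sym pp; rewrite last_rcons belast_rcons rev_cons.
      + by rewrite rev_uniq.
      + by move=> z; rewrite mem_rev => /psv.
      + case: ne => [h|ps0]; [left|right].
          by rewrite /edge_in orbC; exact: h.
        by rewrite -size_eq0 size_rev size_eq0.
    - by case/eqP: xy; rewrite -(nth_index x xv) eq nth_index.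
  have Uv : uniq (vs ++ ps).
    by rewrite cat_uniq U Ups andbT; apply/hasPn => z /psv.
  move: sz U E Uv xv yv lt pp ne; clear no psv.
  case: vs => [|v0 [|v1 [|v2 [|v3 [|v4 [|v5 [|v6 [|]]]]]]]] // _ U E Uv xv yv lt pp ne.
  apply: (@theta0_pair_good _ e e_sym v0 v1 v2 v3 v4 v5 v6 U (E v0) _ _ ps lt) => //.
  - by rewrite -index_mem in yv.
  - by rewrite !nth_index.
have [/forallP allc|] := boolP [forall x, x \in vs]; last first.
  rewrite negb_forall => /existsP[z zc].
  have [||u [p [w [pp Up p0 pc [uc wc uw]]]]] := @ear_exists _ e connG nsepG [set x in vs] z.
  - by rewrite cardsE (card_uniqP _) // sz.
  - by rewrite inE.
  rewrite !inE in uc wc.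
  apply: (gen u w p) => //; last by right.
  by move=> k /pc; rewrite inE.
have [|] := boolP [forall x, [forall y, e x y ==> edge_in theta0_edges (index x vs) (index
    y vs)]].
  move=> /forallP h; case: no; split=> // x y exy.
  by have /forallP/(_ y) := h x; rewrite exy.
rewrite negb_forall => /existsP[x]; rewrite negb_forall => /existsP[y].
rewrite negb_imply => /andP[exy /negbTE chord].
apply: (gen x y [::]) => //; last by left.
- by apply: contraTneq exy => ->; rewrite e_irr.
- by rewrite /= exy.
Qed.

End CycleTheta.

(** The excluded graphs are those where the search for a larger subgraph stops: a cycle that is the
    whole graph is a polygon, and a theta0 that is the whole graph is theta0 itself. *)
Lemma wilson_good V (e : rel 'I_V) : (3 < V)%N -> simple_graph e -> nonseparable e ->
  ~ is_theta0 e -> ~ is_polygon e -> exists A h, good e A h.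
Proof.
move=> V4 [sym irr] [conn nsep] nth npoly.
have [|c [cc Uc c3]] := cycle_exists sym irr conn nsep; first by rewrite card_ord ltnW.
have [|u [w [X [Z [Y [th sz]]]]]] := theta_exists sym irr conn nsep cc Uc c3.
  case=> allc adj; apply: npoly.
  have szc : size c = V.
    by rewrite -(card_uniqP Uc) -[RHS]card_ord; apply: eq_card => x; rewrite allc.
  have ic x : (index x c < V)%N by have := allc x; rewrite -index_mem szc.
  pose f x := Ordinal (ic x).
  have f_inj : injective f.
    by move=> x y /(congr1 val) /= h; rewrite -(nth_index x (allc x)) h nth_index.
  exists f; split; first exact: injF_bij.
  have nxt x y : (y == next c x) = (index y c == (index x c).+1 %% V)%N.
    rewrite -{1}(nth_index x (allc x)) next_nth_mod // ?szc //.
    rewrite -{1}(nth_index x (allc y)) nth_uniq // ?szc ?ltn_pmod //.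
    exact: leq_ltn_trans (ic x).
  move=> x y; rewrite /cycle_rel /= -!nxt; apply/idP/orP; first by move/adj/orP.
  by case=> /eqP ->; [|rewrite sym]; apply: next_cycle.
have [//|[vs tv]] := theta_good_or_theta0 sym th sz.
apply: (theta0_good sym irr conn nsep tv) => -[allc adj]; apply: nth.
have [szv Uv Ev] := tv.
have ic x : (index x vs < 7)%N by have := allc x; rewrite -index_mem szv.
have VE : V = 7 by rewrite -szv -(card_uniqP Uv) -[LHS]card_ord; apply: eq_card => x;
    rewrite allc.
exists (fun x => Ordinal (ic x)); split.
  apply: inj_card_bij; last by rewrite !card_ord VE.
  by move=> x y /(congr1 val) /= h; rewrite -(nth_index x (allc x)) h nth_index.
move=> x y.
have -> : theta0_rel (Ordinal (ic x)) (Ordinal (ic y)) = edge_in theta0_edges (index x vs)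
    (index y vs).
  rewrite /theta0_rel /=; move: (index x vs) (index y vs) (ic x) (ic y) => i j i7 j7.
  case: i i7 => [|[|[|[|[|[|[|i]]]]]]] // _;
    by case: j j7 => [|[|[|[|[|[|[|j]]]]]]].
apply/idP/idP; first exact: adj.
by case/orP => /(allP (Ev x)); rewrite /= !nth_index // sym.
Qed.

(** * Coloured tokens *)

Section ColouredWalks.
Variables (V N : nat) (e : rel 'I_V).
Hypothesis V4 : (3 < V)%N.
Hypothesis sim : simple_graph e.
Hypothesis nonsep : nonseparable e.
Hypothesis not_theta0 : ~ is_theta0 e.
Hypothesis not_polygon : ~ is_polygon e.
Hypothesis bipN : bipartite e -> (N.+2 <= V)%N.

Lemma even_closed_walk v (s : 'S_V) : s v = v -> odd_perm s = false -> Gam e v s.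
Proof.
have [sym irr] := sim; have [conn nsep] := nonsep.
have [A [h gA]] := wilson_good V4 sim nonsep not_theta0 not_polygon.
exact: (good_alternating sym conn nsep gA).
Qed.

(** Colour each vertex by the parity of a chosen walk from [v]. An edge between equal colours closes
    two such walks to one of odd length. *)
Lemma odd_closed_walk_or_bipartite v :
  bipartite e \/ exists p, [/\ path e v p, last v p = v & odd (size p)].
Proof.
have [sym _] := sim; have [conn _] := nonsep.
have walk x : exists p, path e v p && (last v p == x).
  by have /connectP[p pp ->] := conn v x; exists p; rewrite pp eqxx.
pose w x := xchoose (walk x).
have wP x : path e v (w x) /\ last v (w x) = x.
  by have /andP[? /eqP ?] := xchooseP (walk x).
have [/forallP bip|] := boolP [forall x, [forall y, e x y ==> (odd (size (w x)) != odd
    (size (w y)))]].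
  left; exists (fun x => odd (size (w x))) => x y exy.
  by have /forallP/(_ y) := bip x; rewrite exy.
rewrite negb_forall => /existsP[x]; rewrite negb_forall => /existsP[y].
rewrite negb_imply negbK => /andP[exy /eqP par]; right.
have [[px lx] [py ly]] := (wP x, wP y).
exists (w x ++ y :: rev (belast v (w y))); split.
- rewrite cat_path px lx /= exy /=.
  by have := path_rev sym py; rewrite ly.
- by rewrite last_cat /= -{1}ly last_revbelast.
- by rewrite size_cat /= size_rev size_belast oddD /= par addbN addbb.
Qed.

(** The hole gets the colour [None], which no token has, so a permutation matching the two
    colourings must fix it. *)
Lemma recolouring_perm (h : 'I_V) (alpha alpha' : 'I_V -> 'I_N) :
    (forall b, flavor_count h alpha b = flavor_count h alpha' b) ->
  exists s : 'S_V, s h = h /\ forall i, i != h -> alpha' i = alpha (s i).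
Proof.
move=> cnt.
pose lift_ (a : 'I_V -> 'I_N) i := if i == h then None else Some (a i).
have : perm_eq [tuple lift_ alpha' i | i < V] [tuple lift_ alpha i | i < V].
  have sz a c : count_mem c (map (lift_ a) (enum 'I_V)) = #|[set i | lift_ a i == c]|.
    rewrite count_map -size_filter cardE enumT /enum_mem; congr size.
    by apply: eq_filter => i; rewrite /= inE.
  apply/allP=> c _; apply/eqP; rewrite [LHS]sz [RHS]sz; case: c => [b|].
    have := cnt b; rewrite /flavor_count => cb; symmetry; etransitivity;
        last (etransitivity; first exact: cb).
      by apply: eq_card => i; rewrite !inE /lift_; case: (i == h).
    by apply: eq_card => i; rewrite !inE /lift_; case: (i == h).
  by apply: eq_card => i; rewrite !inE /lift_; case: (i == h).
case/tuple_permP=> s sE; exists s.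
have sE' i : lift_ alpha' i = lift_ alpha (s i).
  have := congr1 (fun t => nth None t i) sE.
  by rewrite -!tnth_nth !tnth_mktuple.
split; first by have := sE' h; rewrite /lift_ eqxx; case: eqP.
by move=> i ih; have := sE' i; rewrite /lift_ (negbTE ih); case: eqP => // _ [].
Qed.

Lemma coloured_walk (h h' : 'I_V) (alpha alpha' : 'I_V -> 'I_N) :
    (forall b, flavor_count h alpha b = flavor_count h' alpha' b) ->
  exists p, [/\ path e h p, last h p = h', (0 < size p)%N &
    forall i, i != h' -> alpha' i = alpha (wperm h p i)].
Proof.
move=> cnt; have [sym irr] := sim; have [conn nsep] := nonsep.
have [q0 qq0 lq0] := connectP (conn h h').
have [w ehw] : exists w, e h' w.
  have [z zh] : exists z, z != h'.
    have : (0 < #|~: [set h']|)%N by rewrite cardsC1 card_ord; case: (V) V4 => [|[|]].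
    by case/card_gt0P=> z; rewrite !inE; exists z.
  have /connectP[[|w p] /=] := conn h' z; first by move=> _ zE; rewrite zE eqxx in zh.
  by move=> /andP[? _] _; exists w.
have [q [qq lq q_gt0]] : exists q, [/\ path e h q, last h q = h' & (0 < size q)%N].
  (* A detour to a neighbour and back makes the walk nonempty, since connectivity demands at least
     one application of the Hamiltonian. *)
  exists (q0 ++ [:: w; h']); rewrite cat_path last_cat size_cat addnS; split=> //.
  by rewrite qq0 -lq0 /= ehw sym ehw.
pose s1 := wperm h q.
have s1h : s1 h' = h by rewrite -lq /s1 wperm_last.
pose alpha1 i := alpha (s1 i).
have [s [sh sE]] : exists s : 'S_V, s h' = h' /\ forall i, i != h' -> alpha' i = alpha1 (s i).
  apply: recolouring_perm => b; rewrite -cnt /flavor_count.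
  rewrite -(card_imset _ (@perm_inj _ s1)); apply: eq_card => i.
  rewrite inE; apply/imsetP/idP => [[j]|/andP[ih ai]].
    by rewrite inE => /andP[jh aj] ->; rewrite -s1h (inj_eq perm_inj) jh.
  exists (s1^-1%g i); last by rewrite permKV.
  by rewrite inE /alpha1 permKV ai andbT -(inj_eq (@perm_inj _ s1)) permKV s1h.
(* Only the colours matter, so [s] may be replaced by any [g] that recolours in the same way. *)
suff [g [[p [pp lp gE]] aE]] : exists g, Gam e h' g /\ forall i, alpha1 (g i) = alpha1 (s i).
  exists (q ++ p); rewrite cat_path last_cat qq lq pp lp; split=> //.
    by rewrite size_cat ltn_addr.
  by move=> i ih; rewrite sE // -aE /alpha1 wperm_cat lq permM gE.
have [od|ev] := boolP (odd_perm s); last first.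
  by exists s; split=> //; apply: even_closed_walk => //; apply: negbTE.
have [/bipN VN|[p [pp lp op]]] := odd_closed_walk_or_bipartite h'.
  (* There are [V - 1 > N] tokens, hence two of the same flavor; exchanging them changes the parity
     and not the colouring. *)
  have [i [j [ih jh ij aij]]] : exists i j, [/\ i != h', j != h', i != j & alpha1 i =
      alpha1 j].
    have : ~~ [forall i, forall j, [&& i != h', j != h' & alpha1 i == alpha1 j] ==> (i == j)].
      apply/negP => inj; have : (#|alpha1 @: ~: [set h']| <= N)%N.
        by rewrite -[X in (_ <= X)%N]card_ord max_card.
      rewrite card_in_imset ?cardsC1 ?card_ord; first by case: (V) VN => // n;
          rewrite ltnNge => /negP.
      move=> i j; rewrite !inE => ih jh aij.
      by move/forallP/(_ i)/forallP/(_ j): inj; rewrite ih jh aij eqxx => /eqP.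
    rewrite negb_forall => /existsP[i]; rewrite negb_forall => /existsP[j].
    by rewrite negb_imply => /andP[/and3P[? ? /eqP ?] ?]; exists i, j.
  exists (s * tperm i j)%g; split.
    apply: even_closed_walk; first by rewrite permM sh tpermD.
    by rewrite odd_permM od odd_tperm ij.
  by move=> k; rewrite permM; case: tpermP => [->|->|//]; rewrite aij.
exists s; split=> //.
pose g := wperm h' p; have Gg : Gam e h' g by exists p.
have gh : g h' = h' by rewrite -{1}lp /g wperm_last.
have og : odd_perm g by rewrite (odd_wperm irr pp).
have -> : s = ((s * g^-1) * g)%g by rewrite -mulgA mulVg mulg1.
apply: GamM Gg; apply: even_closed_walk.
  by rewrite permM sh; apply: (@perm_inj _ g); rewrite permKV gh.
by rewrite odd_permM odd_permV od og.
Qed.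

End ColouredWalks.

(** * Perron vector and Dirichlet form *)

Section Perron.
Local Open Scope sesquilinear_scope.
Variables (C : numClosedFieldType) (n : nat) (e : rel 'I_n) (t : 'I_n -> 'I_n -> C).
Hypothesis n_gt0 : (0 < n)%N.
Hypothesis t_sym : forall i j, t i j = t j i.
Hypothesis t_ge0 : forall i j, 0 <= t i j.
Hypothesis t_gt0 : forall i j, e i j -> 0 < t i j.
Hypothesis conn : forall x y, connect e x y.

(* If [u] belongs to the largest eigenvalue, then so does the vector of the
   absolute values of [u], since its Rayleigh quotient is at least as large. *)
Lemma perron_vector : exists (lam : C) (psi : 'I_n -> C),
  (forall i, 0 < psi i) /\ (forall i, \sum_j t i j * psi j = lam * psi i).
Proof.
pose A : 'M[C]_n := \matrix_(i, j) t i j.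
have Aherm : A \is hermsymmx.
  apply/is_hermitianmxP; rewrite expr0 scale1r; apply/matrixP=> i j.
  by rewrite !mxE t_sym geC0_conj.
have /orthomx_spectralP AE := hermitian_normalmx Aherm.
have sp_real := hermitian_spectral_diag_real Aherm.
set P := spectralmx A in AE; set sp := spectral_diag A in AE sp_real.
have Pu : P \is unitarymx := spectral_unitarymx A.
have PV := invmx_unitary Pu.
have PP : P \in unitmx := spectral_unit A.
have realsp i : sp 0 i \is Num.real by apply: (mxOverP sp_real).
have [i0 max_i0] : exists i0, forall i, sp 0 i <= sp 0 i0.
  have [i _ le] := @real_arg_maxP C _ (Ordinal n_gt0) xpredT (sp 0) isT (fun i _ => realsp i).
  by exists i => j; apply: le.
set lam := sp 0 i0 in max_i0.
have lam_real : lam \is Num.real by apply: realsp.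
have PA : P *m A = diag_mx sp *m P by rewrite AE !mulmxA mulmxV // mul1mx.
pose u := row i0 P.
have uA : u *m A = lam *: u.
  by rewrite /u -row_mul PA; apply/rowP=> j; rewrite mul_diag_mx !mxE.
have uAi i : \sum_j t i j * u 0 j = lam * u 0 i.
  have /matrixP/(_ 0 i) := uA; rewrite !mxE => <-.
  by apply: eq_bigr => j _; rewrite !mxE t_sym mulrC.
have u_neq0 : u != 0.
  apply/eqP=> u0; have : row i0 (P *m invmx P) = 0 by rewrite row_mul -/u u0 mul0mx.
  rewrite mulmxV // => /matrixP/(_ 0 i0); rewrite !mxE eqxx => /eqP.
  by rewrite oner_eq0.
pose x : 'rV[C]_n := \row_i `|u 0 i|.
have x_ge0 i : 0 <= x 0 i by rewrite mxE.
pose y := x *m invmx P.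
have xE : x = y *m P by rewrite /y -mulmxA mulVmx // mulmx1.
have conj_x : x ^t* = x^T.
  by apply/matrixP=> i j; rewrite !mxE geC0_conj.
have yE : y ^t* = P *m x^T.
  by rewrite /y trmx_mul map_mxM PV trmxCK conj_x.
have xx : \sum_i x 0 i ^+ 2 = \sum_k `|y 0 k| ^+ 2.
  have -> : \sum_i x 0 i ^+ 2 = (x *m x^T) 0 0.
    by rewrite mxE; apply: eq_bigr => i _; rewrite [x^T _ _]mxE expr2.
  rewrite {1}xE -mulmxA -yE mxE; apply: eq_bigr => k _.
  by rewrite !mxE normCK.
have xAx : \sum_i x 0 i * \sum_j t i j * x 0 j = \sum_k sp 0 k * `|y 0 k| ^+ 2.
  have -> : \sum_i x 0 i * \sum_j t i j * x 0 j = (x *m A *m x^T) 0 0.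
    rewrite -mulmxA mxE; apply: eq_bigr => i _; congr (_ * _).
    by rewrite mxE; apply: eq_bigr => j _; rewrite !mxE.
  rewrite {1}xE -(mulmxA y) PA mulmxA -mulmxA -yE mxE; apply: eq_bigr => k _.
  by rewrite mul_mx_diag !mxE normCK mulrA (mulrC (sp 0 k)).
have le1 : lam * \sum_i x 0 i ^+ 2 <= \sum_i x 0 i * \sum_j t i j * x 0 j.
  have -> : lam * \sum_i x 0 i ^+ 2 = \sum_i (u 0 i)^* * \sum_j t i j * u 0 j.
    rewrite mulr_sumr; apply: eq_bigr => i _.
    by rewrite uAi [x 0 i]mxE normCK; ring.
  apply: le_trans (real_ler_norm _) _.
    have -> : \sum_i (u 0 i)^* * \sum_j t i j * u 0 j = lam * \sum_i x 0 i ^+ 2.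
      rewrite mulr_sumr; apply: eq_bigr => i _.
      by rewrite uAi [x 0 i]mxE normCK; ring.
    by rewrite realM // rpred_sum // => i _; rewrite rpredX // ger0_real.
  apply: le_trans (ler_norm_sum _ _ _) _; apply: ler_sum => i _.
  rewrite normrM norm_conjC [x 0 i]mxE ler_wpM2l //.
  apply: le_trans (ler_norm_sum _ _ _) _; apply: ler_sum => j _.
  by rewrite normrM [x 0 j]mxE [`|t i j|]ger0_norm.
(* The Rayleigh quotient of [x] is a weighted mean of the eigenvalues. Reaching the maximum, it has
   no weight on smaller ones. *)
have yk k : (lam - sp 0 k) * `|y 0 k| ^+ 2 = 0.
  have ge0 j : 0 <= (lam - sp 0 j) * `|y 0 j| ^+ 2.
    by rewrite mulr_ge0 ?exprn_ge0 // subr_ge0.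
  have : \sum_k (lam - sp 0 k) * `|y 0 k| ^+ 2 == 0.
    rewrite eq_le sumr_ge0 ?andbT //.
    under eq_bigr do rewrite mulrBl.
    by rewrite sumrB -mulr_sumr -xx -xAx subr_le0.
  by rewrite psumr_eq0 // => /allP/(_ k); rewrite mem_index_enum => /(_ isT)/eqP.
have xA : x *m A = lam *: x.
  rewrite {1}xE -mulmxA PA mulmxA; suff -> : y *m diag_mx sp = lam *: y.
    by rewrite -scalemxAl -xE.
  apply/rowP=> k; rewrite mul_mx_diag [LHS]mxE [RHS]mxE mulrC.
  have /eqP := yk k; rewrite mulf_eq0 sqrf_eq0 normr_eq0 => /orP[|/eqP->].
    by rewrite subr_eq0 => /eqP->.
  by rewrite !mulr0.
have xAi i : \sum_j t i j * x 0 j = lam * x 0 i.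
  have /matrixP/(_ 0 i) := xA; rewrite [in X in _ = X]mxE => <-.
  by rewrite [RHS]mxE; apply: eq_bigr => j _; rewrite [A _ _]mxE t_sym mulrC.
exists lam, (x 0); split=> // i.
(* A zero entry spreads along edges, because the eigenvalue equation at that vertex is a vanishing
   sum of nonnegative terms; by connectedness [u] would vanish. *)
rewrite lt_def x_ge0 andbT; apply/negP => /eqP xi0; case/negP: u_neq0.
apply/eqP/rowP=> j; rewrite [RHS]mxE.
suff : x 0 j = 0 by rewrite mxE => /eqP; rewrite normr_eq0 => /eqP.
have /connectP[p pp ->] := conn i j.
elim: p i xi0 pp => //= k p IH i xi0 /andP[eik pp]; apply: IH pp.
have := xAi i; rewrite xi0 mulr0 => /eqP.
rewrite psumr_eq0; last by move=> l _; rewrite mulr_ge0.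
move=> /allP/(_ k); rewrite mem_index_enum => /(_ isT)/eqP/eqP.
by rewrite mulf_eq0 gt_eqF ?t_gt0 //= => /eqP.
Qed.

End Perron.

(** * The Dirichlet form of a ground state representation *)

Section GroundState.
Variables (C : numClosedFieldType) (I : finType) (M : I -> I -> C) (p : I -> C) (E0 : C).
Hypothesis M_sym : forall i j, M i j = M j i.
Hypothesis p_real : forall i, (p i)^* = p i.
Hypothesis Mp : forall i, \sum_j M i j * p j = E0 * p i.
Hypothesis M_le0 : forall i j, 0 <= - M i j * p i * p j.
Variables (mu : C) (f : I -> C).
Hypothesis Mf : forall i, \sum_j M i j * (f j * p j) = mu * (f i * p i).

Let W i j := - M i j * p i * p j.
Let nf := \sum_i `|f i * p i| ^+ 2.

(** Expand the square: the eigenvalue equation of [p] evaluates the diagonal terms, that of [f p]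
    the cross terms, and the symmetry of [W] makes the terms of each kind equal. *)
Lemma dirichlet_identity : \sum_i \sum_j W i j * `|f i - f j| ^+ 2 = (mu - E0) * nf *+ 2.
Proof.
have nfE : nf = \sum_i (f i)^* * f i * p i * p i.
  by apply: eq_bigr => i _; rewrite normCK rmorphM /= p_real; ring.
pose D1 := \sum_i \sum_j W i j * (f i * (f i)^*).
pose D2 := \sum_i \sum_j W i j * ((f i)^* * f j).
have W_sym i j : W i j = W j i by rewrite /W M_sym; ring.
have D1E : D1 = - E0 * nf.
  rewrite nfE mulr_sumr; apply: eq_bigr => i _.
  have -> : - E0 * ((f i)^* * f i * p i * p i) = - ((f i)^* * f i * p i) * (E0 * p i) by ring.
  by rewrite -Mp mulr_sumr; apply: eq_bigr => j _; rewrite /W; ring.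
have D2E : D2 = - mu * nf.
  rewrite nfE mulr_sumr; apply: eq_bigr => i _.
  have -> : - mu * ((f i)^* * f i * p i * p i) = - ((f i)^* * p i) * (mu * (f i * p i)) by
      ring.
  by rewrite -Mf mulr_sumr; apply: eq_bigr => j _; rewrite /W; ring.
have -> : (mu - E0) * nf *+ 2 = D1 + D1 - D2 - D2 by rewrite D1E D2E; ring.
have D1' : D1 = \sum_i \sum_j W i j * (f j * (f j)^*).
  rewrite exchange_big; apply: eq_bigr => i _; apply: eq_bigr => j _ /=.
  by rewrite W_sym.
have D2' : D2 = \sum_i \sum_j W i j * ((f j)^* * f i).
  rewrite exchange_big; apply: eq_bigr => i _; apply: eq_bigr => j _ /=.
  by rewrite W_sym.
rewrite {2}D1' {2}D2' -big_split -!sumrB; apply: eq_bigr => i _ /=.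
rewrite -big_split -!sumrB; apply: eq_bigr => j _ /=.
by rewrite normCK rmorphB /=; ring.
Qed.

Lemma ground_energy_min i : f i * p i != 0 -> E0 <= mu.
Proof.
move=> fi.
have nf_gt0 : 0 < nf.
  rewrite /nf (bigD1 i) //= ltr_pwDl //; first by rewrite exprn_gt0 // normr_gt0.
  by apply: sumr_ge0 => j _; rewrite exprn_ge0.
have : 0 <= (mu - E0) * nf *+ 2.
  rewrite -dirichlet_identity; apply: sumr_ge0 => j _; apply: sumr_ge0 => k _.
  by apply: mulr_ge0; [exact: M_le0 | apply: exprn_ge0].
by rewrite pmulrn_lge0 // pmulr_lge0 // subr_ge0.
Qed.

Lemma ground_state_const i j : mu = E0 -> - M i j * p i * p j != 0 -> f i = f j.
Proof.
move=> muE Wij.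
have ge0 k l : 0 <= W k l * `|f k - f l| ^+ 2 by apply: mulr_ge0;
    [exact: M_le0 | apply: exprn_ge0].
have := dirichlet_identity; rewrite muE subrr mul0r mul0rn => /eqP.
rewrite psumr_eq0; last by move=> k _; apply: sumr_ge0.
move=> /allP/(_ i); rewrite mem_index_enum => /(_ isT) /=.
rewrite psumr_eq0 // => /allP/(_ j); rewrite mem_index_enum => /(_ isT) /=.
by rewrite mulf_eq0 (negbTE Wij) /= sqrf_eq0 normr_eq0 subr_eq0 => /eqP.
Qed.

End GroundState.

(** * Matrix elements in Fock space *)

Section FockSpace.
Variables (C : numClosedFieldType) (V N : nat).
Implicit Types (S : fock V N) (i j h : 'I_V) (a b : 'I_N) (m : 'I_V * 'I_N).
Implicit Types (v : 'cV[C]_(dimF V N)) (A : 'M[C]_(dimF V N)) (al : 'I_V -> 'I_N).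

Definition ent A (S' S : fock V N) := A (enum_rank S') (enum_rank S).
Definition amp v (S : fock V N) := v (enum_rank S) 0.

Lemma fstateK S : fstate (enum_rank S) = S.
Proof. exact: enum_rankK. Qed.

Lemma amp_inj v v' : (forall S, amp v S = amp v' S) -> v = v'.
Proof. by move=> h; apply/colP => k; have := h (enum_val k); rewrite /amp enum_valK. Qed.

Lemma sum_states (F : 'I_(dimF V N) -> C) : \sum_k F k = \sum_(S : fock V N) F (enum_rank S).
Proof.
by rewrite (reindex enum_rank) //; apply: onW_bij; apply: enum_rank_bij.
Qed.

Lemma amp_mul A v S : amp (A *m v) S = \sum_S' ent A S S' * amp v S'.
Proof. by rewrite /amp mxE sum_states. Qed.

Lemma amp_sum (J : Type) (r : seq J) (P : pred J) (F : J -> 'cV[C]_(dimF V N)) S :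
  amp (\sum_(x <- r | P x) F x) S = \sum_(x <- r | P x) amp (F x) S.
Proof. exact: summxE. Qed.

Lemma ent_sum (J : Type) (r : seq J) (P : pred J) (F : J -> 'M[C]_(dimF V N)) S S' :
  ent (\sum_(x <- r | P x) F x) S S' = \sum_(x <- r | P x) ent (F x) S S'.
Proof. exact: summxE. Qed.

Lemma amp_scale (c : C) v S : amp (c *: v) S = c * amp v S.
Proof. by rewrite /amp mxE. Qed.

Lemma mode_lt_irr m : mode_lt m m = false.
Proof. by rewrite /mode_lt ltnn eqxx ltnn. Qed.

Lemma jw_signD1 S m : jw_sign C (S :\ m) m = jw_sign C S m.
Proof.
congr (_ ^+ _); apply: eq_card => x; rewrite !inE.
by case: (eqVneq x m) => [->|_] /=; rewrite ?mode_lt_irr ?andbF.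
Qed.

Lemma tr_cdag m : (cdag C m)^T = cann C m.
Proof.
apply/matrixP=> k l; rewrite !mxE /=.
set S := fstate k; set S' := fstate l.
have -> : (m \notin S) && (S' == m |: S) = (m \in S') && (S == S' :\ m).
  apply/andP/andP => -[mS /eqP->]; rewrite ?setU11 ?setD11; split=> //.
    by rewrite setU1K.
  by rewrite setD1K.
by case: ifP => // /andP[_ /eqP ->]; rewrite jw_signD1.
Qed.

Lemma tr_cann m : (cann C m)^T = cdag C m.
Proof. by rewrite -tr_cdag trmxK. Qed.

Lemma ent_hop m m' S' S : ent (cdag C m *m cann C m') S' S =
  if [&& m' \in S, m \notin S :\ m' & S' == m |: (S :\ m')]
  then jw_sign C (S :\ m') m * jw_sign C S m' else 0.
Proof.
rewrite /ent mxE sum_states (bigD1 (S :\ m')) //= big1 ?addr0 => [|S1 ne].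
  rewrite !mxE /= !fstateK eqxx andbT.
  by case: (m' \in S); case: ifP; rewrite ?mulr0 ?mul0r.
by rewrite !mxE /= !fstateK (negbTE ne) andbF mulr0.
Qed.

Lemma ent_Hinf t S' S : ent (Hinf N t) S' S =
  if inH1 S' && inH1 S then ent (hopping N t) S' S else 0.
Proof.
rewrite /ent /Hinf mxE (bigD1 (enum_rank S)) //= big1 ?addr0 => [|k ne]; last first.
  by rewrite !mxE (negbTE ne) mulr0.
rewrite [Pproj _ _ _ _ _]mxE eqxx fstateK mxE (bigD1 (enum_rank S')) //= big1 ?addr0 => [|k
    ne]; last first.
  by rewrite !mxE eq_sym (negbTE ne) mul0r.
rewrite mxE eqxx fstateK.
by case: (inH1 S'); case: (inH1 S); rewrite /= ?mulr1 ?mul1r ?mulr0 ?mul0r.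
Qed.

Lemma in_H1P v : in_H1 v <-> forall S, ~~ inH1 S -> amp v S = 0.
Proof.
have PE S : amp (Pproj C V N *m v) S = if inH1 S then amp v S else 0.
  rewrite amp_mul (bigD1 S) //= big1 ?addr0 => [|S' ne]; last first.
    by rewrite /ent mxE (inj_eq enum_rank_inj) eq_sym (negbTE ne) mul0r.
  by rewrite /ent mxE eqxx fstateK; case: (inH1 S); rewrite ?mul1r ?mul0r.
split=> [vP S SN|h]; first by rewrite -vP PE (negbTE SN).
by apply: amp_inj => S; rewrite PE; case: ifP => // /negbT /h.
Qed.

Lemma tr_Pproj : (Pproj C V N)^T = Pproj C V N.
Proof.
by apply/matrixP=> k l; rewrite !mxE eq_sym; case: eqP => // ->.
Qed.

Lemma ent_Hinf_sym t S S' : (forall i j, t i j = t j i) ->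
  ent (Hinf N t) S S' = ent (Hinf N t) S' S.
Proof.
move=> t_sym; rewrite /ent -[in LHS](trmxK (Hinf N t)) [LHS]mxE.
suff -> : (Hinf N t)^T = Hinf N t by [].
rewrite /Hinf !trmx_mul tr_Pproj mulmxA; congr (_ *m _ *m _).
rewrite /hopping [RHS]exchange_big linear_sum /=; apply: eq_bigr => i _.
rewrite linear_sum; apply: eq_bigr => j _; rewrite linear_sum; apply: eq_bigr => a _.
by rewrite linearZ /= trmx_mul tr_cdag tr_cann t_sym.
Qed.

Definition conf h al : fock V N := [set x | (x.1 != h) && (x.2 == al x.1)].

Definition occ S b := #|[set i | (i, b) \in S]|.

Lemma mem_conf h al i a : ((i, a) \in conf h al) = (i != h) && (a == al i).
Proof. by rewrite inE. Qed.

Lemma occ_conf h al b : occ (conf h al) b = flavor_count h al b.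
Proof. by apply: eq_card => i; rewrite !inE /= (eq_sym b). Qed.

Lemma card_conf h al P : #|[set x in conf h al | P x.1]| = #|[set i | (i != h) && P i]|.
Proof.
have inj : injective (fun i => (i, al i)) by move=> i j [].
rewrite -(card_imset _ inj); apply: eq_card => -[i a]; rewrite !inE /=.
apply/andP/imsetP => [[/andP[ih /eqP->] Pi]|[j]]; first by exists i; rewrite // inE ih.
by rewrite inE => /andP[jh Pj] [-> ->]; rewrite jh eqxx.
Qed.

Lemma inH1_conf h al : inH1 (conf h al).
Proof.
apply/andP; split.
  have <- : #|[set x in conf h al | xpredT x.1]| = #|conf h al|.
    by apply: eq_card => x; rewrite inE andbT.
  have -> := card_conf h al xpredT; have -> : [set i | (i != h) && true] = [set~ h].
    by apply/setP=> i; rewrite !inE andbT.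
  by rewrite cardsC1 card_ord.
apply/forallP=> i; apply: leq_trans (_ : #|[set al i]| <= 1)%N; last by rewrite cards1.
by apply: subset_leq_card; apply/subsetP=> a; rewrite !inE => /andP[].
Qed.

Lemma card_sites S : #|S| = (\sum_i #|[set a | (i, a) \in S]|)%N.
Proof.
rewrite -sum1_card (eq_bigr (fun i => \sum_(a | (i, a) \in S) 1)%N); last first.
  by move=> i _; rewrite -sum1_card; apply: eq_bigl => a; rewrite inE.
by rewrite pair_big_dep /=; apply: eq_bigl => -[].
Qed.

(** Counting: without an empty site there would be [V] particles, and with two at most [V - 2]. *)
Lemma inH1P S : (0 < V)%N -> (0 < N)%N -> inH1 S -> exists h al, S = conf h al.
Proof.
move=> V0 N0 /andP[/eqP cS /forallP le1].
have /existsP[h /eqP hS] : [exists h, [set a | (h, a) \in S] == set0].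
  apply: contraPT cS => no; rewrite card_sites.
  have -> : (\sum_i #|[set a | (i, a) \in S]| = \sum_(i < V) 1)%N.
    apply: eq_bigr => i _; apply/eqP; rewrite eqn_leq le1 card_gt0.
    by apply: contra no => ?; apply/existsP; exists i.
  by rewrite sum1_card card_ord; case: (V) V0 => [|n] //= _ /esym/n_Sn.
exists h, (fun i => odflt (Ordinal N0) [pick a | (i, a) \in S]).
apply/setP=> -[i a]; rewrite mem_conf.
have cT : (\sum_(i | i != h) #|[set a | (i, a) \in S]| = V.-1)%N.
  by move: cS; rewrite card_sites (bigD1 h) //= hS cards0 add0n.
have [->|ih] /= := eqVneq i h; first by have /setP/(_ a) := hS; rewrite !inE.
have [a0 a0S] : exists a0, (i, a0) \in S.
  have : (0 < #|[set a | (i, a) \in S]|)%N.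
    rewrite lt0n; apply/negP => /eqP i0.
    have : (\sum_(j | j != h) #|[set a | (j, a) \in S]| <= \sum_(j | (j != h) && (j != i))
        1)%N.
      by rewrite (bigD1 i) //= i0; apply: leq_sum => j _; apply: le1.
    have -> : (\sum_(j | (j != h) && (j != i)) 1 = #|~: [set h; i]|)%N.
      by rewrite sum1_card; apply: eq_card => j; rewrite !inE negb_or.
    have := cardsC [set h; i]; rewrite cards2 (eq_sym h) ih card_ord cT.
    by move: #|_| => k; lia.
  by case/card_gt0P => a0; rewrite inE; exists a0.
case: pickP => [a1 a1S /=|/(_ a0)]; last by rewrite a0S.
apply/idP/eqP => [aS|->//].
by have /card_le1_eqP := le1 i; apply; rewrite inE.
Qed.

Lemma card_ord_lt_neq h (k : nat) : (k <= V)%N ->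
  (#|[set i : 'I_V | (i != h) && (i < k)%N]| + (h < k) = k)%N.
Proof.
move=> kV; have c : #|[set i : 'I_V | (i < k)%N]| = k.
  rewrite -sum1_card (eq_bigl (fun i : 'I_V => (i < k)%N)); last by move=> i; rewrite inE.
  by rewrite -(big_ord_widen V (fun=> 1%N)) // sum1_card card_ord.
rewrite -[RHS]c [RHS](cardsD1 h) inE addnC; congr (_ + _)%N.
by apply: eq_card => i; rewrite !inE.
Qed.

Lemma mode_lt_conf h al j x : x \in conf h al -> mode_lt x (j, al j) = (x.1 < j)%N.
Proof.
rewrite inE /mode_lt => /andP[_ /eqP ->] /=.
by case: (eqVneq x.1 j) => [->|_]; rewrite ?ltnn ?orbF.
Qed.

(** Since every site but the hole is filled, the two Jordan-Wigner strings have total length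
    [h + j - 1], whatever the flavors. *)
Lemma jw_hop_conf h al j : j != h ->
  jw_sign C (conf h al :\ (j, al j)) (h, al j) * jw_sign C (conf h al) (j, al j)
  = - (-1) ^+ (h + j).
Proof.
move=> jh; rewrite /jw_sign.
have -> : #|[set m' in conf h al | mode_lt m' (j, al j)]| =
    #|[set i : 'I_V | (i != h) && (i < j)%N]|.
  rewrite -(card_conf h al (fun i => (i < j)%N)); apply: eq_card => x.
  rewrite [LHS]in_set [RHS]in_set; case: (boolP (x \in conf h al)) => //= xS.
  by rewrite (mode_lt_conf _ xS).
have -> : #|[set m' in conf h al :\ (j, al j) | mode_lt m' (h, al j)]| =
    #|[set i : 'I_V | (i != j) && (i < h)%N]|.
  have -> : [set i : 'I_V | (i != j) && (i < h)%N] =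
      [set i : 'I_V | (i != h) && ((i != j) && (i < h)%N)].
    by apply/setP=> i; rewrite !inE; case: (eqVneq i h) => [->|//]; rewrite ltnn andbF.
  rewrite -(card_conf h al (fun i => (i != j) && (i < h)%N)); apply: eq_card => -[i a].
  rewrite !inE /= xpair_eqE /mode_lt /=.
  case: (eqVneq i h) => [->|ih]; rewrite ?andbF //= orbF.
  case: (eqVneq a (al i)) => [->|_]; rewrite ?andbF //= !andbT.
  by case: (eqVneq i j) => [->|_]; rewrite ?eqxx.
rewrite -exprD.
have := card_ord_lt_neq j (ltnW (ltn_ord h)).
have := card_ord_lt_neq h (ltnW (ltn_ord j)).
move: #|_| #|_| => e1 e2 E1 E2.
have -> : (h + j = (e2 + e1).+1)%N.
  have : h != j :> nat by rewrite eq_sym.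
  by rewrite -[X in (X + _)%N]E2 -[X in (_ + X)%N]E1; case: ltngtP => //= _ _; lia.
by rewrite exprS mulN1r opprK addnC.
Qed.

Lemma conf_hop h al j : j != h ->
  (h, al j) |: (conf h al :\ (j, al j)) = conf j (al \o tperm h j).
Proof.
move=> jh; apply/setP=> -[i a]; rewrite !inE !xpair_eqE /=.
have [->|ih] := eqVneq i h; first by rewrite tpermL (eq_sym h) jh /= !andbF orbF.
have [->|ij] := eqVneq i j; first by rewrite /= andNb.
by rewrite /= tpermD // eq_sym.
Qed.

Lemma ent_hop_conf S' h al i j a : i != j -> inH1 S' ->
  ent (cdag C (i, a) *m cann C (j, a)) S' (conf h al) =
  if [&& i == h, j != h, a == al j & S' == conf j (al \o tperm h j)]
  then - (-1) ^+ (h + j) else 0.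
Proof.
move=> ij S'1; rewrite ent_hop mem_conf -andbA.
have [jh /=|] := boolP (j != h); last by rewrite andbF.
have [->|] := eqVneq a (al j); last by rewrite /= andbF.
have [->|ih] := eqVneq i h.
  by rewrite !inE /= eqxx andbF /= conf_hop //; case: ifP => // _; rewrite jw_hop_conf.
(* A particle arriving at a filled site would either make it doubly occupied, which [S'] forbids, or
   meet its own flavor. *)
rewrite /=; case: ifP => // /andP[/negP niS /eqP S'E]; case: niS.
have /andP[_ /forallP/(_ i)/card_le1_eqP one] := S'1.
have hj : al j \in [set a | (i, a) \in S'] by rewrite in_set S'E setU11.
have hi : al i \in [set a | (i, a) \in S'].
  by rewrite in_set S'E !inE !xpair_eqE (negbTE ij) /= ih !eqxx ?orbT.
have eqa : al j = al i by apply: one.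
by rewrite !inE xpair_eqE (negbTE ij) /= ih eqa eqxx.
Qed.

Section Hamiltonian.
Variable t : 'I_V -> 'I_V -> C.
Hypothesis t_sym : forall i j, t i j = t j i.
Hypothesis t_diag : forall i, t i i = 0.

Lemma ent_Hinf_conf S' h al : ent (Hinf N t) S' (conf h al) =
  \sum_j (if S' == conf j (al \o tperm h j) then - (-1) ^+ (h + j) * t h j else 0).
Proof.
rewrite ent_Hinf inH1_conf andbT.
have [S'1|S'1] := boolP (inH1 S'); last first.
  by rewrite big1 // => j _; case: eqP => // E; rewrite E inH1_conf in S'1.
rewrite /hopping ent_sum (bigD1 h) //= [X in _ + X]big1 ?addr0 => [|i ih].
  rewrite ent_sum; apply: eq_bigr => j _; rewrite ent_sum.
  have [->|jh] := eqVneq j h.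
    rewrite t_diag mulr0 if_same big1 // => a _.
    by rewrite scale0r /ent mxE.
  have hj : h != j by rewrite eq_sym.
  rewrite (bigD1 (al j)) //= big1 ?addr0 => [|a aj].
    rewrite {1}/ent mxE -/(ent _ S' (conf h al)) ent_hop_conf //.
    by rewrite jh !eqxx /=; case: ifP => _; rewrite ?mulr0 // mulrC.
  rewrite {1}/ent mxE -/(ent _ S' (conf h al)) ent_hop_conf //.
  by rewrite (negbTE aj) !andbF mulr0.
rewrite ent_sum big1 // => j _; rewrite ent_sum big1 // => a _.
rewrite {1}/ent mxE -/(ent _ S' (conf h al)).
have [->|ij] := eqVneq i j; first by rewrite t_diag mul0r.
by rewrite ent_hop_conf // (negbTE ih) mulr0.
Qed.

(** By symmetry of the Hamiltonian the columns just computed also serve as rows. *)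
Lemma amp_Hinf_conf v h al : amp (Hinf N t *m v) (conf h al) =
  - \sum_(j < V) (-1) ^+ (h + j) * t h j * amp v (conf j (al \o tperm h j)).
Proof.
rewrite amp_mul; under eq_bigr do rewrite (ent_Hinf_sym _ _ t_sym) ent_Hinf_conf mulr_suml.
rewrite exchange_big /= -sumrN; apply: eq_bigr => j _.
rewrite (bigD1 (conf j (al \o tperm h j))) //= big1 ?addr0 => [|S ne].
  by rewrite eqxx mulNr mulNr.
by rewrite (negbTE ne) mul0r.
Qed.

Lemma amp_Hinf_out v S : ~~ inH1 S -> amp (Hinf N t *m v) S = 0.
Proof.
by move=> SN; rewrite amp_mul big1 // => S' _; rewrite ent_Hinf (negbTE SN) mul0r.
Qed.

End Hamiltonian.

Lemma amp_vacuum S : amp (vacuum C V N) S = (S == set0)%:R.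
Proof. by rewrite /amp mxE fstateK. Qed.

(** The new mode precedes all occupied ones, so its sign is trivial. This is the situation at each
    stage of the ordered product in [hbasis]. *)
Lemma amp_cdag_delta m S0 v (c : C) : (forall S, amp v S = if S == S0 then c else 0) ->
    m \notin S0 -> (forall m', m' \in S0 -> ~~ mode_lt m' m) ->
  forall S, amp (cdag C m *m v) S = if S == m |: S0 then c else 0.
Proof.
move=> vE mS0 first_m S; rewrite amp_mul (bigD1 S0) //= big1 ?addr0 => [|S' ne].
  rewrite vE eqxx /ent mxE /= !fstateK mS0 /=; case: eqP => _; rewrite ?mul0r //.
  rewrite /jw_sign (_ : [set m' in S0 | mode_lt m' m] = set0) ?cards0 ?mul1r //.
  by apply/setP=> x; rewrite !inE; apply/negP => /andP[/first_m/negbTE->].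
by rewrite vE (negbTE ne) mulr0.
Qed.

Lemma amp_hbasis h al S : amp (hbasis C h al) S = if S == conf h al then (-1) ^+ h else 0.
Proof.
rewrite /hbasis amp_scale.
set l := [seq i <- enum 'I_V | i != h].
have sl : sorted (fun i j : 'I_V => i < j)%N l.
  apply: sorted_filter; first by move=> i j k; apply: ltn_trans.
  have := iota_ltn_sorted 0 V; rewrite -val_enum_ord sorted_map; exact.
suff -> : amp (foldr (fun i v => cdag C (i, al i) *m v) (vacuum C V N) l) S =
    if S == [set x | (x.1 \in l) && (x.2 == al x.1)] then 1 else 0.
  have -> : [set x | (x.1 \in l) && (x.2 == al x.1)] = conf h al.
    by apply/setP=> x; rewrite !inE mem_filter mem_enum andbT.
  by case: ifP => _; rewrite ?mulr1 ?mulr0.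
elim: l sl S => [|i l IH] sl S.
  rewrite /= amp_vacuum (_ : [set x | _] = set0); first by case: eqP.
  by apply/setP=> x; rewrite !inE.
have [lt_il sl'] : {in l, forall j : 'I_V, (i < j)%N} /\ sorted (fun i j : 'I_V => i < j)%N l.
  move: sl; rewrite /= path_sortedE; last by move=> x y z; apply: ltn_trans.
  by case/andP=> /allP.
have -> : [set x | (x.1 \in i :: l) && (x.2 == al x.1)] =
    (i, al i) |: [set x | (x.1 \in l) && (x.2 == al x.1)].
  apply/setP=> -[k a]; rewrite !inE xpair_eqE /= andb_orl; congr (_ || _).
  by case: (eqVneq k i) => [->|].
apply: (amp_cdag_delta (IH sl')) => /=.
  by rewrite inE /=; apply/negP => /andP[/lt_il]; rewrite ltnn.
move=> x; rewrite inE => /andP[/lt_il xl _]; rewrite /mode_lt /= negb_or -leqNgt (ltnW xl) /=.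
by rewrite negb_and; apply/orP; left; apply: contraTneq xl => ->; rewrite ltnn.
Qed.

End FockSpace.

(** * Connectivity and ground space *)

Section Hubbard.
Variables (C : numClosedFieldType) (V N : nat) (e : rel 'I_V) (t : 'I_V -> 'I_V -> C).
Implicit Types (S : fock V N) (i j h : 'I_V) (a b : 'I_N) (al : 'I_V -> 'I_N).
Hypothesis N2 : (2 < N)%N.
Hypothesis VN : (N.+1 <= V)%N.
Hypothesis sim : simple_graph e.
Hypothesis t_sym : forall i j, t i j = t j i.
Hypothesis t_gt0 : forall i j, e i j -> 0 < t i j.
Hypothesis t_eq0 : forall i j, ~~ e i j -> t i j = 0.
Hypothesis nonsep : nonseparable e.
Hypothesis not_theta0 : ~ is_theta0 e.
Hypothesis not_polygon : ~ is_polygon e.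
Hypothesis bipN : bipartite e -> (N.+2 <= V)%N.

Let V4 : (3 < V)%N. Proof. exact: leq_ltn_trans VN. Qed.
Let V0 : (0 < V)%N. Proof. exact: leq_ltn_trans VN. Qed.
Let N0 : (0 < N)%N. Proof. exact: leq_ltn_trans N2. Qed.
Let t_ge0 i j : 0 <= t i j.
Proof. by case: (boolP (e i j)) => [/t_gt0/ltW|/t_eq0 ->]. Qed.
Let t_diag i : t i i = 0.
Proof. by apply: t_eq0; have [_ ->] := sim. Qed.
Let H := Hinf N t.

Lemma conf_ext h al al' : (forall i, i != h -> al i = al' i) -> conf h al = conf h al'.
Proof.
move=> E; apply/setP=> -[i a]; rewrite !mem_conf.
by case: (boolP (i != h)) => // /E ->.
Qed.

Lemma conf_hole h h' al al' : conf h al = conf h' al' -> h = h'.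
Proof.
move=> E; apply/eqP/negPn/negP => hh'.
have := mem_conf h' al' h (al' h); rewrite -E mem_conf eqxx hh' /= => /esym.
by rewrite eqxx.
Qed.

Lemma conf_hopE h al j : flavor_count j (al \o tperm h j) =1 flavor_count h al.
Proof.
move=> b; rewrite /flavor_count -(card_imset _ (@perm_inj _ (tperm h j))).
apply: eq_card => i; apply/imsetP/idP => [[k]|].
  rewrite !inE /= => /andP[kj ab] ->; rewrite ab andbT.
  by rewrite -[X in _ != X](tpermR h j) (inj_eq perm_inj).
rewrite inE => /andP[ih ab]; exists (tperm h j i); last by rewrite tpermK.
by rewrite inE /= tpermK ab andbT -[X in _ != X](tpermL h j) (inj_eq perm_inj).
Qed.

Lemma sign_cancel (m n : nat) : (-1) ^+ (m + n) * (-1) ^+ n = (-1) ^+ m :> C.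
Proof. by rewrite exprD -mulrA -expr2 sqrr_sign mulr1. Qed.

Section Walks.
Variables (h : 'I_V) (al : 'I_V -> 'I_N).
(** The amplitude after [n] steps, freed from the sign of the basis state and from one minus sign
    per hop; its recursion has the coefficients [t], which are nonnegative. *)
Let g n h' al' : C := (-1) ^+ n * (-1) ^+ (h' : nat) *
  amp (iter n (mulmx H) (hbasis C h al)) (conf h' al').

Let g0 h' al' : g 0 h' al' = (conf h' al' == conf h al)%:R.
Proof.
rewrite /g /= amp_hbasis expr0 mul1r; case: eqP => [/conf_hole ->|_]; last by rewrite mulr0.
by rewrite -expr2 sqrr_sign.
Qed.

Let gS n h' al' : g n.+1 h' al' = \sum_j t h' j * g n j (al' \o tperm h' j).
Proof.
rewrite /g /= amp_Hinf_conf // exprS mulN1r !mulNr mulrN opprK mulr_sumr.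
apply: eq_bigr => j _; rewrite -(sign_cancel j h') addnC; ring.
Qed.

Let g_ge0 n h' al' : 0 <= g n h' al'.
Proof.
elim: n h' al' => [|n IH] h' al'; first by rewrite g0 ler0n.
by rewrite gS; apply: sumr_ge0 => j _; rewrite mulr_ge0.
Qed.

(** The recursion unfolds from the final configuration, so the walk leads from [h'] back to [h]. *)
Let g_gt0 p h' al' : path e h' p -> last h' p = h ->
  (forall i, i != h -> al i = al' (wperm h' p i)) -> 0 < g (size p) h' al'.
Proof.
elim: p h' al' => [|k p IH] h' al' /=.
  move=> _ -> E; rewrite g0 (@conf_ext h al' al) ?eqxx ?ltr01 // => i ih.
  by rewrite E // perm1.
case/andP=> ek pp lp E; rewrite gS (bigD1 k) //= ltr_pwDl //.
  rewrite mulr_gt0 ?t_gt0 // IH // => i ih.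
  by rewrite E // permM.
by apply: sumr_ge0 => j _; rewrite mulr_ge0.
Qed.

Lemma walk_amplitude p h' al' : path e h' p -> last h' p = h ->
    (forall i, i != h -> al i = al' (wperm h' p i)) ->
  dotc (hbasis C h' al') (iter (size p) (mulmx H) (hbasis C h al)) != 0.
Proof.
move=> pp lp E; rewrite /dotc sum_states (bigD1 (conf h' al')) //= big1 ?addr0 => [|S ne].
  rewrite -/(amp _ _) -/(amp _ (conf h' al')) amp_hbasis eqxx rmorphXn rmorphN1.
  have := g_gt0 pp lp E; rewrite /g -mulrA => /lt0r_neq0.
  by rewrite mulf_eq0 negb_or => /andP[].
by rewrite -/(amp _ S) amp_hbasis (negbTE ne) rmorph0 mul0r.
Qed.
End Walks.

Lemma connectivity_holds (m : 'I_N -> nat) : connectivity t m.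
Proof.
move=> h h' al al' cnt cnt'.
have [|p [pp lp p0 E]] := @coloured_walk V N e V4 sim nonsep not_theta0 not_polygon bipN h'
    h al' al.
  by move=> b; rewrite cnt cnt'.
by exists (size p); split=> //; apply: walk_amplitude.
Qed.

(** * The Perron state of each sector *)

Variables (lam : C) (psi : 'I_V -> C).
Hypothesis psi_gt0 : forall i, 0 < psi i.
Hypothesis psiE : forall i, \sum_j t i j * psi j = lam * psi i.

(* A state of one hole has exactly one empty site, so the sum has one term. *)
Definition pst S : C := if inH1 S then
  \sum_(i | [forall a, (i, a) \notin S]) (-1) ^+ (i : nat) * psi i else 0.

Lemma pst_conf h al : pst (conf h al) = (-1) ^+ h * psi h.
Proof.
rewrite /pst inH1_conf (big_pred1 h) // => i; apply/forallP/eqP => [no|-> a].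
  by have := no (al i); rewrite mem_conf eqxx andbT negbK => /eqP.
by rewrite mem_conf eqxx.
Qed.

Lemma pst_out S : ~~ inH1 S -> pst S = 0.
Proof. by rewrite /pst => /negbTE ->. Qed.

Lemma pst_neq0 S : inH1 S -> pst S != 0.
Proof.
case/(inH1P V0 N0) => h [al ->].
by rewrite pst_conf mulf_neq0 ?signr_eq0 // gt_eqF.
Qed.

Lemma conj_pst S : (pst S)^* = pst S.
Proof.
have [/(inH1P V0 N0)[h [al ->]]|/pst_out ->] := boolP (inH1 S); last by rewrite rmorph0.
by rewrite pst_conf rmorphM /= rmorphXn rmorphN1 geC0_conj // ltW.
Qed.

Definition vec (F : fock V N -> C) : 'cV[C]_(dimF V N) := \col_k F (fstate k).

Lemma amp_vec F S : amp (vec F) S = F S.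
Proof. by rewrite /amp mxE fstateK. Qed.

(** The factor [f] is unchanged by hops and [pst] depends on the hole alone up to sign, so the
    eigenvalue equation reduces to that of [psi]. *)
Lemma Hinf_eigen (f : fock V N -> C) v :
    (forall h al j, f (conf j (al \o tperm h j)) = f (conf h al)) ->
    (forall S, amp v S = f S * pst S) ->
  H *m v = (- lam) *: v.
Proof.
move=> finv vE; apply: amp_inj => S; rewrite amp_scale vE.
have [/(inH1P V0 N0)[h [al ->]]|SN] := boolP (inH1 S); last first.
  by rewrite amp_Hinf_out // pst_out // !mulr0.
rewrite amp_Hinf_conf // pst_conf.
have -> : - lam * (f (conf h al) * ((-1) ^+ h * psi h)) =
  - (f (conf h al) * (-1) ^+ h * (lam * psi h)) by ring.
rewrite -psiE mulr_sumr; congr (- _); apply: eq_bigr => j _.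
by rewrite vE finv pst_conf -[in RHS](sign_cancel h j); ring.
Qed.

Lemma weight_ge0 S S' : 0 <= - ent H S S' * pst S * pst S'.
Proof.
have [/(inH1P V0 N0)[h [al ->]]|SN] := boolP (inH1 S'); last first.
  by rewrite (pst_out SN) mulr0.
rewrite ent_Hinf_conf // -sumrN !mulr_suml; apply: sumr_ge0 => j _.
case: eqP => [->|_]; last by rewrite oppr0 !mul0r.
rewrite !pst_conf.
have -> : - (- (-1) ^+ (h + j) * t h j) * ((-1) ^+ j * psi j) * ((-1) ^+ h * psi h) =
  ((-1) ^+ (h + j) * (-1) ^+ j) * (-1) ^+ h * (t h j * psi j * psi h) by ring.
rewrite sign_cancel -expr2 sqrr_sign mul1r !mulr_ge0 //; exact: ltW.
Qed.

Lemma weight_neq0 h al j : e h j ->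
  - ent H (conf j (al \o tperm h j)) (conf h al) * pst (conf j (al \o tperm h j)) * pst
      (conf h al) != 0.
Proof.
move=> ehj; rewrite mulf_neq0 ?pst_neq0 ?inH1_conf // mulf_neq0 ?pst_neq0 ?inH1_conf //.
rewrite oppr_eq0 ent_Hinf_conf // (bigD1 j) //= eqxx big1 ?addr0 => [|k kj].
  by rewrite mulf_neq0 // ?oppr_eq0 ?signr_eq0 // gt_eqF // t_gt0.
by case: eqP => // /conf_hole jk; rewrite jk eqxx in kj.
Qed.

Lemma pst_eigen S : \sum_S' ent H S S' * pst S' = - lam * pst S.
Proof.
have := @Hinf_eigen (fun=> 1) (vec pst) (fun _ _ _ => erefl) (fun S => _).
move=> /(_ (fun S => etrans (amp_vec pst S) (esym (mul1r _)))) /(congr1 (fun v => amp v S)).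
rewrite amp_scale amp_vec amp_mul => <-.
by apply: eq_bigr => S' _; rewrite amp_vec.
Qed.

(** Off the one-hole space [v] and [pst] both vanish, so the value given to division by zero does no
    harm. *)
Lemma in_H1_ratio v S : in_H1 v -> amp v S / pst S * pst S = amp v S.
Proof.
move/in_H1P => vH; have [S1|SN] := boolP (inH1 S); first by rewrite divfK ?pst_neq0.
by rewrite vH // !mul0r.
Qed.

Lemma ratio_eigen v mu S : in_H1 v -> H *m v = mu *: v ->
  \sum_S' ent H S S' * (amp v S' / pst S' * pst S') = mu * (amp v S / pst S * pst S).
Proof.
move=> vH /(congr1 (fun v => amp v S)); rewrite amp_mul amp_scale in_H1_ratio // => <-.
by apply: eq_bigr => S' _; rewrite in_H1_ratio.
Qed.

Lemma ground_energy_holds : ground_energy N t (- lam).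
Proof.
split.
  exists (vec pst); split.
    by apply/in_H1P => S SN; rewrite amp_vec pst_out.
  split.
    apply/eqP => v0; have := pst_neq0 (inH1_conf (Ordinal V0) (fun=> Ordinal N0)).
    by rewrite -amp_vec v0 /amp mxE eqxx.
  by apply: (@Hinf_eigen (fun=> 1)) => // S; rewrite amp_vec mul1r.
move=> mu v vH v_neq0 Hv.
have [S vS] : exists S, amp v S != 0.
  apply/existsP; apply: contraNT v_neq0; rewrite negb_exists => /forallP no.
  by apply/eqP/amp_inj => S; have := no S; rewrite negbK => /eqP ->; rewrite /amp mxE.
apply: (@ground_energy_min C (fock V N) (ent H) pst (- lam) _ conj_pst pst_eigen weight_ge0 mu
  (fun S => amp v S / pst S) _ S); last by rewrite in_H1_ratio.
- by move=> S1 S2; apply: ent_Hinf_sym.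
- by move=> S1; apply: ratio_eigen.
Qed.

Lemma ground_ratio_const v h h' al al' : ground_state t (- lam) v ->
    (forall b, flavor_count h al b = flavor_count h' al' b) ->
  amp v (conf h al) / pst (conf h al) = amp v (conf h' al') / pst (conf h' al').
Proof.
move=> [vH Hv] cnt; pose f S := amp v S / pst S.
have hop k be j : e k j -> f (conf j (be \o tperm k j)) = f (conf k be).
  move=> ekj; apply: (@ground_state_const C (fock V N) (ent H) pst (- lam) _ conj_pst pst_eigen
    weight_ge0 (- lam) f _ _ _ erefl (weight_neq0 be ekj)).
  - by move=> S1 S2; apply: ent_Hinf_sym.
  - by move=> S1; apply: ratio_eigen.
have [p [pp lp _ E]] := coloured_walk V4 sim nonsep not_theta0 not_polygon bipN cnt.
rewrite -/(f _) -[RHS]/(f _).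
elim: p h al pp lp E {cnt} => [|k p IH] h al /=.
  by move=> _ <- E; congr (f _); apply: conf_ext => i ih; rewrite E // perm1.
case/andP=> ek pp lp E; rewrite -(hop _ _ _ ek); apply: IH => // i ih.
by rewrite E // permM.
Qed.

(** * The monomial basis of the ground space *)

Definition has_occ (m : {ffun 'I_N -> 'I_V}) S := [forall b, occ S b == m b :> nat].

(* With this weight the flavor generators act as [x_a d/dx_b] on monomials. *)
Definition fact_weight (m : {ffun 'I_N -> 'I_V}) : C := (\prod_b (m b)`!)%:R.

Definition occ_coef m S : C := if has_occ m S then fact_weight m else 0.

Definition sym_state m := vec (fun S => occ_coef m S * pst S).

Lemma fact_weight_neq0 m : fact_weight m != 0.
Proof. by rewrite pnatr_eq0 -lt0n prodn_gt0 // => b; apply: fact_gt0. Qed.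

Lemma has_occ_inj m m' S : has_occ m S -> has_occ m' S -> m = m'.
Proof.
move=> /forallP o /forallP o'; apply/ffunP=> b; apply: val_inj => /=.
by rewrite -(eqP (o b)) (eqP (o' b)).
Qed.

Lemma has_occ_conf m h al : has_occ m (conf h al) = [forall b, flavor_count h al b == m b
    :> nat].
Proof. by apply: eq_forallb => b; rewrite occ_conf. Qed.

Lemma sym_state_ground m : ground_state t (- lam) (sym_state m).
Proof.
split; first by apply/in_H1P => S SN; rewrite amp_vec pst_out ?mulr0.
apply: (@Hinf_eigen (occ_coef m)) => [h al j|S]; last by rewrite amp_vec.
rewrite /occ_coef !has_occ_conf.
by under eq_forallb do rewrite conf_hopE.
Qed.

Lemma sum_flavor_count h al : (\sum_b flavor_count h al b = V.-1)%N.
Proof.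
transitivity (\sum_(i | i != h) 1)%N.
  rewrite (partition_big al xpredT) //=; apply: eq_bigr => b _.
  by rewrite /flavor_count -sum1_card; apply: eq_bigl => i; rewrite inE.
by rewrite sum1_card (eq_card (B := [set~ h])) ?cardsC1 ?card_ord // => i; rewrite !inE.
Qed.

Lemma flavor_count_lt h al b : (flavor_count h al b < V)%N.
Proof.
rewrite -[X in (_ < X)%N](prednK V0) ltnS -(sum_flavor_count h al).
by rewrite (bigD1 b) //= leq_addr.
Qed.

Definition occ_ffun h al : {ffun 'I_N -> 'I_V} := [ffun b => Ordinal (flavor_count_lt h al b)].

Lemma occ_ffun_Occ h al : occ_ffun h al \in Occ V N.
Proof.
rewrite inE -(sum_flavor_count h al); apply/eqP.
by apply: eq_bigr => b _; rewrite ffunE.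
Qed.

Lemma has_occ_ffun h al : has_occ (occ_ffun h al) (conf h al).
Proof. by rewrite has_occ_conf; apply/forallP => b; rewrite ffunE. Qed.

Lemma conf_exists m : m \in Occ V N -> exists h al, has_occ m (conf h al).
Proof.
rewrite inE => /eqP sm.
pose s := flatten [seq nseq (m b) b | b <- enum 'I_N].
have cs b : count_mem b s = m b :> nat.
  rewrite count_flatten -map_comp sumnE big_map big_enum /= (bigD1 b) //= count_nseq /=
      eqxx mul1n.
  by rewrite big1 ?addn0 // => c cb; rewrite count_nseq /= (negbTE cb).
have szs : size s = V.-1.
  rewrite size_flatten /shape -map_comp sumnE big_map big_enum /= -sm.
  by apply: eq_bigr => b _; rewrite size_nseq.
have hV : (V.-1 < V)%N by rewrite prednK.
pose b0 := Ordinal N0.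
(* The hole takes the last site, and the sites before it read off the list [s]. *)
exists (Ordinal hV), (fun i => nth b0 s i); rewrite has_occ_conf; apply/forallP => b.
rewrite -cs -sum1_count (big_nth b0) big_mkord szs /flavor_count -sum1_card.
rewrite (big_ord_widen_cond V (fun i : nat => nth b0 s i == b) (fun=> 1%N)) ?leq_pred //.
apply/eqP; apply: eq_bigl => i; rewrite inE andbC; congr (_ && _).
have iV : (i <= V.-1)%N by rewrite -ltnS prednK.
by rewrite -(inj_eq val_inj) /= neq_ltn [(V.-1 < i)%N]ltnNge iV orbF.
Qed.

(** States of distinct occupations have disjoint supports, so a single term survives. *)
Lemma amp_sym_comb (c : {ffun 'I_N -> 'I_V} -> C) m S : m \in Occ V N -> has_occ m S ->
  amp (\sum_(m' in Occ V N) c m' *: sym_state m') S = c m * (fact_weight m * pst S).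
Proof.
move=> mO mS; rewrite amp_sum (bigD1 m) //= big1 ?addr0 => [|m' /andP[_ ne]].
  by rewrite amp_scale amp_vec /occ_coef mS.
rewrite amp_scale amp_vec /occ_coef; case: ifP => [m'S|_]; last by rewrite mul0r mulr0.
by rewrite (has_occ_inj m'S mS) eqxx in ne.
Qed.

Lemma sym_state_free (c : {ffun 'I_N -> 'I_V} -> C) :
  \sum_(m in Occ V N) c m *: sym_state m = 0 -> forall m, m \in Occ V N -> c m = 0.
Proof.
move=> c0 m mO; have [h [al mS]] := conf_exists mO.
have := amp_sym_comb c mO mS; rewrite c0 {1}/amp mxE => /esym/eqP.
rewrite mulf_eq0 => /orP[/eqP //|]; rewrite mulf_eq0 (negbTE (fact_weight_neq0 m)) /=.
by rewrite (negbTE (pst_neq0 (inH1_conf h al))).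
Qed.

Lemma sym_state_span v : ground_state t (- lam) v ->
  exists c : {ffun 'I_N -> 'I_V} -> C, v = \sum_(m in Occ V N) c m *: sym_state m.
Proof.
move=> gv; have [vH _] := gv.
(* A representative of the sector, which exists for [m] in [Occ]; the coefficient is the constant
   ratio of [v] to [pst] there, up to the normalising weight. *)
pose Sm m : fock V N := odflt set0 [pick S | inH1 S && has_occ m S].
exists (fun m => amp v (Sm m) / pst (Sm m) / fact_weight m).
apply: amp_inj => S.
have [/(inH1P V0 N0)[h [al SE]]|SN] := boolP (inH1 S); last first.
  have /in_H1P/(_ S SN) -> := vH; rewrite amp_sum big1 // => m _.
  by rewrite amp_scale amp_vec (pst_out SN) !mulr0.
rewrite {}SE (amp_sym_comb _ (occ_ffun_Occ h al) (has_occ_ffun h al)).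
rewrite mulrA divfK ?fact_weight_neq0 //.
suff -> : amp v (Sm (occ_ffun h al)) / pst (Sm (occ_ffun h al)) = amp v (conf h al) / pst
    (conf h al).
  by rewrite in_H1_ratio.
rewrite /Sm; case: pickP => [S' /= /andP[/(inH1P V0 N0)[h' [al' ->]] oS']|/(_ (conf h
    al))]; last first.
  by rewrite inH1_conf has_occ_ffun.
apply: ground_ratio_const => // b.
move: oS'; rewrite has_occ_conf => /forallP/(_ b)/eqP ->.
by rewrite ffunE.
Qed.

Lemma amp_Flav_diag a (v : 'cV[C]_(dimF V N)) S : amp (Flav C V a a *m v) S = (occ S a)%:R
    * amp v S.
Proof.
rewrite amp_mul (bigD1 S) //= big1 ?addr0 => [|S' ne]; rewrite /Flav ent_sum; last first.
  rewrite big1 ?mul0r // => i _; rewrite ent_hop.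
  case: ifP => // /and3P[iS _]; rewrite setD1K // => /eqP E.
  by rewrite E eqxx in ne.
congr (_ * _); transitivity (\sum_i ((i, a) \in S)%:R : C).
  apply: eq_bigr => i _; rewrite ent_hop; case: (boolP ((i, a) \in S)) => //= iS.
  by rewrite setD11 /= setD1K // eqxx jw_signD1 /jw_sign -expr2 sqrr_sign.
rewrite -natr_sum; congr _%:R; rewrite -big_mkcond /= sum1_card.
by apply: eq_card => i; rewrite inE.
Qed.

Definition upd al i b : 'I_V -> 'I_N := fun k => if k == i then b else al k.

Lemma conf_upd h al i a : i != h ->
  (i, a) |: (conf h al :\ (i, al i)) = conf h (upd al i a).
Proof.
move=> ih; apply/setP=> -[k c]; rewrite !inE !xpair_eqE /= /upd.
by have [->|ki] := eqVneq k i; rewrite /= ?ih // andNb orbF.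
Qed.

(** Changing a flavor within one site leaves the string of earlier modes as it is, so the two signs
    cancel. *)
Lemma ent_Flav_conf a b S' h al : a != b -> ent (Flav C V a b) S' (conf h al) =
  \sum_(i | (i != h) && (al i == b)) (S' == conf h (upd al i a))%:R.
Proof.
move=> ab; rewrite /Flav ent_sum [RHS]big_mkcond; apply: eq_bigr => i _.
rewrite ent_hop mem_conf (eq_sym b) -andbA.
have [ih|//] := boolP (i != h); have [bE|//] := eqVneq (al i) b.
rewrite /= -bE conf_upd // !inE /= xpair_eqE eqxx /= bE (negbTE ab) /= andbF /=.
case: eqP => // _; rewrite /jw_sign.
have -> : [set m' in conf h al :\ (i, b) | mode_lt m' (i, a)] =
    [set m' in conf h al | mode_lt m' (i, b)].
  apply/setP=> -[k c]; rewrite !inE !xpair_eqE /mode_lt /=.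
  have [->|ki] := eqVneq k i; last by rewrite !orbF.
  rewrite !ltnn bE /=; have [->|cb] := eqVneq c b; rewrite /= ?andbF //.
  by rewrite ltnn andbF.
by rewrite -expr2 sqrr_sign.
Qed.

Lemma tr_Flav a b : (Flav C V a b)^T = Flav C V b a.
Proof.
rewrite /Flav linear_sum; apply: eq_bigr => i _.
by rewrite /= trmx_mul tr_cdag tr_cann.
Qed.

(** Read through the transpose: the configurations sent to [conf h al] have one of its [a] turned
    back into [b]. *)
Lemma amp_Flav_conf a b (v : 'cV[C]_(dimF V N)) h al : a != b ->
    amp (Flav C V a b *m v) (conf h al) =
  \sum_(i | (i != h) && (al i == a)) amp v (conf h (upd al i b)).
Proof.
move=> ab; rewrite amp_mul.
under eq_bigr => S _.
  rewrite /ent -tr_Flav mxE -/(ent _ S (conf h al)) ent_Flav_conf 1?eq_sym // mulr_suml.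
  over.
rewrite exchange_big /=; apply: eq_bigr => i _.
rewrite (bigD1 (conf h (upd al i b))) //= eqxx mul1r big1 ?addr0 // => S /negbTE ->.
by rewrite mul0r.
Qed.

Lemma amp_Flav_out a b (v : 'cV[C]_(dimF V N)) S' : a != b -> in_H1 v -> ~~ inH1 S' ->
  amp (Flav C V a b *m v) S' = 0.
Proof.
move=> ab /in_H1P vH S'N; rewrite amp_mul big1 // => S _.
have [/(inH1P V0 N0)[h [al ->]]|/vH ->] := boolP (inH1 S); last by rewrite mulr0.
rewrite ent_Flav_conf // big1 ?mul0r // => i _.
by case: eqP => // E; rewrite E inH1_conf in S'N.
Qed.

Lemma flavor_count_upd h al i a b c : i != h -> al i = a -> a != b ->
  (flavor_count h (upd al i b) c + (c == a) = flavor_count h al c + (c == b))%N.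
Proof.
move=> ih ai ab; rewrite /flavor_count.
rewrite (cardsD1 i [set k | (k != h) && (upd al i b k == c)]).
rewrite (cardsD1 i [set k | (k != h) && (al k == c)]) !inE ih /= /upd eqxx ai.
have -> : [set k | (k != h) && ((if k == i then b else al k) == c)] :\ i =
    [set k | (k != h) && (al k == c)] :\ i.
  by apply/setP=> k; rewrite !inE; case: (eqVneq k i).
by rewrite (eq_sym b) (eq_sym a) [LHS]addnC addnA [RHS]addnAC.
Qed.

Lemma has_occ_upd m h al i a b : i != h -> al i = a -> a != b ->
  has_occ m (conf h (upd al i b)) = shifted m (occ_ffun h al) a b.
Proof.
move=> ih ai ab; rewrite has_occ_conf /shifted !ffunE /=.
have U c := flavor_count_upd c ih ai ab.
apply/forallP/and3P => [o|[/eqP oa /eqP ob /forallP oc] c].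
  have := U a; have := U b; rewrite !eqxx (negbTE ab) (eq_sym b) (negbTE ab).
  rewrite !(eqP (o _)) => Ub Ua; split; [by apply/eqP; lia| by apply/eqP; lia|].
  apply/forallP=> c; apply/implyP=> /andP[/negbTE ca /negbTE cb].
  by have := U c; rewrite ca cb (eqP (o c)) !addn0 -(inj_eq val_inj) ffunE /= => ->.
have := U c; have [->|ca] := eqVneq c a.
  by rewrite (negbTE ab) oa; move=> h1; apply/eqP; lia.
have [->|cb] := eqVneq c b; first by move=> h1; apply/eqP; lia.
have := oc c; rewrite ca cb /= -(inj_eq val_inj) ffunE /= => /eqP ->.
by rewrite !addn0 => ->.
Qed.

(** At a configuration of occupation [m'], the generator collects [m' a] equal amplitudes. The
    factorials trade this count for the coefficient [m b] of [x_a d/dx_b]. *)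
Lemma fact_weight_shift (m m' : {ffun 'I_N -> 'I_V}) a b : a != b -> shifted m m' a b ->
  (m' a)%:R * fact_weight m = (m b)%:R * fact_weight m'.
Proof.
move=> ab /and3P[/eqP ma /eqP mb /forallP mc].
rewrite /fact_weight -!natrM; congr _%:R.
rewrite (bigD1 a) //= (bigD1 b) 1?eq_sym //= [in RHS](bigD1 a) //= [in RHS](bigD1 b)
    1?eq_sym //=.
rewrite (eq_bigr (fun c => (m' c)`!)); last first.
  by move=> c cab; have /implyP/(_ cab)/eqP -> := mc c.
rewrite ma -mb !factS; move: (m a).+1 (m a)`! (m' b).+1 (m' b)`! (\prod_(_ | _) _)%N => x1
    x2 x3 x4 x5.
by rewrite [RHS]mulnCA -!mulnA; congr (x1 * _)%N; rewrite [RHS]mulnCA.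

Qed.

Lemma Flav_sym_state m a b : m \in Occ V N -> a != b ->
  Flav C V a b *m sym_state m =
  \sum_(m' in Occ V N | shifted m m' a b) (m b)%:R *: sym_state m'.
Proof.
move=> mO ab; apply: amp_inj => S.
have [/(inH1P V0 N0)[h [al ->]]|SN] := boolP (inH1 S); last first.
  rewrite amp_Flav_out // ?amp_sum ?big1 //; last by have [] := sym_state_ground m.
  by move=> m' _; rewrite amp_scale amp_vec (pst_out SN) !mulr0.
rewrite amp_Flav_conf //.
pose m0 := occ_ffun h al.
have -> : \sum_(i | (i != h) && (al i == a)) amp (sym_state m) (conf h (upd al i b)) =
    \sum_(i | (i != h) && (al i == a)) (if shifted m m0 a b then fact_weight m else 0) *
        pst (conf h al).
  apply: eq_bigr => i /andP[ih /eqP ai].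
  by rewrite amp_vec /occ_coef (has_occ_upd _ ih ai ab) !pst_conf.
rewrite sumr_const -[#|_|]/(#|[pred i | (i != h) && (al i == a)]|).
have -> : #|[pred i | (i != h) && (al i == a)]| = m0 a.
  by rewrite /m0 ffunE /=; apply: eq_card => i; rewrite !inE.
rewrite amp_sum.
have [sh|nsh] := boolP (shifted m m0 a b); last first.
  rewrite mul0r mul0rn big1 // => m' /andP[_ sm'].
  rewrite amp_scale amp_vec /occ_coef; case: ifP => [om'|_]; last by rewrite mul0r mulr0.
  by move: sm'; rewrite (has_occ_inj om' (has_occ_ffun h al)) (negbTE nsh).
rewrite (bigD1 m0) /=; last by rewrite occ_ffun_Occ.
rewrite big1 ?addr0 => [|m' /andP[_ ne]].
  rewrite amp_scale amp_vec /occ_coef has_occ_ffun mulrA -(fact_weight_shift ab sh).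
  by rewrite -mulrA mulr_natl.
rewrite amp_scale amp_vec /occ_coef; case: ifP => [om'|_]; last by rewrite mul0r mulr0.
by rewrite (has_occ_inj om' (has_occ_ffun h al)) eqxx in ne.
Qed.

Lemma symmetric_irrep_holds : ground_space_is_symmetric_irrep N t (- lam).
Proof.
exists sym_state; split.
- by move=> m _; apply: sym_state_ground.
- exact: sym_state_free.
- exact: sym_state_span.
- move=> m a _; apply: amp_inj => S; rewrite amp_Flav_diag amp_scale amp_vec /occ_coef.
  by case: ifP => [/forallP/(_ a)/eqP ->//|_]; rewrite mul0r !mulr0.
- exact: Flav_sym_state.
Qed.

End Hubbard.

Theorem theorem2 (C : numClosedFieldType) (N V : nat) (e : rel 'I_V)
    (t : 'I_V -> 'I_V -> C) :
  (2 < N)%N -> (N.+1 <= V)%N ->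
  simple_graph e ->
  (forall i j, t i j = t j i) ->
  (forall i j, e i j -> 0 < t i j) ->
  (forall i j, ~~ e i j -> t i j = 0) ->
  nonseparable e ->
  ~ is_theta0 e ->
  ~ is_polygon e ->
  (bipartite e -> (N.+2 <= V)%N) ->
  (forall m : 'I_N -> nat, (\sum_(b < N) m b)%N = V.-1 -> connectivity t m) /\
  exists E0 : C, ground_energy N t E0 /\ ground_space_is_symmetric_irrep N t E0.
Proof.
move=> N2 VN sim t_sym t_gt0 t_eq0 nonsep nth npoly bip; split.
  by move=> m _; apply: (connectivity_holds N2 VN sim t_sym t_gt0 t_eq0).
have t_ge0 i j : 0 <= t i j.
  by case: (boolP (e i j)) => [/t_gt0/ltW|/t_eq0 ->].
have [conn _] := nonsep.
have V0 : (0 < V)%N by apply: leq_ltn_trans VN.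
have [lam [psi [psi_gt0 psiE]]] := perron_vector V0 t_sym t_ge0 t_gt0 conn.
(* Every hop has a negative matrix element, so the ground energy is minus the Perron eigenvalue of
   [t]. *)
exists (- lam); split.
  exact: (ground_energy_holds N2 VN sim t_sym t_gt0 t_eq0 psi_gt0 psiE).
exact: (symmetric_irrep_holds N2 VN sim t_sym t_gt0 t_eq0 nonsep nth npoly bip psi_gt0 psiE).
Qed.
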